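(* Let $(v,\nu)$ be a conservative solution of the generalized Hunter-Saxton system with initial datum $(\bar u,\bar\mu)\in\mathcal D$. Then there exists a unique characteristic $y_1(\alpha,t)$ satisfying $$\frac{\partial}{\partial t}y_1(\alpha,t)=v(y_1(\alpha,t),t),\qquad y_1(\alpha,0)=\bar x(\alpha),$$ and $$\nu(t)\big((-\infty,y_1(\alpha,t))\big)\le\alpha-\bar x(\alpha)\le\nu(t)\big((-\infty,y_1(\alpha,t)]\big)$$ for any $\alpha\in\mathbb R$ and a.e. $t\in\mathbb R$, where $\bar x(\alpha)$ is the unique real number satisfying $\bar x(\alpha)+\bar\mu((-\infty,\bar x(\alpha)))\le\alpha\le\bar x(\alpha)+\bar\mu((-\infty,\bar x(\alpha)])$. The uniqueness of characteristics and conservative solutions follows, i.e. $(v,\nu)=(u,\mu)$, where, with $y(\alpha,t)=\bar x(\alpha)+\bar u(\bar x(\alpha))t+\frac{t^2}4(\alpha-\bar x(\alpha))$ and $f(\alpha)=1-\bar x'(\alpha)$, $$u(x,t)=\frac{\partial}{\partial t}y(\alpha,t)=\bar u(\bar x(\alpha))+\frac t2(\alpha-\bar x(\alpha))\ \text{ for }x=y(\alpha,t),\qquad \mu(t)=y(\cdot,t)\#(f\,d\alpha).$$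
   Context: $\mathcal M_+(\mathbb R)$ is the set of finite positive Radon measures on $\mathbb R$ endowed with the weak topology (testing against bounded continuous functions). $C_b(\mathbb R)$ is the space of bounded continuous functions with the sup norm. $\mathcal D$ is the set of pairs $(u,\mu)$ with $u\in C_b(\mathbb R)$, $u_x\in L^2(\mathbb R)$, $\mu\in\mathcal M_+(\mathbb R)$, and $d\mu_{ac}=u_x^2\,dx$, where $\mu_{ac}$ is the absolutely continuous part of $\mu$ with respect to Lebesgue measure. $(T\#\nu)(E)=\nu(T^{-1}(E))$ is the push-forward. The function $\bar x$ is nondecreasing and 1-Lipschitz, so $\bar x'$ exists a.e. The generalized Hunter-Saxton system is: $u_t+uu_x=\frac12\int_{-\infty}^x d\mu(t)$, $\ \mu_t+(u\mu)_x=0$, $\ d\mu_{ac}(t)=u_x^2(\cdot,t)\,dx$. Conservative solution: given $(\bar u,\bar\mu)\in\mathcal D$, a pair $(u(t),\mu(t))_{t\in\mathbb R}$ is a (global-in-time) conservative solution with initial datum $(\bar u,\bar\mu)$ if (1) $u\in C(\mathbb R;C_b(\mathbb R))\cap C^{1/2}_{loc}(\mathbb R\times\mathbb R)$, $u_t\in L^2_{loc}(\mathbb R\times\mathbb R)$, $u_x(\cdot,t)\in L^2(\mathbb R)$ for all $t\in\mathbb R$, and $\mu\in C(\mathbb R;\mathcal M_+(\mathbb R))$; (2) $(u(\cdot,0),\mu(0))=(\bar u,\bar\mu)$, and $d\mu(t)=u_x^2(x,t)\,dx$ for a.e. $t\in\mathbb R$; (3) $\int_{\mathbb R}\int_{\mathbb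 R}\big[u\phi_t-\phi(uu_x-\tfrac12F)\big]\,dx\,dt=0$ for all $\phi\in C_c^\infty(\mathbb R\times\mathbb R)$, where $F(x,t)=\int_{-\infty}^x d\mu(t)$ (well defined for a.e. $t$ by (2)); (4) $\int_{\mathbb R}\int_{\mathbb R}(\phi_t+u\phi_x)\,d\mu(t)\,dt=0$ for all $\phi\in C_c^\infty(\mathbb R\times\mathbb R)$; (5) $d\mu_{ac}(t)=u_x^2(\cdot,t)\,dx$ for all $t\in\mathbb R$. *)

(* Defs.v *)
From HB Require Import structures.
From mathcomp Require Import all_boot all_order all_algebra.
From mathcomp Require Import lra.
From mathcomp Require Import all_classical all_reals all_analysis.

Set Implicit Arguments.
Unset Strict Implicit.
Unset Printing Implicit Defensive.

Import Order.TTheory GRing.Theory Num.Theory.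
Import numFieldNormedType.Exports.

Local Open Scope classical_set_scope.
Local Open Scope ring_scope.

(* Functions of (x, t) are functions on [R * R], with x the first component.
   [R] carries its Borel sigma-algebra, [measurableTypeR R]; a finite Borel
   measure on the line is automatically Radon, so that M_+(R) is the type
   [finBorel R]. *)

Notation borelR R := (measurableTypeR R).
Notation finBorel R := {finite_measure set (borelR R) -> \bar R}.
Notation leb R := (@lebesgue_measure R).
Notation leb2 R := (@lebesgue_measure R \x @lebesgue_measure R)%E.

Section TestFunctions.
Context {R : realType}.

(* In finite dimension this is the usual C^n: all directional derivatives
   exist everywhere and are C^(n-1). *)
Fixpoint Cn {V : normedModType R} (n : nat) (f : V -> R) : Prop :=
  continuous f /\
  (if n is m.+1 then forall v, (forall p, derivable f p v) /\ Cn m ('D_v f)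
   else True).

Definition smooth {V : normedModType R} (f : V -> R) := forall n, Cn n f.

Definition test_function {V : normedModType R} (phi : V -> R) :=
  smooth phi /\ compact (closure [set p | phi p != 0]).

Definition Dx (phi : R * R -> R) : R * R -> R := 'D_(1, 0) phi.
Definition Dt (phi : R * R -> R) : R * R -> R := 'D_(0, 1) phi.

End TestFunctions.

Section FunctionSpaces.
Context {R : realType}.

Definition Cb (f : R -> R) := continuous f /\ bounded_fun f.

Definition weak_derivative (f g : R -> R) :=
  forall phi : R -> R, test_function phi ->
    \int[leb R]_x (f x * derive1 phi x) = - \int[leb R]_x (g x * phi x).

Definition weak_Dt (u g : R * R -> R) :=
  forall phi : R * R -> R, test_function phi ->
    \int[leb2 R]_p (u p * Dt phi p) =
    - \int[leb2 R]_p (g p * phi p).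

Definition L2 (f : R -> R) : Prop :=
  (f : borelR R -> R) \in Lfun (leb R) 2%:E.

Definition L2_loc (g : R * R -> R) :=
  measurable_fun [set: borelR R * borelR R] g /\
  forall K : set (R * R), compact K ->
    (\int[leb2 R]_(p in K) ((g p) ^+ 2)%:E < +oo)%E.

Definition holder_half_loc (u : R * R -> R) :=
  forall K : set (R * R), compact K ->
    exists C : R, forall p q, K p -> K q ->
      `|u p - u q| <= C * Num.sqrt `|p - q|.

Definition continuous_to_Cb (u : R * R -> R) :=
  (forall t, Cb (fun x => u (x, t))) /\
  forall t0, {uniform, (fun t x => u (x, t)) @ t0 --> (fun x => u (x, t0))}.

Definition weakly_continuous (mu : R -> finBorel R) :=
  forall g : R -> R, Cb g -> continuous (fun t => \int[mu t]_x g x).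

End FunctionSpaces.

Section AbsolutelyContinuousPart.
Context {R : realType}.
Implicit Types m mu : {measure set (borelR R) -> \bar R}.

Definition mutually_singular m1 m2 :=
  exists N : set (borelR R), [/\ measurable N, m1 N = 0%E & m2 (~` N) = 0%E].

Definition is_ac_part mac mu :=
  mac `<< leb R /\
  exists ms : {measure set (borelR R) -> \bar R},
    mutually_singular ms (leb R) /\
    forall A, measurable A -> mu A = (mac A + ms A)%E.

Definition has_density (g : R -> R) mu :=
  forall A : set (borelR R), measurable A ->
    mu A = (\int[leb R]_(x in A) (g x)%:E)%E.

Definition ac_density (g : R -> R) mu :=
  exists2 mac : {measure set (borelR R) -> \bar R},
    is_ac_part mac mu & has_density g mac.

End AbsolutelyContinuousPart.

Section HunterSaxton.
Context {R : realType}.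

Definition in_D (ub : R -> R) (mub : finBorel R) :=
  Cb ub /\
  exists ux : R -> R,
    [/\ weak_derivative ub ux, L2 ux & ac_density (fun x => ux x ^+ 2) mub].

(* The choice of ]-oo, x] rather than ]-oo, x[ only matters at the (countably
   many) atoms of [mu t]. *)
Definition cdfF (mu : R -> finBorel R) (x t : R) : R :=
  fine (mu t `]-oo, x]%classic).

(* [ux] gives, for every t, a representative of the weak derivative
   u_x(., t); only integrals in x involve it. *)
Definition conservative_solution (ub : R -> R) (mub : finBorel R)
    (u : R * R -> R) (mu : R -> finBorel R) :=
  exists ux : R -> R -> R,
  [/\ [/\ continuous_to_Cb u,
          holder_half_loc u,
          (exists2 ut, L2_loc ut & weak_Dt u ut),
          (forall t, weak_derivative (fun x => u (x, t)) (ux ^~ t) /\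
                     L2 (ux ^~ t)) &
          weakly_continuous mu],
      [/\ (forall x, u (x, 0) = ub x),
          (forall A : set (borelR R), measurable A -> mu 0 A = mub A) &
          {ae leb R, forall t, has_density (fun x => ux x t ^+ 2) (mu t)}],
      (forall phi : R * R -> R, test_function phi ->
        \int[leb R]_t \int[leb R]_x
          (u (x, t) * Dt phi (x, t) -
           phi (x, t) * (u (x, t) * ux x t - 2^-1 * cdfF mu x t)) = 0),
      (forall phi : R * R -> R, test_function phi ->
        \int[leb R]_t \int[mu t]_x
          (Dt phi (x, t) + u (x, t) * Dx phi (x, t)) = 0) &
      (forall t, ac_density (fun x => ux x t ^+ 2) (mu t))].

Definition xbar_spec (mub : finBorel R) (alpha x : R) : Prop :=
  (x%:E + mub `]-oo, x[%classic <= alpha%:E)%E /\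
  (alpha%:E <= x%:E + mub `]-oo, x]%classic)%E.

Lemma xbar_spec_unique (mub : finBorel R) (alpha x y : R) :
  xbar_spec mub alpha x -> xbar_spec mub alpha y -> x = y.
Proof.
wlog xy : x y / x < y.
  move=> H hx hy; have [xy|yx|//] := ltgtP x y; first exact: (H x y).
  by apply/esym; exact: (H y x).
move=> [_ hx] [hy _].
have : (mub `]-oo, x]%classic <= mub `]-oo, y[%classic)%E.
  apply: le_measure; rewrite ?inE; [exact: measurable_itv..|].
  by apply: subset_itvl; rewrite bnd_simp.
move: (le_trans hy hx).
rewrite -(@fineK _ (mub `]-oo, x]%classic)) ?fin_num_measure//.
rewrite -(@fineK _ (mub `]-oo, y[%classic)) ?fin_num_measure//.
by rewrite -!EFinD !lee_fin; lra.
Qed.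

Lemma xbar_spec_exists (mub : finBorel R) (alpha : R) :
  exists x, xbar_spec mub alpha x.
Proof.
pose F x := fine (mub `]-oo, x[%classic).
have FE x : mub `]-oo, x[%classic = (F x)%:E.
  by rewrite fineK// fin_num_measure.
pose S := [set x | x + F x <= alpha].
have F0 x : 0 <= F x by apply: fine_ge0.
have SU : has_sup S.
  split.
    exists (alpha - fine (mub setT)); rewrite /S/=.
    suff : F (alpha - fine (mub setT)) <= fine (mub setT) by lra.
    apply: fine_le; rewrite ?fin_num_measure//.
    by apply: le_measure; rewrite ?inE.
  by exists alpha => x; rewrite /S/=; have := F0 x; lra.
have Fmono x y : x <= y -> F x <= F y.
  move=> xy; apply: fine_le; rewrite ?fin_num_measure//.
  apply: le_measure; rewrite ?inE//.
  by apply: subset_itvl; rewrite bnd_simp.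
pose s := sup S.
have inv_anti (i j : nat) : (i <= j)%N -> (j.+1%:R^-1 : R) <= i.+1%:R^-1.
  by move=> ij; rewrite lef_pV2 ?posrE// ler_nat ltnS.
exists s; split.
- pose E n : set (borelR R) := `]-oo, s - n.+1%:R^-1[%classic.
  have UE : \bigcup_n E n = `]-oo, s[%classic.
    apply/seteqP; split => [x [n _]|x]; rewrite /E/= !in_itv/=.
      by move=> h; apply: (lt_le_trans h); rewrite lerBlDr lerDl.
    move=> /ltr_add_invr[n xns].
    by exists n => //=; rewrite in_itv/= ltrBrDr.
  have : mub \o E @ \oo --> mub (\bigcup_n E n).
    apply: nondecreasing_cvg_mu.
    - by move=> i; exact: measurable_itv.
    - by rewrite UE; exact: measurable_itv.
    - move=> i j ij; apply/subsetPset; apply: subset_itvl; rewrite bnd_simp.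
      by rewrite lerD2l lerN2; exact: inv_anti.
  rewrite UE => cE; rewrite -leeBrDl// -EFinB.
  apply: (cvge_to_le cE); apply: nearW => n /=; rewrite FE lee_fin.
  rewrite lerBrDl; apply/ler_addgt0Pr => e e0.
  have : 0 < (n.+1%:R^-1 : R) by [].
  move: (n.+1%:R^-1 : R) => i i0.
  have m0 : 0 < Num.min e i by rewrite lt_min e0.
  have [z Sz sz] := sup_adherent m0 SU.
  have me : Num.min e i <= e by rewrite ge_min lexx.
  have mi : Num.min e i <= i by rewrite ge_min lexx orbT.
  rewrite -/s in sz; rewrite /S/= in Sz.
  have : F (s - i) <= F z by apply: Fmono; lra.
  by lra.
- pose E n : set (borelR R) := `]-oo, s + n.+1%:R^-1[%classic.
  have IE : \bigcap_n E n = `]-oo, s]%classic by rewrite -itvNycEbigcap.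
  have cE : mub \o E @ \oo --> mub (\bigcap_n E n).
    apply: nonincreasing_cvg_mu.
    - by rewrite ltey_eq fin_num_measure//; exact: measurable_itv.
    - by move=> i; exact: measurable_itv.
    - by rewrite IE; exact: measurable_itv.
    - move=> i j ij; apply/subsetPset; apply: subset_itvl; rewrite bnd_simp.
      by rewrite lerD2l; exact: inv_anti.
  rewrite IE in cE; apply/lee_addgt0Pr => e e0.
  rewrite -addeA -leeBlDl// -leeBlDr// -!EFinB.
  apply: (cvge_to_ge cE).
  have [n _ hn] := near_infty_natSinv_lt (PosNum e0).
  exists n => // m /hn/= me; rewrite FE lee_fin.
  have : 0 < (m.+1%:R^-1 : R) by [].
  move: (m.+1%:R^-1 : R) me => i ie i0.
  rewrite leNgt; apply/negP => h.
  have : S (s + i) by rewrite /S/=; lra.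
  by move/(ub_le_sup SU.2); rewrite -/s; lra.
Qed.

Definition xbar (mub : finBorel R) (alpha : R) : R :=
  get [set x | xbar_spec mub alpha x].

Lemma xbarP (mub : finBorel R) (alpha : R) :
  xbar_spec mub alpha (xbar mub alpha).
Proof. by apply: getPex; exact: xbar_spec_exists. Qed.

Definition ychar (ub : R -> R) (mub : finBorel R) (alpha t : R) : R :=
  xbar mub alpha + ub (xbar mub alpha) * t
  + t ^+ 2 / 4 * (alpha - xbar mub alpha).

(* The derivative of the 1-Lipschitz function [xbar] exists almost
   everywhere; [derive1] takes a default value on the remaining null set. *)
Definition fdens (mub : finBorel R) (alpha : R) : R :=
  1 - derive1 (xbar mub) alpha.

Definition mu_formula (ub : R -> R) (mub : finBorel R) (t : R) :
    set (borelR R) -> \bar R :=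
  pushforward (fun E : set (borelR R) =>
      (\int[leb R]_(alpha in E) (fdens mub alpha)%:E)%E)
    (fun alpha : borelR R => ychar ub mub alpha t : borelR R).

End HunterSaxton.

(* Main.v *)
Require Import Defs.
From HB Require Import structures.
From mathcomp Require Import all_boot all_order all_algebra.
From mathcomp Require Import ring lra.
From mathcomp Require Import all_classical all_reals all_analysis.
From mathcomp Require Import measurable_realfun.
Import Order.TTheory GRing.Theory Num.Theory.
Import numFieldNormedType.Exports.
Local Open Scope classical_set_scope.
Local Open Scope ring_scope.
Set Implicit Arguments.
Unset Strict Implicit.
Unset Printing Implicit Defensive.

(** The distribution function [F x t = nu t (]-oo, x])] is transported by [v],
    so each level set [{x | F (x-) t <= m <= F x t}] moves with velocity [v]:
    comparing with straight barriers [x = z + c t] on which [v - c] has a sign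
    shows that its endpoints are characteristics. For a.e. [t] the measure
    [nu t] has density [v_x ^ 2], so [v] is constant on a level set, and by
    continuity all curves staying in the same level have the same velocity at
    all times. This yields existence and uniqueness of the characteristic of
    each level.

    Along such a characteristic [xi], the average of [v] over a window of
    width [e] around [xi t] has derivative
    [\int (v - v(xi)) ^ 2 g' / 2 + F g / 2]. By Cauchy-Schwarz,
    [(v x - v (xi)) ^ 2 <= |x - xi| |F x - F (xi)|], so as [e] tends to [0] the
    first term vanishes and the second tends to [m / 2], for a.e. [t].
    Dominated convergence gives [v (xi t) t = v (xi 0) 0 + m t / 2], so the
    characteristics are the explicit parabolas, and [nu t] is recovered from
    its values on half-lines. *)

(** * Smooth cutoff functions *)

(** In general [v] is only Hölder continuous of exponent 1/2 in [x], so the characteristic equation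
    alone does not determine its solutions; the level condition supplies the missing information.
    For the same reason a test function carried along a characteristic is not known to be smooth.
    All moving test functions therefore travel along straight lines, and a curve is reached either
    by trapping it with lines whose slopes differ from [v] by [e], or by comparing it with its
    tangent at one instant.

    The equations hold weakly in time. Each tested quantity and its candidate derivative are
    continuous in [t], by weak continuity of [nu] and continuity of [v] as a curve in [C_b], so the
    weak derivatives in [t] are classical at every time, including those at which [nu t] has atoms.

    The extreme levels need separate care: a level [m <= 0] may have no left endpoint, a level that
    reaches the total mass may have no right endpoint, and for zero mass both can be missing. Time
    runs in both directions, hence the factors [t - s] and the signs of [h] in the barrier
    estimates. *)

Section DerivativeEpsilon.
Context {R : realType}.
Implicit Types (f : R -> R) (x a : R).

(** Without difference quotients the increment [h = 0] needs no exception, and explicit error terms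
    can be fed in directly, as the barrier and tangent arguments do. *)
Lemma is_derive_epsP f x a :
  is_derive x 1 f a <->
  (forall e : R, 0 < e -> exists2 d : R, 0 < d &
     forall h, `|h| < d -> `|f (x + h) - f x - a * h| <= e * `|h|).
Proof.
split=> [[df <-] e e0|H].
  move: df; rewrite /derivable => /cvgrPdist_le/(_ _ e0).
  rewrite -/(derive f x 1) => -[d /= d0 H]; exists d => // h hd.
  have [->|h0] := eqVneq h 0.
    by rewrite addr0 subrr mulr0 subrr normr0 mulr0.
  have := H h; rewrite /= sub0r normrN => /(_ hd h0).
  rewrite -/(derive f x 1).
  rewrite (_ : h *: 1 + x = x + h); last by rewrite /GRing.scale/= mulr1 addrC.
  rewrite [h^-1 *: _]/GRing.scale/= distrC => Hh.
  rewrite (_ : _ - _ = h * (h^-1 * (f (x + h) - f x) - 'D_1 f x)).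
    by rewrite normrM mulrC ler_wpM2r.
  by field.
have cv : (fun h => h^-1 *: ((f \o shift x) (h *: 1) - f x)) @ 0^' --> a.
  apply/cvgrPdist_le => e e0; have [d d0 Hd] := H e e0.
  exists d => // h hd0 h0.
  have hd : `|h| < d by have := hd0; rewrite /ball_/= sub0r normrN.
  rewrite /=.
  rewrite (_ : h *: 1 + x = x + h); last by rewrite /GRing.scale/= mulr1 addrC.
  rewrite [h^-1 *: _]/GRing.scale/= distrC.
  have -> : h^-1 * (f (x + h) - f x) - a = h^-1 * (f (x + h) - f x - a * h).
    by field.
  by rewrite normrM normfV ler_pdivrMl ?normr_gt0// [leRHS]mulrC Hd.
by split; [apply/cvg_ex; exists a|apply/cvg_lim].
Qed.

Lemma is_derive_continuous f x a : is_derive x 1 f a -> {for x, continuous f}.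
Proof. by move=> [df _]; exact/differentiable_continuous/derivable1_diffP. Qed.

Lemma is_derive_derive1 f x a : is_derive x 1 f a -> derive1 f x = a.
Proof. by move=> [_ <-]; rewrite derive1E. Qed.

End DerivativeEpsilon.

Section SmoothFunctions.
Context {R : realType} {V : normedModType R}.
Implicit Types (f g h : V -> R).

Lemma Cn_continuous n f : Cn n f -> continuous f.
Proof. by case: n => [|n] []. Qed.

Lemma CnW n f : Cn n.+1 f -> Cn n f.
Proof.
elim: n f => [|n IH] f /= [cf Hf]; first by split.
by split=> // v; have [df Df] := Hf v; split => //; exact: IH.
Qed.

Lemma Cn_cst n (c : R) : Cn n (cst c : V -> R).
Proof.
elim: n c => [|n IH] c /=; first by split=> // x; exact: cvg_cst.
split=> [x|v]; first exact: cvg_cst.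
split=> [p|]; first exact: derivable_cst.
by rewrite (_ : 'D_v _ = cst 0)//; apply/funext => p; rewrite derive_cst.
Qed.

Lemma CnD n f g : Cn n f -> Cn n g -> Cn n (f + g).
Proof.
elim: n f g => [|n IH] f g /= [cf Hf] [cg Hg].
  by split=> // x; apply: cvgD; [exact: cf|exact: cg].
split=> [x|v]; first by apply: cvgD; [exact: cf|exact: cg].
have [df Df] := Hf v; have [dg Dg] := Hg v.
split=> [p|]; first exact: derivableD.
rewrite (_ : 'D_v _ = 'D_v f + 'D_v g); first exact: IH.
by apply/funext => p; rewrite deriveD.
Qed.

Lemma CnM n f g : Cn n f -> Cn n g -> Cn n (f * g).
Proof.
elim: n f g => [|n IH] f g Cf Cg.
  case: Cf Cg => cf _ [cg _].
  by split=> // x; apply: cvgM; [exact: cf|exact: cg].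
have [cf Hf] := Cf; have [cg Hg] := Cg.
split=> [x|v]; first by apply: cvgM; [exact: cf|exact: cg].
have [df Df] := Hf v; have [dg Dg] := Hg v.
split=> [p|]; first exact: derivableM.
rewrite (_ : 'D_v _ = f * 'D_v g + g * 'D_v f).
  by apply: CnD; apply: IH => //; exact: CnW.
by apply/funext => p; rewrite deriveM.
Qed.

Lemma CnN n f : Cn n f -> Cn n (- f).
Proof.
move=> Cf; rewrite (_ : - f = cst (-1) * f); first exact/CnM/Cf/Cn_cst.
by apply/funext => x /=; rewrite !fctE mulN1r.
Qed.

Lemma CnV n f : (forall p, f p != 0) -> Cn n f -> Cn n (fun p => (f p)^-1).
Proof.
move=> f0; elim: n => [|n IH] Cf.
  by case: Cf => cf _; split=> // x; apply: cvgV => //; exact: cf.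
have [cf Hf] := Cf.
split=> [x|v]; first by apply: cvgV => //; exact: cf.
have [df Df] := Hf v.
split=> [p|]; first exact: derivableV.
rewrite (_ : 'D_v _ = - ((fun p => (f p)^-1) * ((fun p => (f p)^-1) * 'D_v f))).
  have Ci := IH (CnW Cf).
  by apply: CnN; apply: CnM => //; apply: CnM.
apply/funext => p; rewrite deriveV// /GRing.scale/= !fctE.
by rewrite -exprVn mulNr expr2 mulrA.
Qed.

(** Since [l] is affine, the difference quotients of [f \o l] along [v] are literally those of [f]
    along [dl v]. The derivative is thus again a composite with [l], which closes the induction. *)
Lemma Cn_comp_affine n (f : R -> R) (l dl : V -> R) : continuous l ->
  (forall p v (h : R), l (h *: v + p) = h * dl v + l p) ->
  Cn n f -> Cn n (f \o l).
Proof.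
move=> cl Hl; elim: n f => [|n IH] f [cf Hf].
  by split=> // x; apply: continuous_comp; [exact: cl|exact: cf].
split=> [x|v]; first by apply: continuous_comp; [exact: cl|exact: cf].
have [df Df] := Hf (dl v).
have E p : (fun k : R => k^-1 *: (((f \o l) \o shift p) (k *: v) - (f \o l) p))
         = (fun k => k^-1 *: ((f \o shift (l p)) (k *: dl v) - f (l p))).
  by apply/funext => k /=; rewrite Hl.
split=> [p|]; first by rewrite /derivable E; exact: df.
rewrite (_ : 'D_v _ = 'D_(dl v) f \o l); first exact: IH.
by apply/funext => p; rewrite /derive E.
Qed.

End SmoothFunctions.

Section SmoothStep.
Context {R : realType}.
Implicit Types (p : {poly R}) (x : R).

Lemma expr_expRN_bounded k :
  exists C : R, forall y : R, 0 < y -> y ^+ k * expR (- y) <= C.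
Proof.
exists (k%:R ^+ k) => y y0; case: k => [|k].
  by rewrite !expr0 mul1r expR_le1 oppr_le0 ltW.
have ky : 0 < y / k.+1%:R by rewrite divr_gt0.
rewrite expRN ler_pdivrMr ?expR_gt0//.
have {2}-> : y = k.+1%:R * (y / k.+1%:R) by rewrite mulrCA divff ?mulr1.
rewrite expRM_natl -exprMn lerXn2r ?nnegrE ?(ltW y0) ?mulr_ge0 ?expR_ge0//.
rewrite -ler_pdivrMl// mulrC.
by rewrite (le_trans _ (expR_ge1Dx _))// lerDr.
Qed.

(** The power [y ^+ k] is carried along for the induction on [p]: multiplying [p] by the variable
    amounts to raising [k] by one. *)
Lemma horner_expRN_bounded p k :
  exists C : R, forall y : R, 0 < y -> `|p.[y]| * y ^+ k * expR (- y) <= C.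
Proof.
elim/poly_ind: p k => [|p c IH] k.
  by exists 0 => y _; rewrite horner0 normr0 !mul0r.
have [C1 H1] := IH k.+1; have [C2 H2] := @expr_expRN_bounded k.
exists (C1 + `|c| * C2) => y y0.
rewrite hornerMXaddC.
apply: (@le_trans _ _ ((`|p.[y]| * y + `|c|) * y ^+ k * expR (- y))).
  rewrite !ler_wpM2r ?expR_ge0 ?exprn_ge0 ?(ltW y0)//.
  by rewrite (le_trans (ler_normD _ _))// normrM (gtr0_norm y0).
rewrite !mulrDl lerD//.
  by rewrite -(mulrA `|_|) -exprS; exact: H1.
by rewrite -mulrA ler_wpM2l//; exact: H2.
Qed.

(** The functions [p(1/x) exp(-1/x)], extended by zero, form a class stable under differentiation:
    [p] becomes [X^2 (p - p')]. Smoothness is then an induction over all [p] at once. *)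
Definition exp_germ p x : R :=
  if 0 < x then p.[x^-1] * expR (- x^-1) else 0.

Lemma exp_germ_is_derive p x :
  is_derive x 1 (exp_germ p) (exp_germ ('X^2 * (p - p^`())) x).
Proof.
have [x0|x0|->] := ltgtP x 0.
- apply: (@near_eq_is_derive _ _ _ (cst 0)) => //.
    near=> y; rewrite /exp_germ ltNge.
    have -> : y <= 0 by near: y; exact: lt_le_nbhsl.
    by [].
  apply: is_derive_eq (is_derive_cst _ _ _) _.
  by rewrite /exp_germ ltNge (ltW x0).
- apply: (@near_eq_is_derive R R R (fun y : R => p.[y^-1] * expR (- y^-1) : R)) => //.
    near=> y; rewrite /exp_germ.
    have -> : 0 < y by near: y; exact: lt_nbhsr.
    by [].
  have xn0 : x != 0 by rewrite gt_eqF.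
  have dV : is_derive x 1 (fun y : R => y^-1) (- x^-1 ^+ 2).
    by apply: is_derive_eq (is_deriveV xn0 (is_derive_id _ _)) _;
      rewrite /GRing.scale/= mulr1 exprVn.
  have dp : is_derive x 1 (fun y => p.[y^-1]) ((p^`()).[x^-1] * (- x^-1 ^+ 2)).
    apply: is_derive_eq (is_derive1_comp (is_derive_poly p x^-1) dV) _.
    by [].
  have dN : is_derive x 1 (fun y : R => - y^-1) (x^-1 ^+ 2).
    by apply: is_derive_eq (is_deriveN dV) _; rewrite opprK.
  have de : is_derive x 1 (fun y => expR (- y^-1)) (expR (- x^-1) * (x^-1 ^+ 2)).
    exact: is_derive1_comp (is_derive_expR _) dN.
  apply: is_derive_eq (is_deriveM dp de) _.
  rewrite /exp_germ x0 hornerM hornerXn hornerD hornerN.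
  by rewrite /GRing.scale/=; ring.
- have -> : exp_germ ('X^2 * (p - p^`())) 0 = 0 by rewrite /exp_germ ltxx.
  apply/is_derive_epsP => e e0.
  (* The exponent 2 bounds the germ by a multiple of [h ^+ 2], so its difference quotient at [0]
     tends to [0]. *)
  have [C HC] := horner_expRN_bounded p 2.
  have C0 : 0 < `|C| + 1 by rewrite ltr_pwDr.
  exists (e / (`|C| + 1)); first by rewrite divr_gt0.
  move=> h hd; rewrite add0r mul0r subr0 {2}/exp_germ ltxx subr0 /exp_germ.
  case: ifPn => h0; last by rewrite normr0 mulr_ge0// ltW.
  have hV : 0 < h^-1 by rewrite invr_gt0.
  have := HC _ hV; rewrite normrM (ger0_norm (expR_ge0 _)) (gtr0_norm h0).
  rewrite (gtr0_norm h0) in hd.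
  set a := `|_|; set b := expR _; rewrite mulrAC exprVn.
  rewrite ler_pdivrMr ?exprn_gt0// => /le_trans; apply.
  rewrite expr2 mulrA ler_wpM2r ?(ltW h0)//.
  move: hd; rewrite ltr_pdivlMr// => /ltW; apply: le_trans.
  by rewrite mulrC ler_wpM2l ?(ltW h0)// (le_trans (ler_norm _))// lerDl.
Unshelve. all: by end_near.
Qed.

Lemma exp_germ_Cn n p : Cn n (exp_germ p).
Proof.
elim: n p => [|n IH] p; (split; first by
  move=> x; exact: is_derive_continuous (exp_germ_is_derive p x)); first by [].
move=> v; have D x : is_derive x v (exp_germ p)
    (v * exp_germ ('X^2 * (p - p^`())) x).
  have [dp <-] := exp_germ_is_derive p x.
  have df : differentiable (exp_germ p) x by exact/derivable1_diffP.
  split; first exact: diff_derivable.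
  by rewrite !deriveE// -{1}(mulr1 v) linearZ.
split=> [x|]; first by have [] := D x.
rewrite (_ : 'D_v _ = cst v * exp_germ ('X^2 * (p - p^`()))).
  exact/CnM/IH/Cn_cst.
by apply/funext => x; have [_ ->] := D x.
Qed.

Definition expV : R -> R := exp_germ 1.

Lemma expV_le0 x : x <= 0 -> expV x = 0.
Proof. by move=> x0; rewrite /expV /exp_germ ltNge x0. Qed.

Lemma expV_gt0 x : 0 < x -> 0 < expV x.
Proof. by move=> x0; rewrite /expV /exp_germ x0 hornerE mul1r expR_gt0. Qed.

Lemma expV_ge0 x : 0 <= expV x.
Proof. by have [/expV_le0->|/expV_gt0/ltW] := leP x 0. Qed.

Lemma expV_le x y : x <= y -> expV x <= expV y.
Proof.
move=> xy; have [/expV_le0->|x0] := leP x 0; first exact: expV_ge0.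
have y0 := lt_le_trans x0 xy.
rewrite /expV /exp_germ x0 y0 !hornerE ?mul1r ler_expR lerN2.
by rewrite lef_pV2.
Qed.

(** The denominator never vanishes, as [x] and [1 - x] are not both nonpositive. *)
Definition smooth_step x : R := expV x / (expV x + expV (1 - x)).

Let denom_gt0 x : 0 < expV x + expV (1 - x).
Proof.
have [x0|x0] := leP x 0; last by rewrite ltr_pwDl ?expV_gt0 ?expV_ge0.
by rewrite ltr_wpDl ?expV_ge0// expV_gt0// subr_gt0 (le_lt_trans x0).
Qed.

Lemma smooth_step_Cn n : Cn n smooth_step.
Proof.
have C1 : Cn n (expV \o (fun x => 1 - x)).
  apply: (@Cn_comp_affine _ _ _ _ _ -%R); last exact: exp_germ_Cn.
    by move=> x; apply: cvgB; [exact: cvg_cst|exact: cvg_id].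
  by move=> p v h; rewrite /GRing.scale/=; ring.
apply: CnM; first exact: exp_germ_Cn.
apply: CnV; first by move=> x; rewrite gt_eqF.
by apply: CnD => //; exact: exp_germ_Cn.
Qed.

Lemma smooth_step_le0 x : x <= 0 -> smooth_step x = 0.
Proof. by move=> x0; rewrite /smooth_step expV_le0// mul0r. Qed.

Lemma smooth_step_ge1 x : 1 <= x -> smooth_step x = 1.
Proof.
move=> x1; rewrite /smooth_step (@expV_le0 (1 - x)) ?subr_le0//.
by rewrite addr0 divff// gt_eqF// expV_gt0// (lt_le_trans ltr01).
Qed.

Lemma smooth_step_ge0 x : 0 <= smooth_step x.
Proof. by rewrite divr_ge0 ?addr_ge0 ?expV_ge0. Qed.

Lemma smooth_step_le1 x : smooth_step x <= 1.
Proof. by rewrite ler_pdivrMr// mul1r lerDl expV_ge0. Qed.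

Lemma smooth_step_homo x y : x <= y -> smooth_step x <= smooth_step y.
Proof.
move=> xy; rewrite ler_pdivrMr// mulrAC ler_pdivlMr//.
have := expV_le xy; have : expV (1 - y) <= expV (1 - x).
  by apply: expV_le; rewrite lerD2l lerN2.
have := expV_ge0 x; have := expV_ge0 (1 - y); nra.
Qed.

End SmoothStep.

Notation rint f := (Rintegral (leb _) setT f).

Section ContinuityEpsilon.
Context {R : realType}.
Implicit Types (f g : R -> R) (x y : R).

Lemma continuous_epsP f x :
  {for x, continuous f} <->
  (forall e : R, 0 < e -> exists2 d : R, 0 < d &
     forall y, `|y - x| < d -> `|f y - f x| <= e).
Proof.
split=> [cf e e0|H].
  move/cvgrPdist_le : cf => /(_ _ e0)[d /= d0 Hd].
  exists d => // y yx; rewrite distrC; apply: Hd.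
  by rewrite /= distrC.
apply/cvgrPdist_le => e e0; have [d d0 Hd] := H e e0.
exists d => // y /= yx; rewrite distrC; apply: Hd.
by rewrite distrC.
Qed.

Lemma compact_support_test {V : normedModType R} (K : set V) (f : V -> R) :
  smooth f -> compact K -> closed K -> (forall p, ~ K p -> f p = 0) ->
  test_function f.
Proof.
move=> sf cK clK f0; split => //.
apply: (subclosed_compact _ cK); first exact: closed_closure.
rewrite [X in _ `<=` X](closure_id K).1//; apply: closureS => p /= /eqP fp.
by apply: contrapT => /f0.
Qed.

End ContinuityEpsilon.

(** * Continuous functions with bounded support and their integrals *)

Section CompactlySupported.
Context {R : realType}.
Implicit Types (f g : R -> R) (x y : R).

Definition bsupp f := exists N : R, forall x, N < `|x| -> f x = 0.

Definition ccs f := continuous f /\ bsupp f.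

Lemma bsuppMl f g : bsupp g -> bsupp (fun x => f x * g x).
Proof. by move=> [N HN]; exists N => x /HN->; rewrite mulr0. Qed.

Lemma bsuppD f g : bsupp f -> bsupp g -> bsupp (fun x => f x + g x).
Proof.
move=> [N HN] [M HM]; exists (Num.max N M) => x.
by rewrite gt_max => /andP[/HN-> /HM->]; rewrite addr0.
Qed.

Lemma bsuppB f g : bsupp f -> bsupp g -> bsupp (fun x => f x - g x).
Proof.
move=> [N HN] [M HM]; exists (Num.max N M) => x.
by rewrite gt_max => /andP[/HN-> /HM->]; rewrite subr0.
Qed.

Lemma ccsMl f g : continuous f -> ccs g -> ccs (fun x => f x * g x).
Proof.
move=> cf [cg bg]; split; last exact: bsuppMl.
by move=> x; apply: cvgM; [exact: cf|exact: cg].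
Qed.

Lemma ccsD f g : ccs f -> ccs g -> ccs (fun x => f x + g x).
Proof.
move=> [cf bf] [cg bg]; split; last exact: bsuppD.
by move=> x; apply: cvgD; [exact: cf|exact: cg].
Qed.

Lemma ccsB f g : ccs f -> ccs g -> ccs (fun x => f x - g x).
Proof.
move=> [cf bf] [cg bg]; split; last exact: bsuppB.
by move=> x; apply: cvgB; [exact: cf|exact: cg].
Qed.

Lemma bounded_on_segment f (N : R) : continuous f ->
  exists K, forall x, `|x| <= N -> `|f x| <= K.
Proof.
move=> cf; have cK : compact (f @` `[- N, N]).
  apply: continuous_compact; last exact: segment_compact.
  exact: continuous_subspaceT.
have [M [_ HM]] := compact_bounded cK.
exists (M + 1) => x xN; apply: (HM (M + 1)); first by rewrite ltrDl.
by exists x => //=; rewrite in_itv/= -ler_norml.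
Qed.

Lemma ccs_bounded f : ccs f -> exists K, forall x, `|f x| <= K.
Proof.
move=> [cf [N HN]]; have [K HK] := bounded_on_segment N cf.
exists (Num.max K 0) => x; have [xN|/HN->] := leP `|x| N.
  by rewrite le_max HK.
by rewrite normr0 le_max lexx orbT.
Qed.

Lemma bounded_bsupp_integrable (f : borelR R -> R) (K : R) :
  measurable_fun setT f -> (forall x, `|f x| <= K) -> bsupp f ->
  (leb R).-integrable setT (EFin \o f).
Proof.
move=> mf Kf [N HN].
have := integrable_indic_itv (- N) N true false; set ind := EFin \o _ => iI.
have iK : (leb R).-integrable setT (fun x => K%:E * ind x)%E.
  exact: integrableZl.
apply: le_integrable iK => //; first exact/measurable_EFinP.
move=> x _ /=; rewrite lee_fin.
have [xN|/HN->] := leP `|x| N; last by rewrite normr0.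
rewrite indicE mem_set ?mulr1; last by rewrite /= in_itv/= -ler_norml.
exact: le_trans (ler_norm _).
Qed.

Lemma ccs_integrable f : ccs f -> (leb R).-integrable setT (EFin \o f).
Proof.
move=> cf; have [K HK] := ccs_bounded cf; have [cof bf] := cf.
by apply: (bounded_bsupp_integrable _ HK) => //; exact: continuous_measurable_fun.
Qed.

Lemma rint_restrict f (a b : R) : (forall x, x < a \/ b < x -> f x = 0) ->
  rint f = \int[leb R]_(x in `[a, b]) f x.
Proof.
move=> f0; rewrite [RHS]Rintegral_mkcond; apply: eq_Rintegral => x _ /=.
rewrite patchE; case: ifPn => // xab; apply: f0.
apply: contrapT => /not_orP[/negP + /negP]; rewrite -!leNgt => ax xb.
by move/negP: xab; apply; rewrite inE/= in_itv/= ax.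
Qed.

Lemma rint_FTC_segment (F f : R -> R) (a b : R) : a <= b -> continuous f ->
  (forall x : R, is_derive x 1 F (f x)) ->
  \int[leb R]_(x in `[a, b]) f x = F b - F a.
Proof.
rewrite le_eqVlt => /predU1P[<-|ab] cf dF.
  by rewrite set_itv1 Rintegral_set1 subrr.
rewrite /Rintegral (@continuous_FTC2 _ f F)//.
- exact: continuous_subspaceT.
- have cF x : {for x, continuous F} by exact: is_derive_continuous (dF x).
  split => [x _||]; first by have [] := dF x.
  + by apply: cvg_at_right_filter; exact: cF.
  + by apply: cvg_at_left_filter; exact: cF.
- by move=> x _; rewrite (is_derive_derive1 (dF x)).
Qed.

Lemma rint_FTC (F f : R -> R) (a b N : R) : 0 <= N -> continuous f ->
  (forall x : R, is_derive x 1 F (f x)) -> (forall x, N < `|x| -> f x = 0) ->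
  F (- N) = a -> F N = b -> rint f = b - a.
Proof.
move=> N0 cf dF f0 <- <-; rewrite (@rint_restrict _ (- N) N).
  by rewrite rint_FTC_segment// ge0_cp.
move=> x [xN|Nx]; apply: f0.
  by have := ler_norm (- x); rewrite normrN; lra.
by have := ler_norm x; lra.
Qed.

End CompactlySupported.

Section Steps.
Context {R : realType}.
Implicit Types (x y a b r s : R).

Lemma smooth_cont (f : R -> R) : smooth f -> continuous f.
Proof. by move=> /(_ 0%N)/Cn_continuous. Qed.

Lemma smooth_derive (f : R -> R) : smooth f ->
  (forall x : R, is_derive x 1 f (derive1 f x)) /\ continuous (derive1 f).
Proof.
move=> sf; have E : derive1 f = 'D_1 f by apply/funext => x; rewrite derive1E.
have [_ /(_ 1)[df Df]] := sf 1%N; split; last first.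
  by rewrite E; exact: (@Cn_continuous R R 0%N ('D_1 f) Df).
by move=> x; rewrite E; split.
Qed.

Lemma derive1_vanish (f : R -> R) (N : R) : smooth f ->
  (forall x, N < `|x| -> f x = 0) -> (forall x, N < `|x| -> derive1 f x = 0).
Proof.
move=> sf f0 x Nx; apply: is_derive_derive1.
apply: (@near_eq_is_derive R R R (cst 0)).
have : \forall y \near x, N < `|y|.
  apply/nbhs_ballP; exists (`|x| - N) => /=; first by rewrite subr_gt0.
  by move=> y; rewrite /ball/= => h; have := lerB_dist x y; lra.
by apply: filterS => y /f0.
Qed.

Definition dstep : R -> R := derive1 (@smooth_step R).

Lemma smooth_step_smooth : smooth (@smooth_step R).
Proof. by move=> n; exact: smooth_step_Cn. Qed.

Lemma smooth_step_derive (x : R) : is_derive x 1 (@smooth_step R) (dstep x).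
Proof. by have [] := smooth_derive smooth_step_smooth. Qed.

Lemma dstep_continuous : continuous dstep.
Proof. by have [] := smooth_derive smooth_step_smooth. Qed.

Lemma dstep_ge0 x : 0 <= dstep x.
Proof.
rewrite leNgt; apply/negP => d0.
have e0 : 0 < - dstep x / 2 by rewrite divr_gt0// oppr_gt0.
have [d dp /(_ (d / 2))] := (is_derive_epsP _ _ _).1 (smooth_step_derive x) _ e0.
have dd : 0 < d / 2 by rewrite divr_gt0.
rewrite gtr0_norm// => /(_ _)/wrap[|]; first by rewrite ltr_pdivrMr// ltr_pMr// ltr1n.
have : smooth_step x <= smooth_step (x + d / 2).
  by apply: smooth_step_homo; rewrite lerDl ltW.
rewrite ler_norml => h /andP[_]; nra.
Qed.

(** At the endpoints [0] and [1] the step is constant on one side only. Since the two-sided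
    derivative exists, an increment [d / 2] towards that side already determines it. *)
Lemma dstep_out x : x <= 0 \/ 1 <= x -> dstep x = 0.
Proof.
move=> x01; apply/eqP; rewrite -normr_eq0 eq_le normr_ge0 andbT.
apply/ler_addgt0Pr => e e0; rewrite add0r.
have [d dp Hd] := (is_derive_epsP _ _ _).1 (smooth_step_derive x) _ e0.
have dd : 0 < d / 2 by rewrite divr_gt0.
have dlt : d / 2 < d by rewrite ltr_pdivrMr// ltr_pMr// ltr1n.
case: x01 => x01.
- have := Hd (- (d / 2)); rewrite normrN gtr0_norm// => /(_ dlt).
  rewrite !smooth_step_le0//; last by lra.
  by rewrite subrr sub0r mulrN opprK normrM (gtr0_norm dd) ler_pM2r.
- have := Hd (d / 2); rewrite gtr0_norm// => /(_ dlt).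
  rewrite !smooth_step_ge1//; last by lra.
  by rewrite subrr sub0r normrN normrM (gtr0_norm dd) ler_pM2r.
Qed.

Lemma dstep_bounded : exists C : R, forall x, dstep x <= C.
Proof.
have : ccs dstep.
  split; first exact: dstep_continuous.
  exists 1 => x; rewrite ltr_normr => /orP[|] h; apply: dstep_out; lra.
by move=> /ccs_bounded[C HC]; exists C => x; exact: le_trans (ler_norm _) (HC x).
Qed.

Definition step (a r x : R) : R := smooth_step ((x - a) / r).

Lemma step_smooth a r : smooth (step a r).
Proof.
move=> n; rewrite (_ : step a r = @smooth_step R \o (fun x => (x - a) / r))//.
apply: (@Cn_comp_affine R R n _ (fun x => (x - a) / r) (fun v => v / r));
  last exact: smooth_step_Cn.
  move=> x; apply: cvgM; last exact: cvg_cst.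
  by apply: cvgB; [exact: cvg_id|exact: cvg_cst].
by move=> p v h; rewrite /GRing.scale/=; ring.
Qed.

Lemma step_derive1 a r x : derive1 (step a r) x = dstep ((x - a) / r) / r.
Proof.
apply: is_derive_derive1.
have dl : is_derive x 1 (fun x : R => (x - a) / r) (r^-1).
  have h := is_deriveM (is_deriveB (is_derive_id x 1) (is_derive_cst a x 1))
    (is_derive_cst r^-1 x 1).
  by apply: is_derive_eq h _; rewrite scaler0 add0r subr0 /GRing.scale/= mulr1.
exact: (@is_derive1_comp R (@smooth_step R) (fun x => (x - a) / r) x _ _
  (smooth_step_derive ((x - a) / r)) dl).
Qed.

Lemma step_derive (a r x : R) : is_derive x 1 (step a r) (derive1 (step a r) x).
Proof. by have [] := smooth_derive (@step_smooth a r). Qed.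

Lemma step_le a r x : 0 < r -> x <= a -> step a r x = 0.
Proof.
by move=> r0 xa; rewrite /step smooth_step_le0// pmulr_lle0 ?invr_gt0// subr_le0.
Qed.

Lemma step_ge a r x : 0 < r -> a + r <= x -> step a r x = 1.
Proof. by move=> r0 xa; rewrite /step smooth_step_ge1// ler_pdivlMr// mul1r; lra. Qed.

Lemma step_derive1_ge0 a r x : 0 < r -> 0 <= derive1 (step a r) x.
Proof. by move=> r0; rewrite step_derive1 divr_ge0 ?dstep_ge0 ?ltW. Qed.

Lemma step_derive1_out a r x : 0 < r -> x <= a \/ a + r <= x -> derive1 (step a r) x = 0.
Proof.
move=> r0 h; rewrite step_derive1 dstep_out ?mul0r//.
by case: h => h; [left; rewrite pmulr_lle0 ?invr_gt0// subr_le0|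
  right; rewrite ler_pdivlMr// mul1r; lra].
Qed.

Lemma step_derive1_ccs a r : 0 < r -> ccs (derive1 (step a r)).
Proof.
move=> r0; split; first by have [] := smooth_derive (@step_smooth a r).
exists (`|a| + r) => x h; apply: step_derive1_out => //.
move: h; rewrite ltr_normr => /orP[h|h]; [right|left].
- by have := ler_norm a; lra.
- by have := ler_norm (- a); rewrite normrN; lra.
Qed.

Lemma rint_step_derive1 a r : 0 < r -> rint (derive1 (step a r)) = 1.
Proof.
move=> r0; rewrite -[RHS]subr0; apply: (@rint_FTC R (step a r) _ 0 1 (`|a| + r)).
- by rewrite addr_ge0// ltW.
- by have [] := step_derive1_ccs a r0.
- exact: step_derive.
- move=> x h; apply: step_derive1_out => //.
  move: h; rewrite ltr_normr => /orP[h|h]; [right|left].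
  + by have := ler_norm a; lra.
  + by have := ler_norm (- a); rewrite normrN; lra.
- by rewrite step_le//; have := ler_norm (- a); rewrite normrN; lra.
- by rewrite step_ge// lerD2r ler_norm.
Qed.

(** The two ramps have independent widths: the barrier argument combines a falling ramp of
    prescribed width with an arbitrarily long rising one. *)
Definition plateau (a r b s x : R) : R := step a r x - step b s x.

Lemma plateau_smooth a r b s : smooth (plateau a r b s).
Proof.
move=> n; rewrite (_ : plateau a r b s = step a r - step b s)//.
by apply: CnD; [|apply: CnN]; exact: step_smooth.
Qed.

Lemma plateau_derive1 a r b s x :
  derive1 (plateau a r b s) x = derive1 (step a r) x - derive1 (step b s) x.
Proof.
by apply: is_derive_derive1; apply: is_deriveB; exact: step_derive.
Qed.

Lemma plateau_out a r b s x :
  0 < r -> 0 < s -> a + r <= b -> x <= a \/ b + s <= x -> plateau a r b s x = 0.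
Proof.
move=> r0 s0 arb [h|h]; rewrite /plateau.
  rewrite step_le// step_le ?subr0//.
  by lra.
by rewrite !step_ge ?subrr//; lra.
Qed.

Lemma plateau_in a r b s x :
  0 < r -> 0 < s -> a + r <= b -> a + r <= x -> x <= b -> plateau a r b s x = 1.
Proof. by move=> r0 s0 arb h h'; rewrite /plateau step_ge// step_le// subr0. Qed.

Lemma plateau_ge0 a r b s x :
  0 < r -> 0 < s -> a + r <= b -> 0 <= plateau a r b s x.
Proof.
move=> r0 s0 arb; have [xb|bx] := leP x b.
  by rewrite /plateau (step_le s0)// subr0 smooth_step_ge0.
by rewrite /plateau (step_ge r0) ?subr_ge0 ?smooth_step_le1//; lra.
Qed.

Lemma plateau_le1 a r b s x :
  0 < r -> 0 < s -> a + r <= b -> plateau a r b s x <= 1.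
Proof.
by move=> r0 s0 arb; rewrite /plateau; have := smooth_step_ge0 ((x - b) / s);
  have := smooth_step_le1 ((x - a) / r); rewrite /step; lra.
Qed.

Lemma plateau_far a r b s x :
  0 < r -> 0 < s -> a + r <= b -> `|a| + `|b| + s < `|x| -> plateau a r b s x = 0.
Proof.
move=> r0 s0 arb; rewrite ltr_normr => h; apply: plateau_out => //.
have := ler_norm a; have := ler_norm b; have := ler_norm (- a).
have := ler_norm (- b); rewrite !normrN.
by case/orP: h => h; [right|left]; lra.
Qed.

Lemma plateau_test a r b s :
  0 < r -> 0 < s -> a + r <= b -> test_function (plateau a r b s).
Proof.
move=> r0 s0 arb; apply: (@compact_support_test _ _ `[a, b + s]).
- exact: plateau_smooth.
- exact: segment_compact.
- exact: interval_closed.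
- move=> x /= /negP; rewrite in_itv/= negb_and -!ltNge => /orP h.
  by apply: plateau_out => //; case: h => h; [left|right]; exact: ltW.
Qed.

End Steps.

(** * From weak to classical derivatives *)

Section WeakToStrongDerivative.
Context {R : realType}.
Implicit Types (A B C : R -> R) (s t k d e x : R).

Lemma le_rint (f g : R -> R) : ccs f -> ccs g -> (forall x, f x <= g x) ->
  rint f <= rint g.
Proof.
move=> cf cg fg; apply: le_Rintegral => //; exact: ccs_integrable.
Qed.

Lemma rintB (f g : R -> R) : ccs f -> ccs g ->
  rint (fun x => f x - g x) = rint f - rint g.
Proof. by move=> cf cg; apply: RintegralB => //; exact: ccs_integrable. Qed.

Lemma rintD (f g : R -> R) : ccs f -> ccs g ->
  rint (fun x => f x + g x) = rint f + rint g.
Proof. by move=> cf cg; apply: RintegralD => //; exact: ccs_integrable. Qed.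

Lemma rintZ k (f : R -> R) : ccs f -> rint (fun x => k * f x) = k * rint f.
Proof. by move=> cf; apply: RintegralZl => //; exact: ccs_integrable. Qed.

(* [derive1 (step s d)] approximates the Dirac mass at [s]. *)
Lemma rint_step_derive1_close C s d e : 0 < d -> continuous C ->
  (forall x, s <= x <= s + d -> `|C x - C s| <= e) ->
  `|rint (fun x => C x * derive1 (step s d) x) - C s| <= e.
Proof.
move=> d0 cC He.
have cS := @step_derive1_ccs R s d d0.
have I k : rint (fun x => k * derive1 (step s d) x) = k.
  by rewrite rintZ// rint_step_derive1// mulr1.
have cM : ccs (fun x => C x * derive1 (step s d) x) by exact: ccsMl.
have cK k : ccs (fun x => k * derive1 (step s d) x).
  by apply: (@ccsMl _ (cst k)) => // x; exact: cvg_cst.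
have aux x : `|C x - C s| * derive1 (step s d) x <= e * derive1 (step s d) x.
  have [xs|sx] := leP x s; first by rewrite step_derive1_out ?mulr0//; left.
  have [sdx|xsd] := leP (s + d) x.
    by rewrite step_derive1_out ?mulr0//; right.
  by rewrite ler_wpM2r ?step_derive1_ge0// He// !ltW.
have S0 x := step_derive1_ge0 s x d0.
rewrite ler_norml; apply/andP; split.
- rewrite lerBrDl -(I (C s + - e)); apply: le_rint => // x.
  have := aux x; have := ler_norm (- (C x - C s)); rewrite normrN.
  by have := S0 x; nra.
- rewrite lerBlDl -(I (C s + e)); apply: le_rint => // x.
  have := aux x; have := ler_norm (C x - C s).
  by have := S0 x; nra.
Qed.

(** For [C x = A x - k * x] and a plateau [psi] rising just after [s] and falling just after [t],
    the integral of [C * derive1 psi] is close to [C s - C t] and equals that of [(k - B) * psi],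
    which is nonnegative. The bound on [B] extends to [t + d] to cover the falling ramp. *)
Lemma weak_derivative_le A B k s t d : continuous A -> continuous B ->
  (forall psi : R -> R, test_function psi ->
     rint (fun x => A x * derive1 psi x + B x * psi x) = 0) ->
  s < t -> 0 < d -> (forall x, s <= x <= t + d -> B x <= k) ->
  A t - A s <= k * (t - s).
Proof.
have arith (u w a b q : R) : - (q / 2) <= u - a <= q / 2 ->
  - (q / 2) <= w - b <= q / 2 -> 0 <= u - w -> b <= a + q.
  by move=> /andP[? ?] /andP[? ?] ?; lra.
move=> cA cB AB st d0 Bk.
pose C x := A x - k * x.
have cC : continuous C.
  move=> x; apply: cvgB; first exact: cA.
  by apply: cvgM; [exact: cvg_cst|exact: cvg_id].
suff : C t <= C s by rewrite /C; lra.
apply/ler_addgt0Pr => e e0.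
have e20 : 0 < e / 2 by rewrite divr_gt0.
have [d1 d10 H1] := (continuous_epsP C s).1 (cC s) _ e20.
have [d2 d20 H2] := (continuous_epsP C t).1 (cC t) _ e20.
pose r := Num.min (Num.min d (t - s)) (Num.min d1 d2) / 2.
have r0 : 0 < r by rewrite divr_gt0// !lt_min d0 subr_gt0 st d10.
have [rd rts rd1 rd2] : [/\ r < d, s + r <= t, r < d1 & r < d2].
  have : r * 2 = Num.min (Num.min d (t - s)) (Num.min d1 d2).
    by rewrite /r divfK.
  have h1 : Num.min (Num.min d (t - s)) (Num.min d1 d2) <= Num.min d (t - s).
    by rewrite ge_min lexx.
  have h2 : Num.min (Num.min d (t - s)) (Num.min d1 d2) <= Num.min d1 d2.
    by rewrite ge_min lexx orbT.
  have h3 : Num.min d (t - s) <= d by rewrite ge_min lexx.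
  have h4 : Num.min d (t - s) <= t - s by rewrite ge_min lexx orbT.
  have h5 : Num.min d1 d2 <= d1 by rewrite ge_min lexx.
  have h6 : Num.min d1 d2 <= d2 by rewrite ge_min lexx orbT.
  by move=> ?; split; lra.
have Hs x : s <= x <= s + r -> `|C x - C s| <= e / 2.
  by move=> /andP[sx xs]; apply: H1; rewrite ger0_norm; lra.
have Ht x : t <= x <= t + r -> `|C x - C t| <= e / 2.
  by move=> /andP[sx xs]; apply: H2; rewrite ger0_norm; lra.
pose psi := plateau s r t r.
have psi_smooth : smooth psi by exact: plateau_smooth.
have [dpsi cdpsi] := smooth_derive psi_smooth.
pose N := `|s| + `|t| + r.
have psi_far x : N < `|x| -> psi x = 0 by exact: plateau_far.
have cpsi : ccs psi by split; [exact: smooth_cont|exists N].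
have cdp : ccs (derive1 psi).
  by split=> //; exists N => x; exact: derive1_vanish psi_far x.
have kk : rint (fun x => k * x * derive1 psi x + k * psi x) = 0.
  rewrite -[RHS]subr0; apply: (@rint_FTC R (fun x => k * x * psi x) _ 0 0 (N + 1)).
  - by rewrite /N addr_ge0// addr_ge0 ?addr_ge0// ltW.
  - move=> x; apply: cvgD; apply: cvgM; try exact: cdpsi.
    + by apply: cvgM; [exact: cvg_cst|exact: cvg_id].
    + exact: cvg_cst.
    + exact: smooth_cont.
  - move=> x.
    have dk : is_derive x 1 (fun x => k * x) k.
      apply: is_derive_eq (is_deriveM (is_derive_cst k x 1) (is_derive_id x 1)) _.
      by rewrite scaler0 addr0 /GRing.scale/= mulr1.
    apply: is_derive_eq (is_deriveM dk (dpsi x)) _.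
    by rewrite /GRing.scale/= [psi x * k]mulrC.
  - move=> x Nx; have {}Nx : N < `|x| by lra.
    by rewrite psi_far// (derive1_vanish psi_smooth psi_far)// !mulr0 addr0.
  - by rewrite psi_far ?mulr0// normrN ltr_normr; apply/orP; left; rewrite ltrDl.
  - by rewrite psi_far ?mulr0// ltr_normr; apply/orP; left; rewrite ltrDl.
have c1 : ccs (fun x => C x * derive1 psi x) by exact: ccsMl.
have ck : continuous (fun x => k * x).
  by move=> x; apply: cvgM; [exact: cvg_cst|exact: cvg_id].
have ckc : continuous (fun _ : R => k) by move=> x; exact: cvg_cst.
have ckB : continuous (fun x => k - B x).
  by move=> x; apply: cvgB; [exact: cvg_cst|exact: cB].
have c2 : ccs (fun x => (k - B x) * psi x) by exact: ccsMl.
have E : rint (fun x => C x * derive1 psi x) = rint (fun x => (k - B x) * psi x).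
  apply/eqP; rewrite -subr_eq0 -rintB// -[X in _ == X](subr0 0).
  rewrite -{1}(AB psi (plateau_test r0 r0 rts)) -kk -rintB.
  - by apply/eqP; apply: eq_Rintegral => x _; rewrite /C; ring.
  - by apply: ccsD; exact: ccsMl.
  - by apply: ccsD; exact: ccsMl.
have P0 : 0 <= rint (fun x => C x * derive1 psi x).
  rewrite E; apply: Rintegral_ge0 => x _.
  have [xs|sx] := leP x s; first by rewrite /psi plateau_out ?mulr0//; left.
  have [tdx|xtd] := leP (t + r) x; first by rewrite /psi plateau_out ?mulr0//; right.
  rewrite mulr_ge0 ?plateau_ge0// subr_ge0 Bk// (ltW sx)/= (le_trans (ltW xtd))//.
  by rewrite lerD2l ltW.
have Es : rint (fun x => C x * derive1 psi x) =
    rint (fun x => C x * derive1 (step s r) x) -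
    rint (fun x => C x * derive1 (step t r) x).
  rewrite -rintB; [|exact/ccsMl/step_derive1_ccs..].
  by apply: eq_Rintegral => x _; rewrite plateau_derive1 mulrBr.
have K1 := rint_step_derive1_close r0 cC Hs.
have K2 := rint_step_derive1_close r0 cC Ht.
by move: K1 K2 P0; rewrite Es !ler_norml; exact: arith.
Qed.

(** Near [t], continuity puts [B] within [e] of [B t]; the one-sided estimate for [(A, B)] and for
    [(- A, - B)] then bounds the increments of [A] from both sides. This is how equations that are
    weak in time become classical ones. *)
Lemma weak_derivative_is_derive A B : continuous A -> continuous B ->
  (forall psi : R -> R, test_function psi ->
     rint (fun x => A x * derive1 psi x + B x * psi x) = 0) ->
  forall t, is_derive t 1 A (B t).
Proof.
move=> cA cB AB t; apply/is_derive_epsP => e e0.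
have [d d0 Hd] := (continuous_epsP B t).1 (cB t) _ e0.
have NAB (psi : R -> R) : test_function psi ->
    rint (fun x => - A x * derive1 psi x + - B x * psi x) = 0.
  move=> tp; have := AB psi tp; have [sp _] := tp => H.
  transitivity (rint (fun x => -1 * (A x * derive1 psi x + B x * psi x))).
    by apply: eq_Rintegral => x _; ring.
  have [N bN] := compact_bounded tp.2.
  have pN x : N + 1 < `|x| -> psi x = 0.
    move=> Nx; apply: contrapT => /eqP px.
    have := bN.2 (N + 1); rewrite ltrDl ltr01 => /(_ isT x).
    by move=> /(_ (@subset_closure _ _ x px))/=; lra.
  rewrite rintZ ?H ?mulr0//; apply: ccsD; apply: ccsMl => //.
    have [_ ?] := smooth_derive sp; split => //; exists (N + 1).
    exact: derive1_vanish.
  by split; [exact: smooth_cont|exists (N + 1)].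
have cNA : continuous (fun x => - A x) by move=> x; apply: cvgN; exact: cA.
have cNB : continuous (fun x => - B x) by move=> x; apply: cvgN; exact: cB.
have key x y : t - d / 2 <= x -> x < y -> y <= t + d / 2 ->
    `|A y - A x - B t * (y - x)| <= e * (y - x).
  move=> tx xy yt.
  have Bx z : x <= z <= y + d / 4 -> `|B z - B t| <= e.
    by move=> /andP[xz zy]; apply: Hd; rewrite ltr_norml; lra.
  (* The points stay within [d / 2] of [t], which leaves a margin [d / 4] for the falling ramp. *)
  have d40 : 0 < d / 4 by rewrite divr_gt0.
  have h1 := @weak_derivative_le A B (B t + e) x y (d / 4) cA cB AB xy d40.
  have h2 := @weak_derivative_le _ _ (- B t + e) x y (d / 4) cNA cNB NAB xy d40.
  have {}h1 : A y - A x <= (B t + e) * (y - x).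
    by apply: h1 => z /Bx; rewrite ler_norml; lra.
  have {}h2 : - A y - - A x <= (- B t + e) * (y - x).
    by apply: h2 => z /Bx; rewrite ler_norml; lra.
  by rewrite ler_norml; nra.
exists (d / 2) => [|h]; first by rewrite divr_gt0.
have [h0|h0|->] := ltgtP h 0; last by rewrite addr0 subrr mulr0 subrr !normr0 mulr0.
- rewrite (ltr0_norm h0) => hd.
  have := key (t + h) t; rewrite -normrN.
  rewrite (_ : - (A t - _ - _) = A (t + h) - A t - B t * h); last by ring.
  rewrite (_ : t - (t + h) = - h); last by ring.
  by apply; lra.
- rewrite (gtr0_norm h0) => hd.
  have := key t (t + h); rewrite (_ : t + h - t = h); last by ring.
  by apply; lra.
Qed.

End WeakToStrongDerivative.

(** * Integration of bounded continuous functions against finite measures *)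

Section FiniteMeasures.
Context {R : realType}.
Implicit Types (f g : R -> R) (x e d t : R).

Lemma CbP f : Cb f <-> continuous f /\ exists K : R, forall x, `|f x| <= K.
Proof.
split=> [[cf [M [_ HM]]]|[cf [K HK]]]; split=> //.
  by exists (M + 1) => x; apply: (HM (M + 1)) => //; rewrite ltrDl.
exists K; split; first exact: num_real.
by move=> M KM x _; exact: le_trans (HK x) (ltW KM).
Qed.

Lemma CbM f g : Cb f -> Cb g -> Cb (fun x => f x * g x).
Proof.
move=> /CbP[cf [K HK]] /CbP[cg [M HM]]; apply/CbP; split.
  by move=> x; apply: cvgM; [exact: cf|exact: cg].
by exists (K * M) => x; rewrite normrM ler_pM.
Qed.

Lemma CbD f g : Cb f -> Cb g -> Cb (fun x => f x + g x).
Proof.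
move=> /CbP[cf [K HK]] /CbP[cg [M HM]]; apply/CbP; split.
  by move=> x; apply: cvgD; [exact: cf|exact: cg].
by exists (K + M) => x; rewrite (le_trans (ler_normD _ _))// lerD.
Qed.

Lemma Cb_cst (c : R) : Cb (fun _ : R => c).
Proof. by apply/CbP; split; [move=> x; exact: cvg_cst|exists `|c|]. Qed.

Lemma CbB f g : Cb f -> Cb g -> Cb (fun x => f x - g x).
Proof.
move=> /CbP[cf [K HK]] /CbP[cg [M HM]]; apply/CbP; split.
  by move=> x; apply: cvgB; [exact: cf|exact: cg].
by exists (K + M) => x; rewrite (le_trans (ler_normB _ _))// lerD.
Qed.

Lemma ccs_Cb f : ccs f -> Cb f.
Proof. by move=> cf; apply/CbP; split; [have [] := cf|exact: ccs_bounded]. Qed.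

Lemma Cb_integrable (m : finBorel R) f : Cb f -> m.-integrable setT (EFin \o f).
Proof.
move=> [cf bf]; apply: measurable_bounded_integrable => //.
- by rewrite ltey_eq fin_num_measure.
- exact: continuous_measurable_fun.
Qed.

Lemma mint_cst (m : finBorel R) (c : R) :
  Rintegral m setT (fun _ : R => c) = c * fine (m setT).
Proof. exact: Rintegral_cst. Qed.

Lemma mintD (m : finBorel R) f g : Cb f -> Cb g ->
  Rintegral m setT (fun x => f x + g x) = Rintegral m setT f + Rintegral m setT g.
Proof. by move=> cf cg; apply: RintegralD => //; exact: Cb_integrable. Qed.

Lemma mintB (m : finBorel R) f g : Cb f -> Cb g ->
  Rintegral m setT (fun x => f x - g x) = Rintegral m setT f - Rintegral m setT g.
Proof. by move=> cf cg; apply: RintegralB => //; exact: Cb_integrable. Qed.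

Lemma mintZ (m : finBorel R) (c : R) f : Cb f ->
  Rintegral m setT (fun x => c * f x) = c * Rintegral m setT f.
Proof. by move=> cf; apply: RintegralZl => //; exact: Cb_integrable. Qed.

Lemma le_mint (m : finBorel R) f g : Cb f -> Cb g -> (forall x, f x <= g x) ->
  Rintegral m setT f <= Rintegral m setT g.
Proof. by move=> cf cg fg; apply: le_Rintegral => //; exact: Cb_integrable. Qed.

Lemma mint_dist (m : finBorel R) f g e : Cb f -> Cb g ->
  (forall x, `|f x - g x| <= e) ->
  `|Rintegral m setT f - Rintegral m setT g| <= e * fine (m setT).
Proof.
move=> cf cg fg; rewrite -mintB//.
have ce := Cb_cst e; have cN := Cb_cst (- e).
have cfg := CbB cf cg.
rewrite ler_norml -mulNr -!mint_cst.
apply/andP; split; apply: le_mint => // x.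
  by have := fg x; rewrite ler_norml => /andP[].
by have := fg x; rewrite ler_norml => /andP[].
Qed.

Lemma continuous_mint (mu : R -> finBorel R) (h : R -> R -> R) :
  weakly_continuous mu -> (forall t, Cb (h t)) ->
  (forall t0 e, 0 < e -> exists2 d, 0 < d &
     forall t, `|t - t0| < d -> forall x, `|h t x - h t0 x| <= e) ->
  continuous (fun t => Rintegral (mu t) setT (h t)).
Proof.
move=> wc Ch hu t0; apply/continuous_epsP => e e0.
pose M t := fine (mu t setT).
have cM : continuous M.
  rewrite (_ : M = fun t => Rintegral (mu t) setT (fun _ : R => 1)).
    exact: wc (Cb_cst 1).
  by apply/funext => t; rewrite mint_cst mul1r.
have M0 : 0 <= M t0 by exact: fine_ge0.
(* The mass is continuous, being the integral of [1], so it is at most [M t0 + 1] near [t0]. *)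
have K0 : 0 < 2 * (M t0 + 1) by rewrite mulr_gt0// ltr_wpDl.
have e10 : 0 < e / (2 * (M t0 + 1)) by rewrite divr_gt0.
have e20 : 0 < e / 2 by rewrite divr_gt0.
have [d1 d10 H1] := hu t0 _ e10.
have [d2 d20 H2] := (continuous_epsP _ t0).1 (cM t0) _ ltr01.
have [d3 d30 H3] := (continuous_epsP _ t0).1 (wc _ (Ch t0) t0) _ e20.
exists (Num.min d1 (Num.min d2 d3)); first by rewrite !lt_min d10 d20.
move=> t; rewrite !lt_min => /andP[td1 /andP[td2 td3]].
have := mint_dist (mu t) (Ch t) (Ch t0) (H1 t td1); rewrite -/(M t).
have := H3 t td3.
have : e / (2 * (M t0 + 1)) * M t <= e / 2.
  rewrite mulrAC ler_pdivrMr//.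
  have := H2 t td2; rewrite ler_norml => /andP[_ hM].
  rewrite (_ : e / 2 * _ = e * (M t0 + 1)); last by field.
  by rewrite ler_pM2l//; lra.
have := ler_distD (Rintegral (mu t) setT (h t0))
  (Rintegral (mu t) setT (h t)) (Rintegral (mu t0) setT (h t0)).
lra.
Qed.

End FiniteMeasures.

(** * Distribution functions *)

Section DistributionFunctions.
Context {R : realType}.
Implicit Types (m : finBorel R) (x y e d : R).

Definition cdf m x : R := fine (m `]-oo, x]%classic).

Definition cdfl m x : R := fine (m `]-oo, x[%classic).

Definition mass m : R := fine (m setT).

Lemma cdfE m x : m `]-oo, x]%classic = (cdf m x)%:E.
Proof. by rewrite fineK// fin_num_measure. Qed.

Lemma cdflE m x : m `]-oo, x[%classic = (cdfl m x)%:E.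
Proof. by rewrite fineK// fin_num_measure. Qed.

Lemma fine_measure_le m (A B : set (borelR R)) : measurable A -> measurable B ->
  A `<=` B -> fine (m A) <= fine (m B).
Proof.
move=> mA mB AB; apply: fine_le; rewrite ?fin_num_measure//.
by apply: le_measure; rewrite ?inE.
Qed.

Lemma cdf_ge0 m x : 0 <= cdf m x. Proof. exact: fine_ge0. Qed.

Lemma cdfl_ge0 m x : 0 <= cdfl m x. Proof. exact: fine_ge0. Qed.

Lemma cdf_le_mass m x : cdf m x <= mass m.
Proof. exact: fine_measure_le. Qed.

Lemma cdf_homo m x y : x <= y -> cdf m x <= cdf m y.
Proof.
by move=> xy; apply: fine_measure_le => //; apply: subset_itvl; rewrite bnd_simp.
Qed.

Lemma cdfl_le_cdf m x : cdfl m x <= cdf m x.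
Proof. by apply: fine_measure_le => //; apply: subset_itvl; rewrite bnd_simp. Qed.

Lemma cdf_le_cdfl m x y : x < y -> cdf m x <= cdfl m y.
Proof.
by move=> xy; apply: fine_measure_le => //; apply: subset_itvl; rewrite bnd_simp.
Qed.

Lemma cdfl_homo m x y : x <= y -> cdfl m x <= cdfl m y.
Proof.
by move=> xy; apply: fine_measure_le => //; apply: subset_itvl; rewrite bnd_simp.
Qed.

Let approx m (E : nat -> set (borelR R)) (F : set (borelR R)) e : 0 < e ->
  measurable F -> (forall n, measurable (E n)) ->
  m \o E @ \oo --> m F -> exists n, `|fine (m (E n)) - fine (m F)| <= e.
Proof.
move=> e0 mF mE EF.
have : fine \o (m \o E) @ \oo --> fine (m F).
  by apply: fine_cvg; rewrite fineK// fin_num_measure.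
move=> /cvgrPdist_le/(_ _ e0)[n _ /(_ n (leqnn n))] h.
by exists n; rewrite distrC.
Qed.

Let inv_anti (i j : nat) : (i <= j)%N -> (j.+1%:R^-1 : R) <= i.+1%:R^-1.
Proof. by move=> ij; rewrite lef_pV2 ?posrE// ler_nat ltnS. Qed.

Lemma cdf_right m x e : 0 < e -> exists2 d, 0 < d & cdf m (x + d) <= cdf m x + e.
Proof.
move=> e0; pose E n : set (borelR R) := `]-oo, x + n.+1%:R^-1[%classic.
have IE : \bigcap_n E n = `]-oo, x]%classic by rewrite -itvNycEbigcap.
have [|||n] := @approx m E `]-oo, x]%classic e e0; first exact: measurable_itv.
- by move=> n; exact: measurable_itv.
- rewrite -IE; apply: nonincreasing_cvg_mu.
  + by rewrite ltey_eq fin_num_measure//; exact: measurable_itv.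
  + by move=> i; exact: measurable_itv.
  + by rewrite IE; exact: measurable_itv.
  + move=> i j ij; apply/subsetPset; apply: subset_itvl; rewrite bnd_simp.
    by rewrite lerD2l; exact: inv_anti.
- rewrite ler_norml -/(cdf m x) -/(cdfl m (x + n.+1%:R^-1)) => /andP[_ h].
  have n0 : 0 < (n.+1%:R^-1 : R) by [].
  exists (n.+1%:R^-1 / 2); first by rewrite divr_gt0.
  have := @cdf_le_cdfl m (x + n.+1%:R^-1 / 2) (x + n.+1%:R^-1).
  by move: h n0; move: (n.+1%:R^-1) => d h d0 /(_ _)/wrap[|]; lra.
Qed.

Lemma cdf_left m x e : 0 < e -> exists2 d, 0 < d & cdfl m x <= cdf m (x - d) + e.
Proof.
move=> e0; pose E n : set (borelR R) := `]-oo, x - n.+1%:R^-1[%classic.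
have UE : \bigcup_n E n = `]-oo, x[%classic.
  apply/seteqP; split => [y [n _]|y]; rewrite /E/= !in_itv/=.
    by move=> h; apply: (lt_le_trans h); rewrite lerBlDr lerDl.
  move=> /ltr_add_invr[n xns].
  by exists n => //=; rewrite in_itv/= ltrBrDr.
have [|||n] := @approx m E `]-oo, x[%classic e e0; first exact: measurable_itv.
- by move=> n; exact: measurable_itv.
- rewrite -UE; apply: nondecreasing_cvg_mu.
  + by move=> i; exact: measurable_itv.
  + by rewrite UE; exact: measurable_itv.
  + move=> i j ij; apply/subsetPset; apply: subset_itvl; rewrite bnd_simp.
    by rewrite lerD2l lerN2; exact: inv_anti.
- rewrite ler_norml -/(cdfl m x) -/(cdfl m (x - n.+1%:R^-1)) => /andP[h _].
  exists (n.+1%:R^-1); first by [].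
  by have := cdfl_le_cdf m (x - n.+1%:R^-1); lra.
Qed.

Lemma cdf_Ny m e : 0 < e -> exists x, cdf m x <= e.
Proof.
move=> e0; pose E n : set (borelR R) := `]-oo, - n%:R]%classic.
have IE : \bigcap_n E n = set0.
  apply/seteqP; split => // x /(_ (Num.bound `|x|) Logic.I).
  rewrite /E/= in_itv/= => h; have := archi_boundP (normr_ge0 x).
  by have := ler_norm (- x); rewrite normrN; move: h; rewrite -[1 *- _]/(- (_%:R)); lra.
have [|||n] := @approx m E set0 e e0; first exact: measurable0.
- by move=> n; exact: measurable_itv.
- rewrite -IE; apply: nonincreasing_cvg_mu.
  + by rewrite ltey_eq fin_num_measure//; exact: measurable_itv.
  + by move=> i; exact: measurable_itv.
  + by rewrite IE; exact: measurable0.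
  + move=> i j ij; apply/subsetPset; apply: subset_itvl; rewrite bnd_simp.
    by rewrite lerN2 ler_nat.
- rewrite measure0/= subr0 ler_norml => /andP[_ h].
  by exists (- n%:R).
Qed.

Lemma cdf_y m e : 0 < e -> exists x, mass m <= cdf m x + e.
Proof.
move=> e0; pose E n : set (borelR R) := `]-oo, n%:R]%classic.
have UE : \bigcup_n E n = setT.
  apply/seteqP; split => // x _; exists (Num.bound `|x|) => //=.
  rewrite /E/= in_itv/= (le_trans (ler_norm x))//.
  exact/ltW/archi_boundP.
have [|||n] := @approx m E setT e e0; first exact: measurableT.
- by move=> n; exact: measurable_itv.
- rewrite -UE; apply: nondecreasing_cvg_mu.
  + by move=> i; exact: measurable_itv.
  + by rewrite UE; exact: measurableT.
  + move=> i j ij; apply/subsetPset; apply: subset_itvl; rewrite bnd_simp.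
    by rewrite ler_nat.
- rewrite ler_norml => /andP[h _].
  by exists n%:R; rewrite /cdf /mass; lra.
Qed.

Lemma le_mint_cdf m (f : R -> R) x : Cb f -> (forall y, f y <= 1) ->
  (forall y, x < y -> f y <= 0) -> Rintegral m setT f <= cdf m x.
Proof.
move=> cf f1 f0; have mi : measurable (`]-oo, x] : set (borelR R)).
  exact: measurable_itv.
have -> : cdf m x = Rintegral m setT (\1_(`]-oo, x]%classic : set (borelR R))).
  by rewrite /Rintegral integral_indic// setIT.
apply: le_Rintegral => //; first exact: Cb_integrable.
  exact: integrable_indic.
move=> y _; have [yx|xy] := leP y x.
  by rewrite mem_set//= in_itv.
by rewrite memNset/= ?f0// in_itv/= => /(lt_le_trans xy); rewrite ltxx.
Qed.

Lemma ge_mint_cdf m (f : R -> R) x y : Cb f -> (forall z, 0 <= f z) ->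
  (forall z, y < z -> z <= x -> 1 <= f z) -> cdf m x - cdf m y <= Rintegral m setT f.
Proof.
move=> cf f1 f0; rewrite lerBlDr.
have mi z : measurable (`]-oo, z] : set (borelR R)) by exact: measurable_itv.
have E z : cdf m z = Rintegral m setT (\1_(`]-oo, z]%classic : set (borelR R))).
  by rewrite /Rintegral integral_indic// setIT.
rewrite !E -RintegralD//; [|exact: Cb_integrable|exact: integrable_indic].
apply: le_Rintegral => //; first exact: integrable_indic.
  rewrite (_ : EFin \o _ =
    (fun z => (f z)%:E + (\1_(`]-oo, y]%classic : set (borelR R)) z)%:E)%E)//.
  by apply: integrableD => //; [exact: Cb_integrable|exact: integrable_indic].
move=> z _; have [zx|xz] := leP z x.
  rewrite mem_set/=; last by rewrite in_itv.
  have [zy|yz] := leP z y; last by rewrite (le_trans (f0 _ yz zx))// lerDl.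
  by rewrite mem_set/= ?in_itv// lerDr.
rewrite memNset/=; first by rewrite addr_ge0.
by rewrite in_itv/= => /(lt_le_trans xz); rewrite ltxx.
Qed.

End DistributionFunctions.

(** * Families of bounded functions varying uniformly in time *)

Section UniformFamilies.
Context {R : realType}.
Implicit Types (h k : R -> R -> R) (x t e d c : R).

(* The continuous curves in C_b(R). *)
Definition ucb h := (forall t, Cb (h t)) /\
  forall t0 e, 0 < e -> exists2 d, 0 < d &
    forall t, `|t - t0| < d -> forall x, `|h t x - h t0 x| <= e.

Lemma ucb_cst (f : R -> R) : Cb f -> ucb (fun _ => f).
Proof.
move=> cf; split=> // t0 e e0; exists 1 => // t _ x.
by rewrite subrr normr0 ltW.
Qed.

Lemma ucbD h k : ucb h -> ucb k -> ucb (fun t x => h t x + k t x).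
Proof.
move=> [bh uh] [bk uk]; split=> [t|t0 e e0]; first exact: CbD.
have e20 : 0 < e / 2 by rewrite divr_gt0.
have [d1 d10 H1] := uh t0 _ e20; have [d2 d20 H2] := uk t0 _ e20.
exists (Num.min d1 d2); first by rewrite lt_min d10.
move=> t; rewrite lt_min => /andP[td1 td2] x.
rewrite (_ : _ - _ = (h t x - h t0 x) + (k t x - k t0 x)); last by ring.
rewrite (le_trans (ler_normD _ _))// [leRHS](splitr e) lerD ?H1 ?H2//.
Qed.

Lemma ucbM h k : ucb h -> ucb k -> ucb (fun t x => h t x * k t x).
Proof.
move=> [bh uh] [bk uk]; split=> [t|t0 e e0]; first exact: CbM.
have [_ [K HK]] := (CbP (h t0)).1 (bh t0).
have [_ [M HM]] := (CbP (k t0)).1 (bk t0).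
have K0 : 0 <= K := le_trans (normr_ge0 _) (HK 0).
have M0 : 0 <= M := le_trans (normr_ge0 _) (HM 0).
have p0 : 0 < K + M + 1 by rewrite ltr_wpDl// addr_ge0.
have r0 : 0 < Num.min 1 (e / (K + M + 1)) by rewrite lt_min ltr01 divr_gt0.
have [r1 re] : Num.min 1 (e / (K + M + 1)) <= 1 /\ Num.min 1 (e / (K + M + 1)) <= e / (K + M + 1).
  by rewrite !ge_min !lexx orbT.
move: (Num.min _ _) r0 r1 re => r r0 r1 re.
have [d1 d10 H1] := uh t0 _ r0; have [d2 d20 H2] := uk t0 _ r0.
exists (Num.min d1 d2); first by rewrite lt_min d10.
move=> t; rewrite lt_min => /andP[td1 td2] x.
have := H1 t td1 x; have := H2 t td2 x; have := HK x; have := HM x.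
move: (h t x) (k t x) (h t0 x) (k t0 x) => a b a0 b0 hb ha hbb haa.
rewrite (_ : _ - _ = (a - a0) * (b - b0) + (a - a0) * b0 + a0 * (b - b0)); last by ring.
have h1 : `|(a - a0) * (b - b0)| <= r.
  by rewrite normrM; have := normr_ge0 (a - a0); have := normr_ge0 (b - b0); nra.
have h2 : `|(a - a0) * b0| <= r * M by rewrite normrM ler_pM.
have h3 : `|a0 * (b - b0)| <= K * r by rewrite normrM ler_pM.
have := ler_normD ((a - a0) * (b - b0) + (a - a0) * b0) (a0 * (b - b0)).
have := ler_normD ((a - a0) * (b - b0)) ((a - a0) * b0).
by move: re; rewrite ler_pdivlMr//; lra.
Qed.

Lemma MVT_any (f df : R -> R) (a b : R) : (forall x, is_derive x 1 f (df x)) ->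
  exists2 c, Num.min a b <= c <= Num.max a b & f b - f a = df c * (b - a).
Proof.
move=> dff; have cf : continuous f by move=> x; exact: is_derive_continuous (dff x).
have [ab|ba] := leP a b.
- have [c] := @MVT_segment R f df a b ab (fun x _ => dff x) (continuous_subspaceT cf).
  by rewrite in_itv/= => hc E; exists c.
- have [c] := @MVT_segment R f df b a (ltW ba) (fun x _ => dff x) (continuous_subspaceT cf).
  by rewrite in_itv/= => hc E; exists c => //; rewrite -opprB E; ring.
Qed.

Lemma bounded_derive_lipschitz (f df : R -> R) (K : R) :
  (forall x, is_derive x 1 f (df x)) -> (forall x, `|df x| <= K) ->
  forall x y : R, `|f x - f y| <= K * `|x - y|.
Proof.
move=> dff dK x y; have [c _ ->] := MVT_any y x dff.
by rewrite normrM ler_wpM2r.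
Qed.

Lemma ccs_derive1 (g : R -> R) : smooth g -> bsupp g ->
  [/\ smooth (derive1 g), ccs g & ccs (derive1 g)].
Proof.
move=> sg [N HN]; have [dg cg] := smooth_derive sg; split.
- move=> n; have [_ /(_ 1)[_ Dg]] := sg n.+1.
  rewrite (_ : derive1 g = 'D_1 g); first exact: Dg.
  by apply/funext => x; rewrite derive1E.
- by split; [exact: smooth_cont|exists N].
- by split => //; exists N; exact: derive1_vanish.
Qed.

Lemma ucb_moving (g : R -> R) (xi : R -> R) : smooth g -> bsupp g ->
  continuous xi -> ucb (fun t x => g (x - xi t)).
Proof.
move=> sg bg cxi; have [_ cg cdg] := ccs_derive1 sg bg.
have [dg _] := smooth_derive sg.
have [K HK] := ccs_bounded cdg.
have K0 : 0 < `|K| + 1 by rewrite ltr_wpDl.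
split=> [t|t0 e e0].
  have [cgc [M HM]] := (CbP g).1 (ccs_Cb cg).
  apply/CbP; split; last by exists M.
  move=> x; apply: continuous_comp; last exact: cgc.
  by apply: cvgB; [exact: cvg_id|exact: cvg_cst].
have e10 : 0 < e / (`|K| + 1) by rewrite divr_gt0.
have [d d0 Hd] := (continuous_epsP xi t0).1 (cxi t0) _ e10.
exists d => // t td x.
apply: le_trans (bounded_derive_lipschitz dg HK _ _) _.
rewrite (_ : _ - _ = - (xi t - xi t0)) ?normrN; last by ring.
have := Hd t td; rewrite ler_pdivlMr// mulrC; apply: le_trans.
by rewrite ler_wpM2r// (le_trans (ler_norm _))// lerDl.
Qed.

(** The sup norm of [h t] is a continuous function of [t], hence bounded on a segment. *)
Lemma ucb_bounded h (T : R) : ucb h ->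
  exists2 K, 0 <= K & forall t x, `|t| <= T -> `|h t x| <= K.
Proof.
move=> [bh uh].
pose N t := sup [set `|h t x| | x in setT].
have hs t : has_sup [set `|h t x| | x in setT].
  split; first by exists `|h t 0|; exists 0.
  by have [_ [K HK]] := (CbP _).1 (bh t); exists K => _ [x _ <-].
have Nle t x : `|h t x| <= N t.
  by apply: (ub_le_sup (hs t).2); exists x.
have Nge t K : (forall x, `|h t x| <= K) -> N t <= K.
  by move=> HK; apply: ge_sup; [exact: (hs t).1|move=> _ [x _ <-]].
have cN : continuous N.
  move=> t0; apply/continuous_epsP => e e0.
  have [d d0 Hd] := uh t0 e e0; exists d => // t td.
  rewrite ler_distl; apply/andP; split.
    rewrite lerBlDr; apply: Nge => x.
    have := Hd t td x; have := Nle t x.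
    by have := ler_distD (h t x) (h t0 x) 0; rewrite !subr0 distrC; lra.
  apply: Nge => x; have := Hd t td x; have := Nle t0 x.
  by have := ler_distD (h t0 x) (h t x) 0; rewrite !subr0; lra.
have [K HK] := bounded_on_segment T cN.
exists (Num.max K 0); first by rewrite le_max lexx orbT.
move=> t x tT; rewrite le_max; apply/orP; left.
exact: le_trans (Nle t x) (le_trans (ler_norm _) (HK t tT)).
Qed.

Lemma continuous_to_Cb_ucb (v : R * R -> R) :
  continuous_to_Cb v -> ucb (fun t x => v (x, t)).
Proof.
move=> [cv uv]; split=> // t0 e e0.
have := uv t0 [set f | forall x, `|f x - v (x, t0)| <= e].
case.
  apply/uniform_nbhs; exists [set p : R * R | `|p.1 - p.2| < e]; split.
    by exists e => //.
  move=> f /= Hf x; rewrite distrC; exact/ltW/Hf.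
move=> d /= d0 Hd; exists d => // t td x.
by apply: (Hd t) => /=; rewrite distrC.
Qed.

End UniformFamilies.

(** * Transport of mass along barriers *)

Section MovingTestFunctions.
Context {R : realType}.
Implicit Types (g psi : R -> R) (x t c : R) (phi : R * R -> R).

Lemma derive_dir_derive1 g (w x : R) : derivable g x 1 ->
  'D_w g x = w * derive1 g x.
Proof.
move=> dg; have df : differentiable g x by exact/derivable1_diffP.
by rewrite derive1E !deriveE// -{1}(mulr1 w) linearZ.
Qed.

Lemma is_derive_comp_affine {V : normedModType R} g (l dl : V -> R) :
  smooth g -> (forall p v (h : R), l (h *: v + p) = h * dl v + l p) ->
  forall p v, is_derive p v (g \o l) (dl v * derive1 g (l p)).
Proof.
move=> sg Hl p v; have [_ /(_ (dl v))[dg _]] := sg 1%N.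
have E : (fun h : R => h^-1 *: (((g \o l) \o shift p) (h *: v) - (g \o l) p))
       = (fun h => h^-1 *: ((g \o shift (l p)) (h *: dl v) - g (l p))).
  by apply/funext => h /=; rewrite Hl.
split; first by rewrite /derivable E; exact: dg.
rewrite /derive E -/('D_(dl v) g (l p)) derive_dir_derive1//.
by have [dg1 _] := smooth_derive sg; have [] := dg1 (l p).
Qed.

Lemma test_bsupp g : test_function g -> bsupp g.
Proof.
move=> [sg cg]; have [N bN] := compact_bounded cg.
exists (N + 1) => x Nx; apply: contrapT => /eqP px.
have := bN.2 (N + 1); rewrite ltrDl ltr01 => /(_ isT x).
by move=> /(_ (@subset_closure _ _ x px))/=; lra.
Qed.

(** The profile travels at constant speed, which keeps the function smooth in [(x, t)]; along a
    characteristic it would only be known to be [C^1]. *)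
Definition moving_test c g psi (p : R * R) : R := g (p.1 - c * p.2) * psi p.2.

Lemma moving_affine c (p v : R * R) (h : R) :
  (h *: v + p).1 - c * (h *: v + p).2 = h * (v.1 - c * v.2) + (p.1 - c * p.2).
Proof. by rewrite /= /GRing.scale/=; ring. Qed.

Lemma moving_test_test c g psi : smooth g -> bsupp g -> test_function psi ->
  test_function (moving_test c g psi).
Proof.
move=> sg [N HN] tp; have [M HM] := test_bsupp tp.
apply: (@compact_support_test R _ (`[- (N + `|c * M|), N + `|c * M|] `*` `[- M, M])).
- move=> n; rewrite (_ : moving_test c g psi =
    (g \o (fun p : R * R => p.1 - c * p.2)) * (psi \o snd))//.
  apply: CnM; last first.
    apply: (@Cn_comp_affine R _ n _ snd snd); last exact: tp.1.
      by move=> x; exact: cvg_snd.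
    by move=> p v h; rewrite /= /GRing.scale.
  apply: (@Cn_comp_affine R _ n _ _ (fun v => v.1 - c * v.2)); last exact: sg.
    move=> x; apply: cvgB; first exact: cvg_fst.
    by apply: cvgM; [exact: cvg_cst|exact: cvg_snd].
  by move=> p v h; exact: moving_affine.
- by apply: compact_setX; exact: segment_compact.
- by apply: compact_closed; [exact: norm_hausdorff|apply: compact_setX; exact: segment_compact].
- move=> [x t] /= nK; rewrite /moving_test/=.
  have [tM|/HM->] := leP `|t| M; last by rewrite mulr0.
  rewrite HN ?mul0r//; rewrite ltNge; apply/negP => xN; apply: nK.
  split; rewrite in_itv/= -ler_norml//.
  have := ler_normD (x - c * t) (c * t); rewrite subrK => h.
  apply: le_trans h _; rewrite lerD// !normrM ler_wpM2l//.
  exact: le_trans tM (ler_norm M).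
Qed.

Section Derivatives.
Variables (c : R) (g psi : R -> R).
Hypotheses (sg : smooth g) (sp : smooth psi).

Let dmoving (p v : R * R) : is_derive p v (moving_test c g psi)
  (g (p.1 - c * p.2) * (v.2 * derive1 psi p.2) +
   psi p.2 * ((v.1 - c * v.2) * derive1 g (p.1 - c * p.2))).
Proof.
have d1 := @is_derive_comp_affine _ g _ _ sg (moving_affine c) p v.
have d2 : is_derive p v (psi \o snd) (v.2 * derive1 psi p.2).
  by apply: (@is_derive_comp_affine (R * R)%type psi snd snd sp) => ? ? ?.
exact: is_deriveM d1 d2.
Qed.

Lemma moving_test_Dt x t : Dt (moving_test c g psi) (x, t) =
  g (x - c * t) * derive1 psi t - c * (psi t * derive1 g (x - c * t)).
Proof. by rewrite /Dt; have [_ ->] := dmoving (x, t) (0, 1); rewrite /=; ring. Qed.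

Lemma moving_test_Dx x t : Dx (moving_test c g psi) (x, t) =
  psi t * derive1 g (x - c * t).
Proof. by rewrite /Dx; have [_ ->] := dmoving (x, t) (1, 0); rewrite /=; ring. Qed.

End Derivatives.
End MovingTestFunctions.

Section Transport.
Context {R : realType}.
Implicit Types (v : R * R -> R) (nu : R -> finBorel R) (g : R -> R).
Implicit Types (x t s c z d e r : R).

Definition transported v nu := [/\ continuous_to_Cb v, weakly_continuous nu &
  forall phi : R * R -> R, test_function phi ->
    \int[leb R]_t \int[nu t]_x
      (Dt phi (x, t) + v (x, t) * Dx phi (x, t)) = 0].

(** Inserting [moving_test] into the transport equation and sorting the terms in [derive1 psi] and
    in [psi] shows that the second integral is the weak derivative in [t] of the first. Both are
    continuous in [t], so the derivative is classical. *)
Lemma transport_is_derive v nu g c : transported v nu -> smooth g -> bsupp g ->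
  forall t, is_derive t 1 (fun t => \int[nu t]_x g (x - c * t))
    (\int[nu t]_x ((v (x, t) - c) * derive1 g (x - c * t))).
Proof.
move=> [cv wnu H4] sg bg.
have uv := continuous_to_Cb_ucb cv.
have [sdg cg cdg] := ccs_derive1 sg bg.
have cc : continuous (fun t => c * t).
  by move=> t; apply: cvgM; [exact: cvg_cst|exact: cvg_id].
have uA := ucb_moving sg bg cc.
have uB : ucb (fun t x => (v (x, t) - c) * derive1 g (x - c * t)).
  apply: ucbM; last by apply: ucb_moving => //; have [] := cdg.
  exact: ucbD uv (ucb_cst (Cb_cst (- c))).
apply: weak_derivative_is_derive.
- exact: continuous_mint wnu uA.1 uA.2.
- exact: continuous_mint wnu uB.1 uB.2.
move=> psi tp; rewrite -[RHS](H4 _ (moving_test_test c sg bg tp)).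
apply: eq_Rintegral => t _.
rewrite [LHS](_ : _ = derive1 psi t * \int[nu t]_x g (x - c * t) +
  psi t * \int[nu t]_x ((v (x, t) - c) * derive1 g (x - c * t))); last by ring.
rewrite -(mintZ (nu t) _ (uA.1 t)) -(mintZ (nu t) _ (uB.1 t)) -mintD.
- apply: eq_Rintegral => x _.
  by rewrite moving_test_Dt ?moving_test_Dx//; [ring|exact: tp.1..].
- exact: CbM (Cb_cst _) (uA.1 t).
- exact: CbM (Cb_cst _) (uB.1 t).
Qed.

Lemma mass_continuous nu : weakly_continuous nu -> continuous (fun t => mass (nu t)).
Proof.
move=> wc; rewrite (_ : (fun t => _) = fun t => \int[nu t]_x (1 : R)).
  exact: wc (Cb_cst 1).
by apply/funext => t; rewrite mint_cst mul1r.
Qed.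

(** The plateau [g] selects the mass to the left of the moving point [z + c * t]. On its falling
    ramp the sign hypothesis prevents mass from escaping, for either order of [s] and [t] thanks to
    the factor [t - s]. The rising ramp sits far to the left with length [L]; its slope is at most
    [C / L], so its effect fades as [L] grows. *)
Lemma barrier_core v nu c z s t r : transported v nu -> 0 < r ->
  (forall x tau, Num.min s t <= tau <= Num.max s t ->
    z + c * tau <= x <= z + r + c * tau -> (v (x, tau) - c) * (t - s) <= 0) ->
  cdf (nu s) (z + c * s) <= cdf (nu t) (z + r + c * t).
Proof.
have arith (a1 a2 a3 a4 i1 i2 w q : R) : a1 - a2 <= i1 -> i2 <= a3 ->
    - w <= i2 - i1 -> w <= q / 2 -> a4 <= q / 2 -> a2 <= a4 -> a1 <= a3 + q by lra.
move=> tv r0 Hv; have [cv wnu _] := tv.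
have uv := continuous_to_Cb_ucb cv.
apply/ler_addgt0Pr => e e0.
pose T := Num.max `|s| `|t|.
have [K K0 HK] := ucb_bounded T uv.
have [Mb HM] := bounded_on_segment T (mass_continuous wnu).
have [C HC] := @dstep_bounded R.
have C0 : 0 <= C := le_trans (dstep_ge0 0) (HC 0).
have e20 : 0 < e / 2 by rewrite divr_gt0.
have [y0 Hy0] := cdf_Ny (nu s) e20.
pose W := `|t - s| * (K + `|c|) * C * `|Mb|.
have W0 : 0 <= W by rewrite !mulr_ge0 ?addr_ge0.
(* The term in [z] puts the rising ramp to the left of the falling one, those in [y0] and [c * s]
   make the mass missed on the left at time [s] at most [e / 2], and the last one makes the slope
   error [W / L] at most [e / 2]. *)
pose L := 1 + `|z| + `|y0| + `|c * s| + W / (e / 2).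
have We0 : 0 <= W / (e / 2) by rewrite divr_ge0// ltW.
have L0 : 0 < L by rewrite /L !ltr_wpDr.
have Lz : - (2 * L) + L <= z.
  by have := ler_norm (- z); have := normr_ge0 y0; have := normr_ge0 (c * s);
    rewrite normrN /L; lra.
have Ly : - L + c * s <= y0.
  have := ler_norm (- y0); have := normr_ge0 z; have := ler_norm (c * s).
  by rewrite normrN /L; lra.
have LW : W / L <= e / 2.
  rewrite ler_pdivrMr// mulrC -ler_pdivrMr// /L.
  by have := normr_ge0 z; have := normr_ge0 y0; have := normr_ge0 (c * s); lra.
pose g := plateau (- (2 * L)) L z r.
have sg : smooth g by exact: plateau_smooth.
have bg : bsupp g by apply: test_bsupp; exact: plateau_test.
have cc : continuous (fun t => c * t).
  by move=> tau; apply: cvgM; [exact: cvg_cst|exact: cvg_id].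
have uA := ucb_moving sg bg cc.
have [sdg cg cdg] := ccs_derive1 sg bg.
have As : cdf (nu s) (z + c * s) - cdf (nu s) (- L + c * s) <=
    \int[nu s]_x g (x - c * s).
  apply: ge_mint_cdf (uA.1 s) _ _ => x; first exact: plateau_ge0.
  by move=> Lx xz; rewrite /g plateau_in//; lra.
have At : \int[nu t]_x g (x - c * t) <= cdf (nu t) (z + r + c * t).
  apply: le_mint_cdf (uA.1 t) _ _ => x; first exact: plateau_le1.
  by move=> zx; rewrite /g plateau_out//; right; lra.
have [xi Hxi E] := MVT_any s t (transport_is_derive c tv sg bg).
have xiT : `|xi| <= T.
  move: Hxi => /andP[h1 h2]; rewrite ler_norml /T; apply/andP; split.
    apply: le_trans h1; rewrite le_min; apply/andP; split; rewrite lerNl.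
      by rewrite le_max -(normrN s) ler_norm.
    by rewrite le_max -(normrN t) ler_norm orbT.
  apply: le_trans h2 _; rewrite ge_max; apply/andP; split.
    by rewrite le_max ler_norm.
  by rewrite le_max ler_norm orbT.
have cB : Cb (fun x => (v (x, xi) - c) * derive1 g (x - c * xi)).
  apply: CbM; first exact: CbB (uv.1 xi) (Cb_cst c).
  have [cd _] := cdg; have [_ [b Hb]] := (CbP _).1 (ccs_Cb cdg).
  apply/CbP; split; last by exists b => x; exact: Hb.
  move=> x; apply: continuous_comp; last exact: cd.
  by apply: cvgB; [exact: cvg_id|exact: cvg_cst].
have lowB : - (W / L) <= \int[nu t]_x g (x - c * t) - \int[nu s]_x g (x - c * s).
  rewrite E [leRHS]mulrC -mintZ//.
  apply: (@le_trans _ _ (\int[nu xi]_x (- (`|t - s| * (K + `|c|) * (C / L))))).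
    rewrite mint_cst mulNr lerN2 -/(mass (nu xi)).
    rewrite (_ : W / L = `|t - s| * (K + `|c|) * (C / L) * `|Mb|); last first.
      by rewrite /W; ring.
    rewrite ler_wpM2l ?mulr_ge0 ?addr_ge0 ?invr_ge0 ?(ltW L0)//.
    exact: le_trans (ler_norm _) (le_trans (HM xi xiT) (ler_norm _)).
  apply: le_mint => [||x]; [exact: Cb_cst|exact: CbM (Cb_cst _) cB|].
  rewrite /g plateau_derive1.
  have p1 := step_derive1_ge0 (- (2 * L)) (x - c * xi) L0.
  have p2 : derive1 (step (- (2 * L)) L) (x - c * xi) <= C / L.
    by rewrite step_derive1 ler_wpM2r ?HC// invr_ge0 ltW.
  have p3 := step_derive1_ge0 z (x - c * xi) r0.
  have p4 : (v (x, xi) - c) * (t - s) * derive1 (step z r) (x - c * xi) <= 0.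
    have [xz|zx] := leP (x - c * xi) z.
      by rewrite step_derive1_out ?mulr0//; left.
    have [zrx|xzr] := leP (z + r) (x - c * xi).
      by rewrite step_derive1_out ?mulr0//; right.
    by rewrite mulr_le0_ge0// Hv//; lra.
  have p5 : `|(v (x, xi) - c) * (t - s)| <= `|t - s| * (K + `|c|).
    rewrite normrM mulrC ler_wpM2l// (le_trans (ler_normB _ _))// lerD2r.
    exact: HK.
  have p6 := ler_norm (- ((v (x, xi) - c) * (t - s))).
  move: p1 p2 p3 p4 p5 p6; rewrite normrN.
  have -> : (t - s) * ((v (x, xi) - c) *
      (derive1 (step (- (2 * L)) L) (x - c * xi) - derive1 (step z r) (x - c * xi))) =
      (v (x, xi) - c) * (t - s) * derive1 (step (- (2 * L)) L) (x - c * xi) -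
      (v (x, xi) - c) * (t - s) * derive1 (step z r) (x - c * xi) by ring.
  move: (_ * (t - s)) (_ * (K + _)) (C / L) (derive1 _ _) (derive1 _ _).
  clear => a b q p1 p2 h1 h2 h3 h4 h5 h6.
  by have h7 := normr_ge0 a; nra.
exact: arith As At lowB LW Hy0 (cdf_homo (nu s) Ly).
Qed.

(** [barrier_core] loses the width of the ramp. It is recovered by right continuity of [cdf] at time
    [t] for closed half-lines, and by approximating [cdfl] from the left at time [s] for open
    ones. *)
Lemma barrier v nu c z s t d : transported v nu -> 0 < d ->
  (forall x tau, Num.min s t <= tau <= Num.max s t ->
    `|x - (z + c * tau)| <= d -> (v (x, tau) - c) * (t - s) <= 0) ->
  cdf (nu s) (z + c * s) <= cdf (nu t) (z + c * t) /\
  cdfl (nu s) (z + c * s) <= cdfl (nu t) (z + c * t).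
Proof.
move=> tv d0 Hv; split; apply/ler_addgt0Pr => e e0.
- have [d1 d10 H1] := cdf_right (nu t) (z + c * t) e0.
  have r0 : 0 < Num.min d d1 by rewrite lt_min d0.
  have [rd rd1] : Num.min d d1 <= d /\ Num.min d d1 <= d1.
    by rewrite !ge_min !lexx orbT.
  have Hr x tau : Num.min s t <= tau <= Num.max s t ->
      z + c * tau <= x <= z + Num.min d d1 + c * tau -> (v (x, tau) - c) * (t - s) <= 0.
    move=> ht /andP[h1 h2]; apply: Hv => //; rewrite ger0_norm; last by lra.
    by move: (Num.min d d1) rd h2 => q; lra.
  apply: (le_trans (barrier_core tv r0 Hr)); apply: le_trans H1.
  by apply: cdf_homo; move: (Num.min d d1) rd1 => q; lra.
- have [d1 d10 H1] := cdf_left (nu s) (z + c * s) e0.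
  have r0 : 0 < Num.min d d1 / 2 by rewrite divr_gt0// lt_min d0.
  have [rd rd1] : Num.min d d1 / 2 * 2 <= d /\ Num.min d d1 / 2 * 2 <= d1.
    by rewrite !divfK// !ge_min !lexx orbT.
  move: (Num.min d d1 / 2) r0 rd rd1 => r r0 rd rd1.
  (* Starting at [z - r * 2] keeps the whole ramp strictly to the left of [z], as the open half-line
     at time [t] requires. *)
  have Hr x tau : Num.min s t <= tau <= Num.max s t ->
      z - r * 2 + c * tau <= x <= z - r * 2 + r + c * tau ->
      (v (x, tau) - c) * (t - s) <= 0.
    by move=> ht /andP[h1 h2]; apply: Hv => //; rewrite ler_norml; lra.
  apply: (le_trans H1); rewrite lerD2r.
  have h1 : cdf (nu s) (z + c * s - d1) <= cdf (nu s) (z - r * 2 + c * s).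
    by apply: cdf_homo; lra.
  apply: (le_trans h1); apply: (le_trans (barrier_core tv r0 Hr)).
  by apply: cdf_le_cdfl; lra.
Qed.

(** A barrier that advances by [K * |t - s|], with [K] a bound for [|v|] between the two times,
    cannot be overtaken. *)
Lemma finite_speed v nu s t : transported v nu ->
  exists c, forall z, cdf (nu s) z <= cdf (nu t) (z + c) /\
                      cdfl (nu s) z <= cdfl (nu t) (z + c).
Proof.
move=> tv; have [cv _ _] := tv.
pose T := Num.max `|s| `|t|.
have [K K0 HK] := ucb_bounded T (continuous_to_Cb_ucb cv).
pose k := K * Num.sg (t - s).
exists (k * (t - s)) => z.
have := @barrier v nu k (z - k * s) s t 1 tv ltr01.
rewrite subrK (_ : z - k * s + k * t = z + k * (t - s)); last by ring.
apply=> x tau /andP[h1 h2] _.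
have tT : `|tau| <= T.
  rewrite ler_norml /T; apply/andP; split.
    apply: le_trans h1; rewrite le_min; apply/andP; split; rewrite lerNl.
      by rewrite le_max -(normrN s) ler_norm.
    by rewrite le_max -(normrN t) ler_norm orbT.
  apply: le_trans h2 _; rewrite ge_max; apply/andP; split.
    by rewrite le_max ler_norm.
  by rewrite le_max ler_norm orbT.
have := HK tau x tT; rewrite mulrBl /k -mulrA -normrEsg.
have := ler_norm (v (x, tau) * (t - s)); rewrite normrM.
have := normr_ge0 (t - s); nra.
Qed.

Lemma mass_preserved v nu s t : transported v nu -> mass (nu s) = mass (nu t).
Proof.
(* Finite speed holds in both directions of time, so one inequality suffices. *)
move=> tv; wlog suff H : s t / mass (nu s) <= mass (nu t).
  by apply/eqP; rewrite eq_le !H.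
apply/ler_addgt0Pr => e e0; have [x Hx] := cdf_y (nu s) e0.
have [c /(_ x)[h _]] := finite_speed s t tv.
by have := cdf_le_mass (nu t) (x + c); lra.
Qed.

(* A curve that no straight barrier can cross is a characteristic. *)
Lemma barrier_curve_is_derive v (a : R -> R) : continuous_to_Cb v ->
  (forall c z s t d, 0 < d ->
    (forall x tau, Num.min s t <= tau <= Num.max s t ->
      `|x - (z + c * tau)| <= d -> (v (x, tau) - c) * (t - s) <= 0) ->
    a s < z + c * s -> a t <= z + c * t) ->
  forall t, is_derive t 1 a (v (a t, t)).
Proof.
move=> cv Ha t0; have [bv uv] := continuous_to_Cb_ucb cv.
apply/is_derive_epsP => e e0.
have e20 : 0 < e / 2 by rewrite divr_gt0.
have [d1 d10 H1] := uv t0 _ e20.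
have [d2 d20 H2] := (continuous_epsP _ _).1 ((bv t0).1 (a t0)) _ e20.
set v0 := v (a t0, t0).
have Hv x tau : `|tau - t0| < d1 -> `|x - a t0| < d2 -> `|v (x, tau) - v0| <= e.
  move=> /H1/(_ x) h1 /H2 h2.
  rewrite (_ : _ - v0 = (v (x, tau) - v (x, t0)) + (v (x, t0) - v0)); last by ring.
  by rewrite (le_trans (ler_normD _ _))// [leRHS](splitr e) lerD.
have w0 : 0 < `|v0| + e + 1 by have := normr_ge0 v0; lra.
(* Within time [q] a line whose slope is at most [|v0| + e] in absolute value moves by less than
   [d2 / 2], so it stays where [v] is within [e] of [v0]. *)
pose q := Num.min d1 (d2 / 2 / (`|v0| + e + 1)).
have q0 : 0 < q by rewrite lt_min d10 !divr_gt0.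
exists q => // h; rewrite lt_min => /andP[hd1]; rewrite ltr_pdivlMr// => hd2.
have strip k c h' : `|k| < d2 / 2 -> `|c - v0| <= e -> `|h'| <= `|h| ->
    `|k + c * h'| < d2.
  move=> kd cv0 hh.
  have : `|c| <= `|v0| + e.
    by have := ler_normD (c - v0) v0; rewrite subrK; lra.
  have := ler_normD k (c * h'); rewrite normrM.
  have := normr_ge0 c; have := normr_ge0 h'; nra.
have between tau : Num.min t0 (t0 + h) <= tau <= Num.max t0 (t0 + h) ->
    `|tau - t0| <= `|h|.
  rewrite ge_min le_max => /andP[/orP[] h1 /orP[] h2]; rewrite ler_norml.
  - by have := normr_ge0 h; lra.
  - by have := ler_norm h; have := normr_ge0 h; lra.
  - by have := ler_norm (- h); rewrite normrN; have := normr_ge0 h; lra.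
  - by have := ler_norm h; have := ler_norm (- h); rewrite normrN; lra.
have d40 : 0 < d2 / 4 by rewrite divr_gt0.
pose sh := Num.sg h.
have shh : sh * h = `|h| by rewrite normrEsg.
have sh1 : `|sh| <= 1 by rewrite normr_sg; case: (h != 0).
(* A line of slope [v0 + e], or [v0 - e] when [h < 0], started slightly above [a t0], is a barrier:
   [v - c] has the required sign on the strip around it. The sign [sh] treats both directions of
   time together. *)
have up : a (t0 + h) <= a t0 + (v0 + e * sh) * h.
  apply/ler_addgt0Pr => k k0.
  pose k' := Num.min k (d2 / 4).
  have k'0 : 0 < k' by rewrite lt_min k0.
  have [k'k k'd] : k' <= k /\ k' <= d2 / 4 by rewrite !ge_min !lexx orbT.
  have := Ha (v0 + e * sh) (a t0 + k' - (v0 + e * sh) * t0) t0 (t0 + h) (d2 / 8).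
  rewrite divr_gt0// subrK ltrDl => /(_ isT) H.
  have {}H : a (t0 + h) <= a t0 + k' - (v0 + e * sh) * t0 + (v0 + e * sh) * (t0 + h).
    apply: H => // x tau /between tauh xz.
    have c1 : `|v0 + e * sh - v0| <= e.
      by rewrite addrAC subrr add0r normrM (gtr0_norm e0) ler_piMr// ltW.
    have : `|v (x, tau) - v0| <= e.
      apply: Hv; first exact: le_lt_trans hd1.
      have -> : x - a t0 = (x - (a t0 + k' - (v0 + e * sh) * t0 + (v0 + e * sh) * tau)
        + k') + (v0 + e * sh) * (tau - t0) by ring.
      apply: strip => //.
      by apply: (le_lt_trans (ler_normD _ _)); rewrite (gtr0_norm k'0); lra.
    rewrite (_ : t0 + h - t0 = h); last by ring.
    have -> : (v (x, tau) - (v0 + e * sh)) * h = (v (x, tau) - v0) * h - e * (sh * h).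
      by ring.
    rewrite shh => b1; have := ler_norm ((v (x, tau) - v0) * h).
    by rewrite normrM; have := normr_ge0 h; nra.
  by move: H; rewrite (_ : _ + _ * (t0 + h) = a t0 + (v0 + e * sh) * h + k'); [lra|ring].
(* Barriers bound the curve from above only, so for the lower bound one is run backwards, from
   [t0 + h] to [t0]: a curve too low at [t0 + h] would have to be at most [a t0 - k] at [t0]. *)
have dn : a t0 + (v0 - e * sh) * h <= a (t0 + h).
  rewrite leNgt; apply/negP => lt1.
  pose k := Num.min (a t0 + (v0 - e * sh) * h - a (t0 + h)) (d2 / 4) / 2.
  have k0 : 0 < k by rewrite divr_gt0// lt_min subr_gt0 lt1.
  have [k1 k2] : k * 2 <= a t0 + (v0 - e * sh) * h - a (t0 + h) /\ k * 2 <= d2 / 4.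
    by rewrite !divfK// !ge_min !lexx orbT.
  have := Ha (v0 - e * sh) (a t0 - k - (v0 - e * sh) * t0) (t0 + h) t0 (d2 / 8).
  rewrite divr_gt0// subrK => /(_ isT) H.
  suff : a t0 <= a t0 - k by lra.
  apply: H; last by lra.
  move=> x tau; rewrite minC maxC => /between tauh xz.
  have c1 : `|v0 - e * sh - v0| <= e.
    by rewrite addrAC subrr add0r normrN normrM (gtr0_norm e0) ler_piMr// ltW.
  have : `|v (x, tau) - v0| <= e.
    apply: Hv; first exact: le_lt_trans hd1.
    have -> : x - a t0 = (x - (a t0 - k - (v0 - e * sh) * t0 + (v0 - e * sh) * tau)
      - k) + (v0 - e * sh) * (tau - t0) by ring.
    apply: strip => //.
    by apply: (le_lt_trans (ler_normB _ _)); rewrite (gtr0_norm k0); lra.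
  have -> : (v (x, tau) - (v0 - e * sh)) * (t0 - (t0 + h)) =
     - ((v (x, tau) - v0) * h) - e * (sh * h) by ring.
  rewrite shh => b1; have := ler_norm (- ((v (x, tau) - v0) * h)).
  by rewrite normrN normrM; have := normr_ge0 h; nra.
have E1 : (v0 + e * sh) * h = v0 * h + e * `|h| by rewrite -shh; ring.
have E2 : (v0 - e * sh) * h = v0 * h - e * `|h| by rewrite -shh; ring.
by rewrite ler_norml; lra.
Qed.

End Transport.

(** * Primitives of square integrable functions *)

Section SquareIntegrable.
Context {R : realType}.
Implicit Types (p q u w : R -> R) (a b c x y z e k r : R).

Definition sqint p := measurable_fun setT (p : borelR R -> R) /\
  (leb R).-integrable setT (EFin \o (fun x => p x ^+ 2)).

Lemma L2_sqint p : L2 p -> sqint p.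
Proof.
move=> Lp; split; last exact: Lfun2_integrable_sqr.
by have := sub_Lfun_mfun Lp; rewrite inE.
Qed.

Lemma le_integrableR (D : set (borelR R)) (f g : borelR R -> R) : measurable D ->
  measurable_fun D f -> (forall x, D x -> `|f x| <= g x) ->
  (leb R).-integrable D (EFin \o g) -> (leb R).-integrable D (EFin \o f).
Proof.
move=> mD mf fg; apply: le_integrable => //; first exact/measurable_EFinP.
by move=> x Dx /=; rewrite lee_fin (le_trans (fg x Dx))// ler_norm.
Qed.

Lemma integrableRD (D : set (borelR R)) (f g : borelR R -> R) : measurable D ->
  (leb R).-integrable D (EFin \o f) -> (leb R).-integrable D (EFin \o g) ->
  (leb R).-integrable D (EFin \o (fun x => f x + g x)).
Proof. by move=> mD; exact: integrableD. Qed.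

Lemma integrableRB (D : set (borelR R)) (f g : borelR R -> R) : measurable D ->
  (leb R).-integrable D (EFin \o f) -> (leb R).-integrable D (EFin \o g) ->
  (leb R).-integrable D (EFin \o (fun x => f x - g x)).
Proof. by move=> mD; exact: integrableB. Qed.

Lemma integrableRZ (D : set (borelR R)) k (f : borelR R -> R) : measurable D ->
  (leb R).-integrable D (EFin \o f) ->
  (leb R).-integrable D (EFin \o (fun x => k * f x)).
Proof. by move=> mD; exact: integrableZl. Qed.

Lemma sqint_mul p q : sqint p -> sqint q ->
  (leb R).-integrable setT (EFin \o (fun x => p x * q x)).
Proof.
move=> [mp ip] [mq iq].
apply: (@le_integrableR _ _ (fun x => p x ^+ 2 + q x ^+ 2)) => //.
- exact: measurable_funM.
- move=> x _; rewrite normrM -(real_normK (num_real (p x))) -(real_normK (num_real (q x))).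
  have := normr_ge0 (p x); have := normr_ge0 (q x).
  by move: `|_| `|_| => a b a0 b0; nra.
- exact: integrableRD.
Qed.

Lemma sqintD p q : sqint p -> sqint q -> sqint (fun x => p x + q x).
Proof.
move=> sp sq; have [mp ip] := sp; have [mq iq] := sq; split.
  exact: measurable_funD.
rewrite (_ : (fun x => _) = fun x => p x ^+ 2 + q x ^+ 2 + 2 * (p x * q x)).
  apply: integrableRD => //; first exact: integrableRD.
  exact/integrableRZ/sqint_mul.
by apply/funext => x; ring.
Qed.

Lemma sqintM_Cb u p : Cb u -> sqint p -> sqint (fun x => u x * p x).
Proof.
move=> /CbP[cu [K HK]] [mp ip]; have mu := continuous_measurable_fun cu.
split; first exact: measurable_funM.
apply: (@le_integrableR _ _ (fun x => K ^+ 2 * p x ^+ 2)) => //.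
- by apply: measurable_funX; exact: measurable_funM.
- move=> x _; rewrite (ger0_norm (sqr_ge0 _)) exprMn ler_wpM2r ?sqr_ge0//.
  rewrite -(real_normK (num_real (u x))) lerXn2r ?nnegrE//.
  exact: le_trans (normr_ge0 _) (HK x).
- exact: integrableRZ.
Qed.

Lemma bounded_bsupp_sqint p k : measurable_fun setT (p : borelR R -> R) ->
  (forall x, `|p x| <= k) -> bsupp p -> sqint p.
Proof.
move=> mp pk bp; split => //.
apply: (@bounded_bsupp_integrable R _ (k ^+ 2)).
- exact: measurable_funX.
- by move=> x; rewrite normrX lerXn2r ?nnegrE ?(le_trans _ (pk x)).
- by rewrite (_ : (fun x => _) = fun x => p x * p x); [exact: bsuppMl|apply/funext => x; ring].
Qed.

Lemma ccs_sqint p : ccs p -> sqint p.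
Proof.
move=> cp; have [k pk] := ccs_bounded cp; have [cop bp] := cp.
exact: bounded_bsupp_sqint (continuous_measurable_fun cop) pk bp.
Qed.

Lemma integrable_segment_cst a b k :
  (leb R).-integrable (`[a, b] : set (borelR R)) (EFin \o (fun _ => k)).
Proof.
apply: continuous_compact_integrable; first exact: segment_compact.
by apply: continuous_subspaceT => x; exact: cvg_cst.
Qed.

Lemma integrable_segment (f : borelR R -> R) a b :
  (leb R).-integrable setT (EFin \o f) ->
  (leb R).-integrable (`[a, b] : set (borelR R)) (EFin \o f).
Proof. by apply: integrableS => //; exact: measurable_itv. Qed.

Lemma sqint_segment p a b : sqint p ->
  (leb R).-integrable (`[a, b] : set (borelR R)) (EFin \o p).
Proof.
move=> [mp ip]; apply: (@le_integrableR _ _ (fun x => 1 + p x ^+ 2)) => //.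
- exact: measurable_funTS.
- move=> x _; rewrite -(real_normK (num_real (p x))).
  by have := normr_ge0 (p x); move: `|_| => c c0; nra.
- by apply: integrableRD => //; [exact: integrable_segment_cst|exact: integrable_segment].
Qed.

Definition segI p a b : R := \int[leb R]_(x in `[a, b]) p x.

Lemma segI_split p a b c : a <= b -> b <= c ->
  (leb R).-integrable (`[a, c] : set (borelR R)) (EFin \o p) ->
  segI p a c = segI p a b + segI p b c.
Proof.
move=> ab bc ip.
have := @Rintegral_itvB R p (BLeft a) (BRight c) b ip; rewrite !bnd_simp => /(_ ab bc).
rewrite Rintegral_itv_obnd_cbnd.
  by rewrite /segI => <-; rewrite addrC subrK.
apply: integrableS ip => //; try exact: measurable_itv.
by move=> x /=; rewrite !in_itv/= => /andP[bx ->]; rewrite (le_trans ab (ltW bx)).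
Qed.

Lemma segI_cst a b k : a <= b -> segI (fun _ => k) a b = k * (b - a).
Proof.
move=> ab; rewrite /segI Rintegral_cst; last exact: measurable_itv.
have := @lebesgue_measure_itv R `[a, b]; rewrite /= lte_fin => ->.
case: ltP => //= ba.
by rewrite (le_anti (introT andP (conj ab ba))) subrr.
Qed.

Lemma segI_ge0 p a b : (forall x, 0 <= p x) -> 0 <= segI p a b.
Proof. by move=> p0; apply: Rintegral_ge0. Qed.

Lemma le_segI p q a b :
  (leb R).-integrable (`[a, b] : set (borelR R)) (EFin \o p) ->
  (leb R).-integrable (`[a, b] : set (borelR R)) (EFin \o q) ->
  (forall x, a <= x <= b -> p x <= q x) -> segI p a b <= segI q a b.
Proof.
by move=> ip iq pq; apply: le_Rintegral.
Qed.

Lemma integrable_normR (D : set (borelR R)) (f : borelR R -> R) :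
  (leb R).-integrable D (EFin \o f) ->
  (leb R).-integrable D (EFin \o (fun x => `|f x|)).
Proof. exact: integrable_norm. Qed.

Lemma segI_norm p a b :
  (leb R).-integrable (`[a, b] : set (borelR R)) (EFin \o p) ->
  `|segI p a b| <= segI (fun x => `|p x|) a b.
Proof. by move=> ip; apply: le_normr_Rintegral => //; exact: measurable_itv. Qed.

(** The integral of [(|p| - l) ^+ 2] is nonnegative, where [l] is the mean of [|p|] over the
    segment. *)
Lemma segI_Cauchy_Schwarz p a b : a <= b -> sqint p ->
  segI (fun x => `|p x|) a b ^+ 2 <= (b - a) * segI (fun x => p x ^+ 2) a b.
Proof.
rewrite le_eqVlt => /predU1P[<-|ab] sp.
  by rewrite /segI set_itv1 !Rintegral_set1 mulr0 expr0n.
have mab : measurable (`[a, b] : set (borelR R)) by exact: measurable_itv.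
have ip := integrable_normR (sqint_segment a b sp).
have iq := integrable_segment a b sp.2.
set P := segI _ _ _; pose l := P / (b - a).
have ba : 0 < b - a by rewrite subr_gt0.
have : 0 <= segI (fun x => p x ^+ 2 - 2 * l * `|p x| + l ^+ 2) a b.
  apply: segI_ge0 => x; rewrite -(real_normK (num_real (p x))).
  by rewrite (_ : _ + _ = (`|p x| - l) ^+ 2) ?sqr_ge0//; ring.
rewrite /segI RintegralD//; last 2 first.
- by apply: integrableRB => //; exact: integrableRZ.
- exact: integrable_segment_cst.
rewrite RintegralB//; last exact: integrableRZ.
rewrite RintegralZl// -/(segI (fun=> l ^+ 2) a b) (segI_cst _ (ltW ab)).
rewrite -/(segI (fun x => `|p x|) a b) -/P -/(segI (fun x => p x ^+ 2) a b).
have lE : l * (b - a) = P by rewrite /l divfK// gt_eqF.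
move: (segI _ a b) lE; clearbody l P; move=> I lE h.
have : P ^+ 2 = l * (b - a) * P by rewrite lE expr2.
nra.
Qed.

(** Each bisection halves the factor [y - x] while [D] and [S] add up, so after [n] of them
    [|D x y|] is at most [(y - x) * S x y] divided by [2 ^+ n]. *)
Lemma additive_square_vanish (D S : R -> R -> R) :
  (forall x y z, x <= y -> y <= z -> D x z = D x y + D y z) ->
  (forall x y z, x <= y -> y <= z -> S x z = S x y + S y z) ->
  (forall x y, x <= y -> `|D x y| <= (y - x) * S x y) ->
  forall x y, x <= y -> D x y = 0.
Proof.
move=> HD HS DS.
have H n : forall x y, x <= y -> `|D x y| * 2 ^+ n <= (y - x) * S x y.
  elim: n => [|n IH] x y xy; first by rewrite expr0 mulr1 DS.
  pose m := (x + y) / 2; have xm : x <= m by rewrite /m; lra.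
  have my : m <= y by rewrite /m; lra.
  rewrite (HD _ _ _ xm my) (HS _ _ _ xm my).
  have := IH _ _ xm; have := IH _ _ my.
  have := ler_normD (D x m) (D m y).
  have : 0 <= (2 ^+ n : R) by rewrite exprn_ge0.
  rewrite exprS (_ : m - x = (y - x) / 2); last by rewrite /m; field.
  rewrite (_ : y - m = (y - x) / 2); last by rewrite /m; field.
  move: (2 ^+ n) `|D x m + _| `|D x m| `|D m y| (S x m) (S m y).
  by clear; move=> k A B C s1 s2 k0 h1 h2 h3; nra.
move=> x y xy; apply/eqP; rewrite -normr_eq0 eq_le normr_ge0 andbT leNgt.
apply/negP => D0.
pose n := Num.bound `|(y - x) * S x y / `|D x y| |.
have := archi_boundP (normr_ge0 ((y - x) * S x y / `|D x y|)); rewrite -/n.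
have := H n x y xy; rewrite -ler_pdivlMl// mulrC => h1 h2.
have : (n%:R : R) < 2 ^+ n by rewrite -natrX ltr_nat ltn_expl.
have := ler_norm ((y - x) * S x y / `|D x y|).
by move: h1 h2; clear; lra.
Qed.

Definition primitive u p := sqint p /\ forall a b, a <= b -> u b - u a = segI p a b.

(** The defect [D] of the product rule is additive in the interval and quadratically small, hence
    zero by bisection. *)
Lemma primitive_mul u w p q : Cb u -> Cb w -> primitive u p -> primitive w q ->
  primitive (fun x => u x * w x) (fun x => u x * q x + w x * p x).
Proof.
move=> bu bw [sp up] [sq wq].
have suq := sqintM_Cb bu sq; have swp := sqintM_Cb bw sp.
have sI := sqintD suq swp.
split=> // a b ab; apply/eqP; rewrite -subr_eq0; apply/eqP.
pose D x y := u y * w y - u x * w x - segI (fun x => u x * q x + w x * p x) x y.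
pose S x y := segI (fun x => p x ^+ 2) x y + segI (fun x => q x ^+ 2) x y.
apply: (@additive_square_vanish D S) ab => [x y z xy yz|x y z xy yz|x y xy].
- by rewrite /D (segI_split xy yz) ?sqint_segment//; ring.
- rewrite /S (segI_split xy yz) ?(integrable_segment _ _ sp.2)//.
  by rewrite (segI_split xy yz) ?(integrable_segment _ _ sq.2)//; ring.
have mxy : measurable (`[x, y] : set (borelR R)) by exact: measurable_itv.
set P := segI (fun x => `|p x|) x y; set Q := segI (fun x => `|q x|) x y.
have P0 : 0 <= P by exact: segI_ge0.
have Q0 : 0 <= Q by exact: segI_ge0.
(* Splitting [u y * w y - u x * w x] as [u y * (w y - w x) + w x * (u y - u x)] leaves only
   increments of [u] and [w] as factors. They are bounded by [P] and [Q], and [2 P Q] is at most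
   [P ^ 2 + Q ^ 2], to which Cauchy-Schwarz applies. *)
have DE : D x y = segI (fun z => (u y - u z) * q z + (w x - w z) * p z) x y.
  have -> : (fun z => (u y - u z) * q z + (w x - w z) * p z) =
    (fun z => (u y * q z + w x * p z) - (u z * q z + w z * p z)).
    by apply/funext => z; ring.
  rewrite /segI RintegralB//; [|apply: integrableRD => //; exact/integrableRZ/sqint_segment|exact: sqint_segment].
  rewrite RintegralD//; [|exact/integrableRZ/sqint_segment..].
  rewrite !RintegralZl//; [|exact: sqint_segment..].
  rewrite -/(segI q x y) -/(segI p x y) -(up _ _ xy) -(wq _ _ xy).
  by rewrite /D /segI; ring.
have uyz z : x <= z <= y -> `|u y - u z| <= P.
  move=> /andP[xz zy]; rewrite (up _ _ zy); apply: le_trans (segI_norm _) _.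
    exact: sqint_segment.
  by rewrite /P (segI_split xz zy) ?lerDr ?segI_ge0//; exact/integrable_normR/sqint_segment.
have wxz z : x <= z <= y -> `|w x - w z| <= Q.
  move=> /andP[xz zy]; rewrite distrC (wq _ _ xz); apply: le_trans (segI_norm _) _.
    exact: sqint_segment.
  by rewrite /Q (segI_split xz zy) ?lerDl ?segI_ge0//; exact/integrable_normR/sqint_segment.
have iu : sqint (fun z => (u y - u z) * q z).
  by apply: sqintM_Cb => //; apply: CbB => //; exact: Cb_cst.
have iw : sqint (fun z => (w x - w z) * p z).
  by apply: sqintM_Cb => //; apply: CbB => //; exact: Cb_cst.
have iqn := integrable_normR (sqint_segment x y sq).
have ipn := integrable_normR (sqint_segment x y sp).
have D1 : `|D x y| <= P * Q + Q * P.
  rewrite DE; apply: (le_trans (segI_norm (sqint_segment _ _ (sqintD iu iw)))).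
  have E : P * Q + Q * P = segI (fun z => P * `|q z| + Q * `|p z|) x y.
    rewrite /segI RintegralD//; [|exact: integrableRZ..].
    by rewrite !RintegralZl.
  rewrite E; apply: le_segI.
  - exact/integrable_normR/sqint_segment/sqintD.
  - by apply: integrableRD => //; exact: integrableRZ.
  - move=> z xzy; rewrite (le_trans (ler_normD _ _))// !normrM.
    by rewrite lerD// ler_wpM2r// ?uyz ?wxz.
have := segI_Cauchy_Schwarz xy sp; have := segI_Cauchy_Schwarz xy sq.
rewrite -/P -/Q /S mulrDr => h1 h2; apply: le_trans D1 _.
by have := sqr_ge0 (P - Q); rewrite sqrrB; move: h1 h2; clear; lra.
Qed.

Let indic_itv c d x : \1_(`[c, d]%classic : set R) x = (c <= x <= d)%R%:R :> R.
Proof.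
rewrite indicE; congr (nat_of_bool _)%:R; apply/idP/idP.
  by rewrite inE /= in_itv.
by move=> cxd; rewrite inE /= in_itv.
Qed.

Let plateau_indic a b r x : 0 < r -> a + r <= b ->
  `|plateau a r b r x - \1_(`[a, b]%classic : set R) x| <= 1 /\
  `|plateau a r b r x - \1_(`[a, b]%classic : set R) x| <=
    \1_(`[a, a + r]%classic : set R) x + \1_(`[b, b + r]%classic : set R) x.
Proof.
move=> r0 arb; rewrite !indic_itv.
have p0 := @plateau_ge0 R a r b r x r0 r0 arb.
have p1 := @plateau_le1 R a r b r x r0 r0 arb.
have s1 : `|plateau a r b r x - (a <= x <= b)%R%:R| <= 1.
  by case: (_ && _); rewrite ler_norml/=; lra.
split => //.
have [ax|xa] := leP a x; last first.
  by rewrite plateau_out//= ?subr0 ?normr0 ?addr_ge0//; left; exact: ltW.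
have [xar|arx] := leP x (a + r).
  by apply: (le_trans _ (_ : 1 <= _)); [move: s1; rewrite ax|rewrite lerDl].
have [xb|bx] := leP x b.
  by rewrite plateau_in//= ?subrr ?normr0 ?addr_ge0// ltW.
have [xbr|brx] := leP x (b + r).
  by rewrite (ltW bx)/= subr0 add0r; rewrite ler_norml; lra.
by rewrite plateau_out//= ?andbF ?subr0 ?normr0 ?addr_ge0//; right; exact: ltW.
Qed.

(** Young's inequality with weight [l], where [s <= 1] replaces [s ^+ 2] by [s]. It weighs the place
    where a plateau differs from an indicator against the energy of [p]. *)
Let young_half (l q s c : R) : 0 < l -> 0 <= s -> s <= 1 -> s <= c ->
  q * s <= l / 2 * q ^+ 2 + (2 * l)^-1 * c.
Proof.
move=> l0 s0 s1 sc; rewrite -(ler_pM2l (x := 2 * l)) ?mulr_gt0//.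
rewrite mulrDr (mulrA _ _^-1) divff ?mul1r ?gt_eqF ?mulr_gt0//.
rewrite (_ : 2 * l * (l / 2 * q ^+ 2) = (l * q) ^+ 2); last by field.
have := sqr_ge0 (l * q - s); rewrite sqrrB => h.
have : s ^+ 2 <= c by rewrite expr2 (le_trans (ler_piMl _ _)).
by move: h; rewrite -mulr_natl; lra.
Qed.

(** The test function is a plateau approximating the indicator of [[a, b]]. Its ramps change the
    integral of [p] by at most [l / 2] times the energy plus [r / l]; the weight [l] is fixed first,
    the ramp width [r] afterwards. *)
Lemma weak_derivative_primitive u p : continuous u -> sqint p ->
  weak_derivative u p -> primitive u p.
Proof.
have arith (i1 i2 i3 q ua ub k : R) : - k <= i1 - ua <= k ->
  - k <= i2 - ub <= k -> - (2 * k) <= i3 - q <= 2 * k -> i1 - i2 = - i3 ->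
  - (4 * k) <= ub - ua - q <= 4 * k.
  by move=> /andP[? ?] /andP[? ?] /andP[? ?] ?; lra.
move=> cu sp Hup; split=> // a b.
rewrite le_eqVlt => /predU1P[<-|ab]; first by rewrite /segI set_itv1 Rintegral_set1 subrr.
pose E := rint (fun x => p x ^+ 2).
have E0 : 0 <= E by apply: Rintegral_ge0 => x _; exact: sqr_ge0.
have ind_sq c d : sqint (\1_(`[c, d]%classic : set R)).
  apply: (@bounded_bsupp_sqint _ 1).
  - by apply: measurable_indic; exact: measurable_itv.
  - by move=> x; rewrite indicE; case: (_ \in _); rewrite ?normr1 ?normr0.
  - exists (`|c| + `|d|) => x; rewrite ltr_normr => h; rewrite indicE memNset//=.
    rewrite in_itv/= => /andP[cx xd].
    have := ler_norm d; have := ler_norm (- c); rewrite normrN.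
    by have := normr_ge0 c; have := normr_ge0 d; case/orP: h; lra.
have ind_I c d : c <= d -> rint (\1_(`[c, d]%classic : set R)) = d - c.
  move=> cd; rewrite -[RHS]mul1r -segI_cst// /segI [RHS]Rintegral_mkcond.
  by apply: eq_Rintegral => x _; rewrite patchE /=; case: (_ \in _).
have segE : segI p a b = rint (fun x => p x * \1_(`[a, b]%classic : set R) x).
  rewrite /segI Rintegral_mkcond; apply: eq_Rintegral => x _.
  by rewrite patchE indicE; case: (_ \in _); rewrite ?mulr1 ?mulr0.
suff H e : 0 < e -> `|u b - u a - segI p a b| <= 4 * e.
  apply/eqP; rewrite -subr_eq0 -normr_eq0 eq_le normr_ge0 andbT.
  apply/ler_addgt0Pr => e e0; rewrite add0r.
  have := H (e / 4); rewrite divr_gt0// => /(_ isT).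
  by rewrite (_ : 4 * (e / 4) = e)//; field.
move=> e0.
have [d1 d10 H1] := (continuous_epsP u a).1 (cu a) _ e0.
have [d2 d20 H2] := (continuous_epsP u b).1 (cu b) _ e0.
pose l := e / (E + 1).
have l0 : 0 < l by rewrite divr_gt0// ltr_wpDl.
have lE : l * E <= e.
  by rewrite /l mulrAC ler_pdivrMr ?ltr_wpDl// ler_pM2l// lerDl.
have [r r0 [r1 r2 r3 r4]] : exists2 r, 0 < r &
    [/\ r < d1, r < d2, a + r <= b & r <= e * l].
  exists (Num.min (Num.min d1 d2) (Num.min (b - a) (e * l)) / 2).
    by rewrite divr_gt0// !lt_min d10 d20 subr_gt0 ab mulr_gt0.
  set m := Num.min _ _.
  have [m1 m2 m3 m4] : [/\ m <= d1, m <= d2, m <= b - a & m <= e * l].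
    by rewrite /m !ge_min !lexx ?orbT.
  have m0 : 0 < m by rewrite /m !lt_min d10 d20 subr_gt0 ab mulr_gt0.
  by clearbody m; split; lra.
have Ha x : a <= x <= a + r -> `|u x - u a| <= e.
  by move=> /andP[? ?]; apply: H1; rewrite ger0_norm; lra.
have Hb x : b <= x <= b + r -> `|u x - u b| <= e.
  by move=> /andP[? ?]; apply: H2; rewrite ger0_norm; lra.
have K1 := rint_step_derive1_close r0 cu Ha.
have K2 := rint_step_derive1_close r0 cu Hb.
have tp := plateau_test r0 r0 r3.
have := Hup _ tp; set psi := plateau a r b r in tp *.
have cpsi : ccs psi by split; [exact: smooth_cont tp.1|exact: test_bsupp].
have -> : rint (fun x => u x * derive1 psi x) =
    rint (fun x => u x * derive1 (step a r) x) -
    rint (fun x => u x * derive1 (step b r) x).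
  rewrite -rintB; [|exact/ccsMl/step_derive1_ccs..].
  by apply: eq_Rintegral => x _; rewrite plateau_derive1 mulrBr.
have i1 := sqint_mul sp (ccs_sqint cpsi).
have i2 := sqint_mul sp (ind_sq a b).
have K3 : `|rint (fun x => p x * psi x) - segI p a b| <= 2 * e.
  rewrite segE -RintegralB//.
  have iB := integrableRB measurableT i1 i2.
  apply: (le_trans (le_normr_Rintegral measurableT iB)).
  pose G x := l / 2 * p x ^+ 2 + (2 * l)^-1 *
    (\1_(`[a, a + r]%classic : set R) x + \1_(`[b, b + r]%classic : set R) x).
  have iG1 := integrableRZ (l / 2) measurableT sp.2.
  have iG2 := integrable_indic_itv a (a + r) true false.
  have iG3 := integrable_indic_itv b (b + r) true false.
  have iG4 := integrableRD measurableT iG2 iG3.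
  have iG5 := integrableRZ (2 * l)^-1 measurableT iG4.
  apply: (@le_trans _ _ (rint G)).
    apply: le_Rintegral => //; [exact: integrable_normR|exact: integrableRD|].
    move=> x _; rewrite -mulrBr normrM /G -/psi.
    have [s1 sc] := @plateau_indic a b r x r0 r3.
    rewrite -(real_normK (num_real (p x))).
    exact: young_half l0 (normr_ge0 (plateau a r b r x - _)) s1 sc.
  rewrite /G (RintegralD measurableT iG1 iG5).
  rewrite (RintegralZl (l / 2) measurableT sp.2).
  rewrite (RintegralZl (2 * l)^-1 measurableT iG4) (RintegralD measurableT iG2 iG3).
  rewrite !ind_I ?lerDl ?(ltW r0)// -/E.
  have -> : (2 * l)^-1 * (a + r - a + (b + r - b)) = r / l.
    by field; rewrite gt_eqF.
  have : r / l <= e by rewrite ler_pdivrMr.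
  by move: lE e0; clear; lra.
by move: K1 K2 K3; rewrite !ler_norml; exact: arith.
Qed.

End SquareIntegrable.

(** * The momentum equation along a characteristic *)

Section LebesgueIntegralsOfCurves.
Context {R : realType}.
Implicit Types (h k : R -> R -> R) (f g : R -> R) (x y z t e d c N T : R).
Implicit Types (nu : R -> finBorel R) (m : finBorel R).

(** A support that follows a moving point is uniformly bounded only for [t] in a bounded
    interval. *)
Definition loc_bsupp h :=
  forall T, exists N, forall t x, `|t| <= T -> N < `|x| -> h t x = 0.

Lemma loc_bsupp_bsupp h t : loc_bsupp h -> bsupp (h t).
Proof. by move=> /(_ `|t|)[N HN]; exists N => x; exact: HN. Qed.

Lemma loc_bsuppMl h k : loc_bsupp k -> loc_bsupp (fun t x => h t x * k t x).
Proof.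
by move=> lk T; have [N HN] := lk T; exists N => t x tT Nx; rewrite HN ?mulr0.
Qed.

Lemma loc_bsupp_moving g (xi : R -> R) : bsupp g -> continuous xi ->
  loc_bsupp (fun t x => g (x - xi t)).
Proof.
move=> [N HN] cxi T; have [K HK] := bounded_on_segment T cxi.
exists (N + K) => t x tT Nx; apply: HN.
have := HK t tT; have := ler_normD (x - xi t) (xi t); rewrite subrK; lra.
Qed.

(** An upper bound for the length of [[-N, N]], taken as the integral of a smooth cutoff to stay
    among continuous functions of bounded support. *)
Definition cutoff_mass N := rint (plateau (- (`|N| + 1)) 1 `|N| 1).

Lemma rint_abs_le f N e : (leb R).-integrable setT (EFin \o f) ->
  (forall x, `|f x| <= e) -> (forall x, N < `|x| -> f x = 0) ->
  `|rint f| <= e * cutoff_mass N.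
Proof.
move=> If fe f0; have e0 : 0 <= e := le_trans (normr_ge0 _) (fe 0).
have ab : - (`|N| + 1) + 1 <= `|N| by have := normr_ge0 N; lra.
have tW := plateau_test ltr01 ltr01 ab.
have cW : ccs (plateau (- (`|N| + 1)) 1 `|N| 1).
  by split; [exact: smooth_cont tW.1|exact: test_bsupp].
apply: (le_trans (le_normr_Rintegral measurableT If)).
rewrite -rintZ//; apply: le_Rintegral => //; first exact: integrable_normR.
  by apply: ccs_integrable; apply: (@ccsMl R (fun _ => e)) => // x; exact: cvg_cst.
move=> x _; have [xN|Nx] := leP `|x| N.
  rewrite plateau_in ?mulr1//; have := ler_norm N; have := ler_norm x;
    have := ler_norm (- x); rewrite normrN; lra.
by rewrite f0// normr0 mulr_ge0// plateau_ge0.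
Qed.

Lemma cutoff_mass_ge0 N : 0 <= cutoff_mass N.
Proof.
have ab : - (`|N| + 1) + 1 <= `|N| by have := normr_ge0 N; lra.
by apply: Rintegral_ge0 => x _; rewrite plateau_ge0.
Qed.

Lemma ucb_loc_ccs h t : ucb h -> loc_bsupp h -> ccs (h t).
Proof.
by move=> [bh _] lh; split; [have [] := bh t|exact: loc_bsupp_bsupp].
Qed.

Lemma nbhs_norm_le t t0 d : `|t - t0| < d -> d <= 1 -> `|t| <= `|t0| + 1.
Proof. by move=> h1 h2; have := ler_normD (t - t0) t0; rewrite subrK; lra. Qed.

Lemma continuous_rint h : ucb h -> loc_bsupp h -> continuous (fun t => rint (h t)).
Proof.
move=> uh lh t0; apply/continuous_epsP => e e0.
have [N HN] := lh (`|t0| + 1).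
have c0 : 0 < cutoff_mass N + 1 by rewrite ltr_wpDl ?cutoff_mass_ge0.
have e10 : 0 < e / (cutoff_mass N + 1) by rewrite divr_gt0.
have [d d0 Hd] := uh.2 t0 _ e10.
exists (Num.min d 1); first by rewrite lt_min d0/=.
move=> t; rewrite lt_min => /andP[td t1].
have c1 := ucb_loc_ccs t uh lh; have c2 := ucb_loc_ccs t0 uh lh.
rewrite -rintB//; apply: le_trans (rint_abs_le (N := N) _ (Hd t td) _) _.
- exact/ccs_integrable/ccsB.
- move=> x Nx; rewrite !HN ?subr0//; last exact: nbhs_norm_le t1 _.
  by rewrite lerDl.
- by rewrite mulrAC ler_pdivrMr// ler_pM2l// lerDl.
Qed.

(** By Tonelli, integrating [cdf (nu t) * h t] over the line is the same as integrating this
    function against [nu t]. It is bounded and continuous in [z], so weak continuity of [nu] applies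
    to it, unlike to the half-line indicators that define [cdf]. *)
Definition tail_int h t z := rint (fun x => (z <= x)%R%:R * h t x).

Let tail_integrable f z : ccs f ->
  (leb R).-integrable setT (EFin \o (fun x => (z <= x)%R%:R * f x)).
Proof.
move=> cf; have [K HK] := ccs_bounded cf; have [cof bf] := cf.
apply: (@bounded_bsupp_integrable R _ K).
- apply: measurable_funM; last exact: continuous_measurable_fun.
  rewrite (_ : (fun x => _) = \1_(`[z, +oo[%classic : set R)).
    by apply: measurable_indic; exact: measurable_itv.
  apply/funext => x; rewrite indicE; congr (nat_of_bool _)%:R.
  by apply/idP/idP; rewrite inE/= in_itv/= andbT.
- move=> x; rewrite normrM; case: (z <= x); rewrite ?normr1 ?mul1r//.
  by rewrite normr0 mul0r (le_trans _ (HK x)).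
- exact: bsuppMl.
Qed.

Lemma tail_int_ucb h : ucb h -> loc_bsupp h -> ucb (tail_int h).
Proof.
move=> uh lh; split=> [t|t0 e e0].
  have ct := ucb_loc_ccs t uh lh; have [K HK] := ccs_bounded ct.
  have K0 : 0 <= K := le_trans (normr_ge0 _) (HK 0).
  apply/CbP; split.
    suff lip x y : x <= y -> `|tail_int h t x - tail_int h t y| <= K * (y - x).
      move=> z; apply/continuous_epsP => e e0.
      have K1 : 0 < K + 1 by rewrite ltr_wpDl.
      exists (e / (K + 1)); first by rewrite divr_gt0.
      move=> y; rewrite ltr_pdivlMr// => yz.
      have [xy|yx] := leP y z.
        by apply: le_trans (lip _ _ xy) _; rewrite -normrN opprB ger0_norm in yz; nra.
      rewrite distrC; apply: le_trans (lip _ _ (ltW yx)) _.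
      by rewrite gtr0_norm ?subr_gt0// in yz; nra.
    move=> xy; rewrite /tail_int -RintegralB//; [|exact: tail_integrable..].
    have iB := integrableRB measurableT (tail_integrable x ct) (tail_integrable y ct).
    apply: (le_trans (le_normr_Rintegral measurableT iB)).
    rewrite -segI_cst// /segI [leRHS]Rintegral_mkcond.
    apply: le_Rintegral => //; first exact: integrable_normR.
      rewrite -restrict_EFin; apply: (proj1 (integrable_mkcond _ _)).
        exact: measurable_itv.
      exact: integrable_segment_cst.
    move=> z _; rewrite patchE -mulrBl normrM.
    case: ifPn => [_|nxy].
      rewrite -[leRHS]mul1r ler_pM//.
      by case: (x <= z); case: (y <= z); rewrite ?subrr ?subr0 ?sub0r ?normrN ?normr1 ?normr0.
    have [xz|zx] := leP x z; last first.
      have -> : (y <= z) = false by apply/negbTE; rewrite -ltNge (lt_le_trans zx xy).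
      by rewrite subrr normr0 mul0r.
    have [yz|zy] := leP y z; first by rewrite subrr normr0 mul0r.
    by move/negP: nxy; case; rewrite inE/= in_itv/= xz ltW.
  have [N HN] := lh `|t|.
  exists (K * cutoff_mass N) => z; apply: rint_abs_le => [|x|x Nx].
  - exact: tail_integrable.
  - rewrite normrM; case: (z <= x); rewrite ?normr1 ?mul1r//.
    by rewrite normr0 mul0r.
  - by rewrite HN ?mulr0.
have [N HN] := lh (`|t0| + 1).
have c0 : 0 < cutoff_mass N + 1 by rewrite ltr_wpDl ?cutoff_mass_ge0.
have e10 : 0 < e / (cutoff_mass N + 1) by rewrite divr_gt0.
have [d d0 Hd] := uh.2 t0 _ e10.
exists (Num.min d 1); first by rewrite lt_min d0/=.
move=> t; rewrite lt_min => /andP[td t1] z.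
have c1 := ucb_loc_ccs t uh lh; have c2 := ucb_loc_ccs t0 uh lh.
rewrite /tail_int -RintegralB//; [|exact: tail_integrable..].
apply: le_trans (rint_abs_le (N := N) (e := e / (cutoff_mass N + 1)) _ _ _) _.
- by apply: integrableRB => //; exact: tail_integrable.
- move=> x; rewrite -mulrBr normrM; case: (z <= x).
    by rewrite normr1 mul1r Hd.
  by rewrite normr0 mul0r ltW.
- move=> x Nx; rewrite !HN ?mulr0 ?subr0//; last exact: nbhs_norm_le t1 _.
  by rewrite lerDl.
- by rewrite mulrAC ler_pdivrMr// ler_pM2l// lerDl.
Qed.

Lemma cdf_measurable m : measurable_fun setT (cdf m : borelR R -> R).
Proof. by apply: nondecreasing_measurable => // x y; exact: cdf_homo. Qed.

Lemma cdf_ccs_integrable m f : ccs f ->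
  (leb R).-integrable setT (EFin \o (fun x => cdf m x * f x)).
Proof.
move=> cf; have [K HK] := ccs_bounded cf; have [cof bf] := cf.
apply: (@bounded_bsupp_integrable R _ (mass m * K)).
- by apply: measurable_funM; [exact: cdf_measurable|exact: continuous_measurable_fun].
- by move=> x; rewrite normrM ler_pM// ger0_norm ?cdf_ge0// cdf_le_mass.
- exact: bsuppMl.
Qed.

Lemma rint_cdf m f : ccs f -> (forall x, 0 <= f x) ->
  rint (fun x => cdf m x * f x) =
  Rintegral m setT (fun z => rint (fun x => (z <= x)%R%:R * f x)).
Proof.
move=> cf f0.
pose F (p : borelR R * borelR R) : \bar R := ((p.2 <= p.1)%R%:R * f p.1)%:E.
have mF : measurable_fun setT F.
  apply/measurable_EFinP; apply: measurable_funM.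
    have mle : measurable [set p : borelR R * borelR R | p.2 <= p.1].
      have := @measurable_fun_le _ (borelR R * borelR R)%type R setT snd fst
        measurableT measurable_snd measurable_fst.
      by rewrite setTI.
    rewrite (_ : (fun p => _) = \1_[set p : borelR R * borelR R | p.2 <= p.1]).
      exact: measurable_indic.
    apply/funext => p; rewrite indicE; congr (nat_of_bool _)%:R.
    by apply/idP/idP; rewrite inE.
  apply: measurableT_comp; last exact: measurable_fst.
  by have [/continuous_measurable_fun] := cf.
have F0 p : (0 <= F p)%E by rewrite lee_fin mulr_ge0.
have := @fubini_tonelli _ _ _ _ _ (leb R) m F mF F0.
rewrite /Rintegral => E; congr fine.
rewrite (_ : (fun x => (cdf m x * f x)%:E) = (fun x => \int[m]_y F (x, y))%E).
  rewrite E; apply: eq_integral => z _.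
  rewrite fineK//; apply: integrable_fin_num => //; exact: tail_integrable.
apply/funext => x; rewrite /F/=.
under eq_integral do rewrite mulrC EFinM.
rewrite ge0_integralZl_EFin//; last first.
  apply/measurable_EFinP.
  rewrite (_ : (fun y => _) = \1_(`]-oo, x]%classic : set R)).
    by apply: measurable_indic; exact: measurable_itv.
  apply/funext => y; rewrite indicE; congr (nat_of_bool _)%:R.
  by apply/idP/idP; rewrite inE/= in_itv.
rewrite EFinM muleC; congr (_ * _)%E.
rewrite (_ : (fun y => _) = (fun y => (\1_(`]-oo, x]%classic : set (borelR R)) y)%:E)).
  have mi : measurable (`]-oo, x] : set (borelR R)) by exact: measurable_itv.
  by rewrite integral_indic// setIT -cdfE.
apply/funext => y; rewrite indicE; congr (nat_of_bool _)%:R%:E.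
by apply/idP/idP; rewrite inE/= in_itv.
Qed.

Lemma continuous_rint_cdf nu h : weakly_continuous nu -> ucb h -> loc_bsupp h ->
  (forall t x, 0 <= h t x) ->
  continuous (fun t => rint (fun x => cdf (nu t) x * h t x)).
Proof.
move=> wnu uh lh h0.
rewrite (_ : (fun t => _) = fun t => Rintegral (nu t) setT (tail_int h t)).
  have ut := tail_int_ucb uh lh; exact: continuous_mint wnu ut.1 ut.2.
by apply/funext => t; rewrite rint_cdf//; exact: ucb_loc_ccs.
Qed.

End LebesgueIntegralsOfCurves.

(** * The momentum equation tested with moving profiles *)

Section MomentumEquation.
Context {R : realType}.
Implicit Types (v : R * R -> R) (ux : R -> R -> R) (nu : R -> finBorel R).
Implicit Types (f g u p : R -> R) (x y z t s e d c N T : R).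

Definition momentum_balance v ux nu := [/\ continuous_to_Cb v,
  weakly_continuous nu,
  forall t, weak_derivative (fun x => v (x, t)) (ux ^~ t) /\ L2 (ux ^~ t) &
  forall phi : R * R -> R, test_function phi ->
    \int[leb R]_t \int[leb R]_x
      (v (x, t) * Dt phi (x, t) -
       phi (x, t) * (v (x, t) * ux x t - 2^-1 * cdfF nu x t)) = 0].

(** The product [u * u * g] vanishes at both ends of a large segment, and by [primitive_mul] its
    increment is the integral of [2 g u p + u ^ 2 g']. *)
Lemma rint_test_mul_deriv u p g : Cb u -> sqint p -> weak_derivative u p ->
  smooth g -> bsupp g ->
  rint (fun x => g x * (u x * p x)) = - rint (fun x => 2^-1 * u x ^+ 2 * derive1 g x).
Proof.
move=> bu sp Hup sg bg; have [cu _] := bu.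
have [sdg cg cdg] := ccs_derive1 sg bg.
have [dg _] := smooth_derive sg.
have Pu := weak_derivative_primitive cu sp Hup.
have Pg : primitive g (derive1 g).
  split=> [|a b ab]; first exact: ccs_sqint.
  by rewrite /segI (@rint_FTC_segment R g)//; have [] := cdg.
have [sI PI] := primitive_mul (CbM bu bu) (ccs_Cb cg) (primitive_mul bu bu Pu Pu) Pg.
have [N HN] := bg; pose M := `|N| + 1.
have M0 : 0 <= M by rewrite addr_ge0.
have NM : N < M by rewrite /M; have := ler_norm N; lra.
have out x : x < - M \/ M < x -> g x = 0 /\ derive1 g x = 0.
  move=> h; have Nx : N < `|x|.
    by apply: (lt_trans NM); rewrite ltr_normr; case: h => h;
      apply/orP; [right; rewrite ltrNr|left].
  by rewrite HN// (derive1_vanish sg HN).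
have i1 : (leb R).-integrable setT (EFin \o (fun x => u x * u x * derive1 g x)).
  by apply: ccs_integrable; apply: ccsMl => // x; apply: cvgM; exact: cu.
have i2 : (leb R).-integrable setT (EFin \o (fun x => g x * (u x * p x))).
  apply: (@eq_integrable _ _ _ (leb R) setT measurableT
    (EFin \o (fun x => u x * g x * p x))); last first.
    by apply: sqint_mul sp; apply: ccs_sqint; exact: ccsMl.
  by move=> x _ /=; congr EFin; ring.
have := PI (- M) M; rewrite ge0_cp// => /(_ isT).
have gM : g M = 0 by apply: HN; rewrite ger0_norm.
have gNM : g (- M) = 0 by apply: HN; rewrite normrN ger0_norm.
rewrite gM gNM !mulr0 subrr /segI -(@rint_restrict R _ (- M) M); last first.
  by move=> x /out[-> ->]; rewrite mulr0 mul0r addr0.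
move=> E.
have : rint (fun x => u x * u x * derive1 g x) + 2 * rint (fun x => g x * (u x * p x)) = 0.
  rewrite -(RintegralZl 2 measurableT i2) -(RintegralD measurableT i1); last first.
    exact: integrableRZ.
  by rewrite E; apply: eq_Rintegral => x _; ring.
have -> : rint (fun x => 2^-1 * u x ^+ 2 * derive1 g x) =
    2^-1 * rint (fun x => u x * u x * derive1 g x).
  by rewrite -(RintegralZl _ measurableT i1); apply: eq_Rintegral => x _; ring.
move: (rint _) (rint _); clear => a b; lra.
Qed.

(** The term [v v_x] is moved onto [g] as [v ^ 2 / 2], so that [ux] disappears and the right-hand
    side is continuous in [t]. Nonnegativity of [g] enters through Tonelli for the [cdf] term. *)
Lemma momentum_is_derive v ux nu g c : momentum_balance v ux nu -> smooth g ->
  bsupp g -> (forall x, 0 <= g x) ->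
  forall t, is_derive t 1 (fun t => rint (fun x => v (x, t) * g (x - c * t)))
    (rint (fun x => (2^-1 * v (x, t) ^+ 2 - c * v (x, t)) * derive1 g (x - c * t)) +
     2^-1 * rint (fun x => cdf (nu t) x * g (x - c * t))).
Proof.
move=> [cv wnu Hux H3] sg bg g0.
have uv := continuous_to_Cb_ucb cv.
have [sdg cg cdg] := ccs_derive1 sg bg; have [_ bdg] := cdg.
have cc : continuous (fun t => c * t).
  by move=> t; apply: cvgM; [exact: cvg_cst|exact: cvg_id].
have ug := ucb_moving sg bg cc; have lg := loc_bsupp_moving bg cc.
have udg := ucb_moving sdg bdg cc; have ldg := loc_bsupp_moving bdg cc.
have uA := ucbM uv ug; have lA : loc_bsupp (fun t x => v (x, t) * g (x - c * t)).
  exact: loc_bsuppMl.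
have u1 : ucb (fun t x => (2^-1 * v (x, t) ^+ 2 - c * v (x, t)) * derive1 g (x - c * t)).
  apply: ucbM => //.
  rewrite (_ : (fun t x => _) = fun t x => (2^-1 * v (x, t) + - c) * v (x, t)).
    apply: ucbM => //; apply: ucbD; last exact: ucb_cst (Cb_cst _).
    by apply: ucbM => //; exact: ucb_cst (Cb_cst _).
  by apply/funext => t; apply/funext => x; ring.
have l1 : loc_bsupp (fun t x =>
    (2^-1 * v (x, t) ^+ 2 - c * v (x, t)) * derive1 g (x - c * t)) by exact: loc_bsuppMl.
have ccF := continuous_rint_cdf wnu ug lg (fun t x => g0 (x - c * t)).
apply: weak_derivative_is_derive.
- exact: continuous_rint.
- move=> t; apply: cvgD; first exact: continuous_rint.
  by apply: cvgM; [exact: cvg_cst|exact: ccF].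
move=> psi tp; rewrite -[RHS](H3 _ (moving_test_test c sg bg tp)).
apply: eq_Rintegral => t _.
have [wd Lux] := Hux t; have sux := L2_sqint Lux.
have cgt := ucb_loc_ccs t ug lg; have cdgt := ucb_loc_ccs t udg ldg.
have cA := ucb_loc_ccs t uA lA; have c1 := ucb_loc_ccs t u1 l1.
have bv := uv.1 t; have [cvt _] := bv.
pose gt x := g (x - c * t).
have sgt : smooth gt.
  move=> n; rewrite (_ : gt = g \o (fun x => x - c * t))//.
  apply: (@Cn_comp_affine R R n _ (fun x => x - c * t) id); last exact: sg.
    by move=> x; apply: cvgB; [exact: cvg_id|exact: cvg_cst].
  by move=> q w h; rewrite /GRing.scale/=; ring.
have dgt x : derive1 gt x = derive1 g (x - c * t).
  apply: is_derive_derive1; have [dg _] := smooth_derive sg.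
  have d1 : is_derive x 1 (fun x => x - c * t) 1.
    by apply: is_derive_eq (is_deriveB (is_derive_id x 1) (is_derive_cst (c * t) x 1)) _; rewrite subr0.
  have := @is_derive1_comp R g (fun x => x - c * t) x _ _ (dg (x - c * t)) d1.
  by rewrite mulr1.
have [_ bgt] := cgt.
have K := rint_test_mul_deriv bv sux wd sgt bgt.
have i2 : (leb R).-integrable setT (EFin \o (fun x => gt x * (v (x, t) * ux x t))).
  apply: (@eq_integrable _ _ _ (leb R) setT measurableT
    (EFin \o (fun x => v (x, t) * gt x * ux x t))); last first.
    by apply: sqint_mul sux; apply: ccs_sqint; exact: ccsMl.
  by move=> x _ /=; congr EFin; ring.
have i3 := cdf_ccs_integrable (nu t) cgt.
have iA := ccs_integrable cA.
have c4 : ccs (fun x => v (x, t) * derive1 g (x - c * t)) by exact: ccsMl.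
have i4 := ccs_integrable c4.
have c5 : ccs (fun x => 2^-1 * v (x, t) ^+ 2 * derive1 g (x - c * t)).
  apply: ccsMl => // x; apply: cvgM; first exact: cvg_cst.
  by under eq_fun do rewrite expr2; apply: cvgM; exact: cvt.
have i5 := ccs_integrable c5.
have E1 : rint (fun x => (2^-1 * v (x, t) ^+ 2 - c * v (x, t)) * derive1 g (x - c * t)) =
   rint (fun x => 2^-1 * v (x, t) ^+ 2 * derive1 g (x - c * t)) -
   c * rint (fun x => v (x, t) * derive1 g (x - c * t)).
  rewrite -(RintegralZl c measurableT i4) -(RintegralB measurableT i5); last exact: integrableRZ.
  by apply: eq_Rintegral => x _; ring.
have E2 : rint (fun x => 2^-1 * v (x, t) ^+ 2 * derive1 g (x - c * t)) =
    - rint (fun x => gt x * (v (x, t) * ux x t)).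
  by rewrite K opprK; apply: eq_Rintegral => x _; rewrite dgt.
have iZ1 := integrableRZ (derive1 psi t) measurableT iA.
have iZ2 := integrableRZ (c * psi t) measurableT i4.
have iZ3 := integrableRZ (psi t) measurableT i2.
have iZ4 := integrableRZ (2^-1 * psi t) measurableT i3.
transitivity (rint (fun x => derive1 psi t * (v (x, t) * g (x - c * t)) -
    c * psi t * (v (x, t) * derive1 g (x - c * t)) -
    psi t * (gt x * (v (x, t) * ux x t)) +
    2^-1 * psi t * (cdf (nu t) x * g (x - c * t)))).
  rewrite (RintegralD measurableT _ iZ4); last first.
    by apply: integrableRB => //; exact: integrableRB.
  rewrite (RintegralB measurableT _ iZ3); last exact: integrableRB.
  rewrite (RintegralB measurableT iZ1 iZ2).
  rewrite (RintegralZl _ measurableT iA) (RintegralZl _ measurableT i4).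
  rewrite (RintegralZl _ measurableT i2) (RintegralZl _ measurableT i3).
  rewrite E1 E2.
  move: (rint _) (rint _) (rint _) (rint _); clear => I1 I2 I3 I4; ring.
apply: eq_Rintegral => x _; rewrite moving_test_Dt//; last exact: tp.1.
by rewrite /moving_test/= -/(cdf (nu t) x) /gt /cdfF -/(cdf (nu t) x); ring.
Qed.

Lemma smooth_shift g c : smooth g -> smooth (fun x => g (x - c)) /\
  forall x, derive1 (fun x => g (x - c)) x = derive1 g (x - c).
Proof.
move=> sg; split=> [n|x].
  rewrite (_ : (fun x => _) = g \o (fun x => x - c))//.
  apply: (@Cn_comp_affine R R n _ (fun x => x - c) id); last exact: sg.
    by move=> x; apply: cvgB; [exact: cvg_id|exact: cvg_cst].
  by move=> q w h; rewrite /GRing.scale/=; ring.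
apply: is_derive_derive1; have [dg _] := smooth_derive sg.
have d1 : is_derive x 1 (fun x => x - c) 1.
  by apply: is_derive_eq (is_deriveB (is_derive_id x 1) (is_derive_cst c x 1)) _; rewrite subr0.
have := @is_derive1_comp R g (fun x => x - c) x _ _ (dg (x - c)) d1.
by rewrite mulr1.
Qed.

Lemma bsupp_shift g c : bsupp g -> bsupp (fun x => g (x - c)).
Proof.
move=> [N HN]; exists (N + `|c|) => x Nx; apply: HN.
by have := ler_normD (x - c) c; rewrite subrK; lra.
Qed.

(* In the frame moving along a characteristic the transport terms combine into a square. *)
Lemma momentum_along_characteristic v ux nu g (xi : R -> R) :
  momentum_balance v ux nu -> smooth g -> bsupp g -> (forall x, 0 <= g x) ->
  (forall t, is_derive t 1 xi (v (xi t, t))) ->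
  forall t, is_derive t 1 (fun t => rint (fun x => v (x, t) * g (x - xi t)))
    (2^-1 * rint (fun x => (v (x, t) - v (xi t, t)) ^+ 2 * derive1 g (x - xi t)) +
     2^-1 * rint (fun x => cdf (nu t) x * g (x - xi t))).
Proof.
have arith (a b c B q h e : R) : `|a - b| <= q -> `|b - c - B| <= e / 2 * h ->
    q <= e / 2 * h -> `|a - c - B| <= e * h.
  by rewrite !ler_norml => /andP[? ?] /andP[? ?] ?; apply/andP; split; lra.
move=> mb sg bg g0 dxi t0; have [cv wnu _ _] := mb.
have uv := continuous_to_Cb_ucb cv.
have cxi : continuous xi by move=> t; exact: is_derive_continuous (dxi t).
have [sdg cg cdg] := ccs_derive1 sg bg; have [_ bdg] := cdg.
have [dg _] := smooth_derive sg.
(* The line [k + c * t] is the tangent to [xi] at [t0]: the derivative is computed in this straight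
   frame and then transferred to [xi]. *)
set c := v (xi t0, t0); pose k := xi t0 - c * t0.
pose gk x := g (x - k).
have [sgk dgk] := smooth_shift k sg; have bgk := bsupp_shift k bg.
have gk0 x : 0 <= gk x by exact: g0.
have gkE t x : gk (x - c * t) = g (x - (k + c * t)) by rewrite /gk; congr g; ring.
have xi0 : k + c * t0 = xi t0 by rewrite /k subrK.
have DA := @momentum_is_derive v ux nu gk c mb sgk bgk gk0 t0.
have cc : continuous (fun t => k + c * t).
  move=> t; apply: cvgD; first exact: cvg_cst.
  by apply: cvgM; [exact: cvg_cst|exact: cvg_id].
(* Here [v ^ 2 / 2 - c v] equals [((v - c) ^ 2 - c ^ 2) / 2], and the constant [c ^ 2] disappears
   because [derive1 g] integrates to zero. *)
have B0 : rint (fun x => (2^-1 * v (x, t0) ^+ 2 - c * v (x, t0)) * derive1 gk (x - c * t0)) +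
     2^-1 * rint (fun x => cdf (nu t0) x * gk (x - c * t0)) =
   2^-1 * rint (fun x => (v (x, t0) - c) ^+ 2 * derive1 g (x - xi t0)) +
     2^-1 * rint (fun x => cdf (nu t0) x * g (x - xi t0)).
  congr (_ + 2^-1 * _); last by apply: eq_Rintegral => x _; rewrite gkE xi0.
  have cdg0 := ucb_loc_ccs t0 (ucb_moving sdg bdg cxi) (loc_bsupp_moving bdg cxi).
  have [cvt _] := uv.1 t0.
  have cs : ccs (fun x => (v (x, t0) - c) ^+ 2 * derive1 g (x - xi t0)).
    apply: ccsMl => //; under eq_fun do rewrite expr2.
    by move=> x; apply: cvgM; (apply: cvgB; [exact: cvt|exact: cvg_cst]).
  have Z : rint (fun x => derive1 g (x - xi t0)) = 0.
    have [sgx dgx] := smooth_shift (xi t0) sg.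
    have [M HM] := bsupp_shift (xi t0) bg.
    have [dx cdx] := smooth_derive sgx.
    have M1 : M < `|M| + 1 by have := ler_norm M; lra.
    rewrite (_ : (fun x => _) = derive1 (fun x => g (x - xi t0))); last first.
      by apply/funext => x; rewrite dgx.
    rewrite -[RHS]subr0; apply: (@rint_FTC R (fun x => g (x - xi t0)) _ 0 0 (`|M| + 1)) => //.
    - by move=> x Mx; apply: (derive1_vanish sgx HM); lra.
    - by apply: HM; rewrite normrN ger0_norm ?addr_ge0.
    - by apply: HM; rewrite ger0_norm ?addr_ge0.
  rewrite -(rintZ _ cs).
  have cz : ccs (fun x => - (2^-1 * c ^+ 2) * derive1 g (x - xi t0)).
    by apply: (@ccsMl R (fun _ => _)) => // x; exact: cvg_cst.
  have cs2 : ccs (fun x => 2^-1 * ((v (x, t0) - c) ^+ 2 * derive1 g (x - xi t0))).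
    by apply: (@ccsMl R (fun _ => _)) => // x; exact: cvg_cst.
  rewrite -[RHS]addr0 -(mulr0 (- (2^-1 * c ^+ 2))) -Z -(rintZ _ cdg0) -(rintD cs2 cz).
  apply: eq_Rintegral => x _; rewrite dgk (_ : x - c * t0 - k = x - xi t0); last first.
    by rewrite -xi0; ring.
  by field.
rewrite B0 in DA.
have [K HK] := ccs_bounded cdg.
have K0 : 0 <= K := le_trans (normr_ge0 _) (HK 0).
have T0 := normr_ge0 t0.
have [V V0 HV] := ucb_bounded (`|t0| + 1) uv.
have [N1 HN1] := loc_bsupp_moving bg cxi (`|t0| + 1).
have [N2 HN2] := loc_bsupp_moving bg cc (`|t0| + 1).
pose N := Num.max N1 N2; pose J := cutoff_mass N.
have J0 : 0 <= J by exact: cutoff_mass_ge0.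
apply/is_derive_epsP => e e0.
have e20 : 0 < e / 2 by rewrite divr_gt0.
have p1 : 0 < V * K * J + 1 by rewrite ltr_wpDl// !mulr_ge0.
have e30 : 0 < e / 2 / (V * K * J + 1) by rewrite divr_gt0.
have [d1 d10 H1] := (is_derive_epsP _ _ _).1 DA _ e20.
have [d2 d20 H2] := (is_derive_epsP _ _ _).1 (dxi t0) _ e30.
exists (Num.min (Num.min d1 d2) 1); first by rewrite !lt_min d10 d20/=.
move=> h; rewrite !lt_min => /andP[/andP[hd1 hd2] hd3].
have th : `|t0 + h| <= `|t0| + 1 by rewrite (le_trans (ler_normD _ _))// lerD2l ltW.
have := H1 h hd1; have := H2 h hd2; rewrite -/c.
set D1 := rint (fun x => v (x, t0 + h) * g (x - xi (t0 + h))).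
set D0 := rint (fun x => v (x, t0) * g (x - xi t0)).
set A1 := rint (fun x => v (x, t0 + h) * gk _).
set A0 := rint (fun x => v (x, t0) * gk _).
have -> : A0 = D0 by apply: eq_Rintegral => x _; rewrite gkE xi0.
move=> hxi hA.
have ugx := ucbM uv (ucb_moving sg bg cxi).
have ugc := ucbM uv (ucb_moving sg bg cc).
have c1 := ucb_loc_ccs (t0 + h) ugx (@loc_bsuppMl R _ _ (loc_bsupp_moving bg cxi)).
have c2 := ucb_loc_ccs (t0 + h) ugc (@loc_bsuppMl R _ _ (loc_bsupp_moving bg cc)).
(* Replacing the tangent by [xi] costs their distance, which is [o(h)], times bounds for [v], for
   [derive1 g] and for the length of the support. *)
have DA1 : `|D1 - A1| <= V * (K * (e / 2 / (V * K * J + 1) * `|h|)) * J.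
  have -> : A1 = rint (fun x => v (x, t0 + h) * g (x - (k + c * (t0 + h)))).
    by apply: eq_Rintegral => x _; rewrite gkE.
  rewrite /D1 -(rintB c1 c2); apply: rint_abs_le => [|x|x Nx].
  - exact/ccs_integrable/ccsB.
  - rewrite -mulrBr normrM ler_pM//; first exact: HV.
    apply: le_trans (bounded_derive_lipschitz dg HK _ _) _.
    rewrite ler_wpM2l// (le_trans _ hxi)// -normrN le_eqVlt; apply/orP; left; apply/eqP.
    by congr `|_|; rewrite /k; ring.
  - move: Nx; rewrite gt_max => /andP[Nx1 Nx2].
    by rewrite HN1// HN2// mulr0 subrr.
have : V * (K * (e / 2 / (V * K * J + 1) * `|h|)) * J <= e / 2 * `|h|.
  rewrite (_ : _ * J = e / 2 * `|h| * (V * K * J) / (V * K * J + 1)); last by ring.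
  rewrite ler_pdivrMr// ler_wpM2l ?lerDl// mulr_ge0// ltW//.
exact: arith DA1 hA.
Qed.

End MomentumEquation.

(** * Level curves *)

Section LevelCurves.
Context {R : realType}.
Implicit Types (v : R * R -> R) (ux : R -> R -> R) (nu : R -> finBorel R).
Implicit Types (xi eta : R -> R) (x y z t s e d c N T m : R) (mu : finBorel R).

Lemma density_cdf (p : R -> R) mu : has_density (fun x => p x ^+ 2) mu ->
  (forall x, cdfl mu x = cdf mu x) /\
  (forall x y, x <= y -> segI (fun z => p z ^+ 2) x y = cdf mu y - cdf mu x).
Proof.
move=> Hd.
have E x y : x <= y -> segI (fun z => p z ^+ 2) x y = cdf mu y - cdfl mu x.
  move=> xy; have mxy : measurable (`[x, y] : set (borelR R)) by exact: measurable_itv.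
  have mx : measurable (`]-oo, x[ : set (borelR R)) by exact: measurable_itv.
  rewrite /segI /Rintegral -Hd//.
  have : mu `]-oo, y]%classic = (mu `]-oo, x[%classic + mu `[x, y]%classic)%E.
    rewrite -measureU//; first by rewrite -itv_bndbnd_setU// bnd_simp.
    apply/seteqP; split=> // z [] /=; rewrite !in_itv/= => zx /andP[xz _].
    by move: (lt_le_trans zx xz); rewrite ltxx.
  rewrite cdfE cdflE -(fineK (fin_num_measure mu _ mxy)) -EFinD => -[->].
  by rewrite addrC addKr.
(* The degenerate segment [[x, x]] shows that there are no atoms. *)
have Ex x : cdfl mu x = cdf mu x.
  have := E x x (lexx x); rewrite /segI set_itv1 Rintegral_set1.
  by move=> /esym/eqP; rewrite subr_eq0 => /eqP.
by split=> // x y xy; rewrite E// Ex.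
Qed.

Lemma density_square_increment (u p : R -> R) mu : Cb u -> weak_derivative u p ->
  L2 p -> has_density (fun x => p x ^+ 2) mu ->
  forall x y, x <= y -> (u y - u x) ^+ 2 <= (y - x) * (cdf mu y - cdf mu x).
Proof.
move=> [cu _] wd Lp Hd x y xy; have sp := L2_sqint Lp.
have [_ Pu] := weak_derivative_primitive cu sp wd.
have [_ <-//] := density_cdf Hd.
rewrite Pu//; apply: le_trans (segI_Cauchy_Schwarz xy sp).
rewrite -(real_normK (num_real (segI p x y))) lerXn2r ?nnegrE ?segI_ge0//.
exact/segI_norm/sqint_segment.
Qed.

(** A disagreement would persist on an open interval, which has positive measure. *)
Lemma ae_eq_continuous (f g : R -> R) : continuous f -> continuous g ->
  {ae leb R, forall t, f t = g t} -> forall t, f t = g t.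
Proof.
move=> cf cg [A [mA A0 HA]] t; apply/eqP; rewrite -subr_eq0.
apply: contrapT => /negP fg0.
have cfg : continuous (fun t => f t - g t).
  by move=> x; apply: cvgB; [exact: cf|exact: cg].
have e0 : 0 < `|f t - g t| / 2 by rewrite divr_gt0// normr_gt0.
have [d d0 Hd] := (continuous_epsP _ t).1 (cfg t) _ e0.
pose I : set (borelR R) := `]t - d, t + d[%classic.
have sub : I `<=` A.
  move=> s; rewrite /I/= in_itv/= => /andP[s1 s2]; apply: HA => /= fgs.
  have := Hd s; rewrite fgs subrr sub0r normrN ltr_norml => /(_ _)/wrap[|].
    by apply/andP; split; lra.
  lra.
have : (leb R I <= leb R A)%E.
  by apply: le_measure; rewrite ?inE//; exact: measurable_itv.
have := @lebesgue_measure_itv R `]t - d, t + d[.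
rewrite A0 -/I /= lte_fin => ->.
have -> : t - d < t + d by lra.
by rewrite -EFinB lee_fin; lra.
Qed.

Lemma ae_imply2 (P Q S : R -> Prop) :
  {ae leb R, forall t, P t} -> {ae leb R, forall t, Q t} ->
  (forall t, P t -> Q t -> S t) -> {ae leb R, forall t, S t}.
Proof.
move=> aP aQ PQS; apply: (@filterS2 _ _ (ae_filter_ringOfSetsType (leb R)) P Q) aP aQ.
exact: PQS.
Qed.

Lemma continuous_along v xi : continuous_to_Cb v -> continuous xi ->
  continuous (fun t => v (xi t, t)).
Proof.
move=> cv cxi t0; have [bv uv] := continuous_to_Cb_ucb cv.
apply/continuous_epsP => e e0.
have e20 : 0 < e / 2 by rewrite divr_gt0.
have [d1 d10 H1] := uv t0 _ e20.
have [d2 d20 H2] := (continuous_epsP _ _).1 ((bv t0).1 (xi t0)) _ e20.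
have [d3 d30 H3] := (continuous_epsP _ t0).1 (cxi t0) _ d20.
have d3' : 0 < d2 / 2 by rewrite divr_gt0.
have [d4 d40 H4] := (continuous_epsP _ t0).1 (cxi t0) _ d3'.
exists (Num.min d1 d4); first by rewrite lt_min d10.
move=> t; rewrite lt_min => /andP[td1 td4].
rewrite (_ : _ - _ = (v (xi t, t) - v (xi t, t0)) + (v (xi t, t0) - v (xi t0, t0))); last by ring.
rewrite (le_trans (ler_normD _ _))// [leRHS](splitr e) lerD ?H1// H2//.
by have := H4 t td4; lra.
Qed.

Definition level nu m t x := cdfl (nu t) x <= m /\ m <= cdf (nu t) x.

Definition energy_density ux nu :=
  {ae leb R, forall t, has_density (fun x => ux x t ^+ 2) (nu t)}.

(* For a.e. [t] the energy [v_x ^ 2] has no mass between two points of the same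
   level, so [v] takes the same value there. *)
Lemma same_level_same_velocity v ux nu m xi eta : momentum_balance v ux nu ->
  energy_density ux nu -> continuous xi -> continuous eta ->
  {ae leb R, forall t, level nu m t (xi t) /\ level nu m t (eta t)} ->
  forall t, v (xi t, t) = v (eta t, t).
Proof.
move=> [cv _ Hux _] ed cxi ceta lv; apply: ae_eq_continuous.
- exact: continuous_along.
- exact: continuous_along.
rewrite /energy_density in ed; apply: (ae_imply2 ed lv) => t Hd [lx ly].
have [wd Lux] := Hux t.
have SI := density_square_increment (cv.1 t) wd Lux Hd.
have [Ecl _] := density_cdf Hd.
have cm x : level nu m t x -> cdf (nu t) x = m.
  by move=> [h1 h2]; apply/le_anti; rewrite h2 -Ecl h1.
have [xy|yx] := leP (xi t) (eta t).
- have := SI _ _ xy; rewrite !cm// subrr mulr0 => h.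
  have : (v (eta t, t) - v (xi t, t)) ^+ 2 == 0 by rewrite eq_le h sqr_ge0.
  by rewrite sqrf_eq0 subr_eq0 => /eqP.
- have := SI _ _ (ltW yx); rewrite !cm// subrr mulr0 => h.
  have : (v (xi t, t) - v (eta t, t)) ^+ 2 == 0 by rewrite eq_le h sqr_ge0.
  by rewrite sqrf_eq0 subr_eq0 => /eqP.
Qed.

Lemma is_derive_constant_diff xi eta (w : R -> R) :
  (forall t, is_derive t 1 xi (w t)) -> (forall t, is_derive t 1 eta (w t)) ->
  forall t, xi t - eta t = xi 0 - eta 0.
Proof.
move=> dx de t.
have d s : is_derive s 1 (fun s => xi s - eta s) 0.
  by apply: is_derive_eq (is_deriveB (dx s) (de s)) _; rewrite subrr.
exact: is_derive_0_is_cst d.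
Qed.

(** The curve is the left end of the level, an infimum: [0 < m] bounds the set from below, and
    finite speed carries its nonemptiness from time [0] to all times. *)
Lemma lower_level_curve v nu m : transported v nu -> 0 < m ->
  (exists x, m <= cdf (nu 0) x) ->
  exists xi, [/\ forall t, is_derive t 1 xi (v (xi t, t)),
    forall t, level nu m t (xi t) & forall x, m <= cdf (nu 0) x -> xi 0 <= x].
Proof.
move=> tv m0 [x0 Hx0]; have [cv _ _] := tv.
pose U t := [set x | m <= cdf (nu t) x].
pose a t := inf (U t).
have hU t : has_inf (U t).
  split.
    have [c /(_ x0)[h _]] := finite_speed 0 t tv.
    by exists (x0 + c); rewrite /U/=; exact: le_trans h.
  have m20 : 0 < m / 2 by rewrite divr_gt0.
  have [y Hy] := cdf_Ny (nu t) m20; exists y => x; rewrite /U/= => Ux.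
  rewrite leNgt; apply/negP => xy; have := cdf_homo (nu t) (ltW xy).
  lra.
have Ua t x : a t <= x -> m <= cdf (nu t) x.
  move=> ax; apply/ler_addgt0Pr => e e0.
  have [d d0 Hd] := cdf_right (nu t) x e0.
  have [u Uu ua] := inf_adherent d0 (hU t).
  apply: le_trans Hd; apply: (le_trans Uu); apply: cdf_homo.
  by rewrite -/(a t) in ua; lra.
have aU t x : m <= cdf (nu t) x -> a t <= x by move=> h; apply: ge_inf => //; exact: (hU t).2.
exists a; split=> [|t|x]; last exact: aU.
- apply: barrier_curve_is_derive => // c z s t d d0 st asz.
  (* A barrier that starts to the right of [a s] has mass at least [m] behind it and keeps it, so
     [a t] cannot lie beyond it. *)
  have [h _] := barrier tv d0 st.
  by apply: aU; apply: le_trans h; apply: Ua; exact: ltW.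
- split; last exact: Ua.
  apply/ler_addgt0Pr => e e0; have [d d0 Hd] := cdf_left (nu t) (a t) e0.
  apply: (le_trans Hd); rewrite lerD2r leNgt; apply/negP => /ltW/aU; lra.
Qed.

(** The right end of the level, a supremum: [m < mass (nu 0)] bounds the set from above at every
    time because the total mass is preserved. *)
Lemma upper_level_curve v nu m : transported v nu -> m < mass (nu 0) ->
  (exists x, cdfl (nu 0) x <= m) ->
  exists xi, [/\ forall t, is_derive t 1 xi (v (xi t, t)),
    forall t, level nu m t (xi t) & forall x, cdfl (nu 0) x <= m -> x <= xi 0].
Proof.
move=> tv mM [x0 Hx0]; have [cv _ _] := tv.
pose W t := [set x | cdfl (nu t) x <= m].
pose b t := sup (W t).
have hW t : has_sup (W t).
  split.
    have [c /(_ (x0 - c))[_ h]] := finite_speed t 0 tv.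
    by exists (x0 - c); rewrite /W/= (le_trans h)// subrK.
  have e0 : 0 < (mass (nu t) - m) / 2.
    by rewrite divr_gt0// subr_gt0 (mass_preserved t 0 tv).
  have [y Hy] := cdf_y (nu t) e0; exists y => x; rewrite /W/= => Wx.
  rewrite leNgt; apply/negP => yx; have := cdf_le_cdfl (nu t) yx.
  lra.
have Wb t x : x <= b t -> cdfl (nu t) x <= m.
  move=> xb; apply/ler_addgt0Pr => e e0.
  have [d d0 Hd] := cdf_left (nu t) x e0.
  have [u Wu bu] := sup_adherent d0 (hW t).
  apply: (le_trans Hd); rewrite lerD2r; apply: le_trans Wu.
  by apply: cdf_le_cdfl; rewrite -/(b t) in bu; lra.
have bW t x : cdfl (nu t) x <= m -> x <= b t.
  by move=> h; apply: ub_le_sup => //; exact: (hW t).2.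
exists b; split=> [|t|x]; last exact: bW.
- apply: barrier_curve_is_derive => // c z s t d d0 st bsz.
  (* If the barrier ended to the left of [b t], the open half-line before it would have mass at most
     [m] at time [t], hence at time [s], and the barrier would have started at or before [b s]. *)
  have [_ h] := barrier tv d0 st.
  rewrite leNgt; apply/negP => /ltW/Wb h2.
  by have := bW s _ (le_trans h h2); rewrite leNgt bsz.
- split; first exact: Wb.
  apply/ler_addgt0Pr => e e0; have [d d0 Hd] := cdf_right (nu t) (b t) e0.
  apply: le_trans Hd; rewrite leNgt; apply/negP => h.
  have := bW t (b t + d) (le_trans (cdfl_le_cdf _ _) (ltW h)); lra.
Qed.

Lemma rint_plateau_bounds (a r b s : R) : 0 < r -> 0 < s -> a + r <= b ->
  b - (a + r) <= rint (plateau a r b s) <= b + s - a.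
Proof.
move=> r0 s0 arb.
have E : rint (plateau a r b s) = segI (plateau a r b s) a (b + s).
  apply: rint_restrict => x h; apply: plateau_out => //.
  by case: h => h; [left|right]; exact: ltW.
have tp := plateau_test r0 s0 arb.
have cp : ccs (plateau a r b s).
  by split; [exact: smooth_cont tp.1|exact: test_bsupp].
have ip x y := integrable_segment x y (ccs_integrable cp).
apply/andP; split; rewrite E.
- rewrite (@segI_split R _ _ (a + r)) ?lerDl ?(ltW r0)//; last by lra.
  rewrite (@segI_split R _ (a + r) b)//; last by rewrite lerDl (ltW s0).
  have h1 : 0 <= segI (plateau a r b s) a (a + r).
    by apply: segI_ge0 => x; exact: plateau_ge0.
  have h2 : 0 <= segI (plateau a r b s) b (b + s).
    by apply: segI_ge0 => x; exact: plateau_ge0.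
  have -> : segI (plateau a r b s) (a + r) b = b - (a + r).
    rewrite -[RHS]mul1r -segI_cst//; apply: eq_Rintegral => x.
    by rewrite inE/= in_itv/= => /andP[h3 h4]; rewrite plateau_in.
  lra.
- rewrite -[leRHS]mul1r -segI_cst; last by lra.
  apply: le_segI => [||x _]; [exact: ip|exact: integrable_segment_cst|].
  exact: plateau_le1.
Qed.

(* When [nu] vanishes the levels carry no information; [v] is then constant in
   [x], and integrating the momentum equation shows it is constant in [t]. *)
Lemma zero_mass_velocity v ux nu : transported v nu -> momentum_balance v ux nu ->
  energy_density ux nu -> mass (nu 0) = 0 -> forall x t, v (x, t) = v (0, 0).
Proof.
move=> tv mb ed M0.
have lv t x : level nu 0 t x.
  have := cdf_le_mass (nu t) x; rewrite (mass_preserved t 0 tv) M0 => h.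
  by split; [exact: le_trans (cdfl_le_cdf _ _) h|exact: cdf_ge0].
have vx x t : v (x, t) = v (0, t).
  have := @same_level_same_velocity v ux nu 0 (fun _ => x) (fun _ => 0) mb ed.
  move=> /(_ (fun _ => cvg_cst _) (fun _ => cvg_cst _)); apply.
  by apply: aeW => s; split.
pose g : R -> R := plateau (-1) 1 1 1.
have arb : -1 + 1 <= 1 :> R by lra.
have tg := plateau_test ltr01 ltr01 arb : test_function g.
have g0 x : 0 <= g x by exact: plateau_ge0.
have /andP[G1 _] : 1 - (-1 + 1) <= rint g <= 1 + 1 - -1 by exact: rint_plateau_bounds.
clearbody g; have bg := test_bsupp tg; have [sdg cg cdg] := ccs_derive1 tg.1 bg.
have dA := @momentum_is_derive R v ux nu g 0 mb tg.1 bg g0.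
have E t : rint (fun x => v (x, t) * g (x - 0 * t)) = v (0, t) * rint g.
  rewrite -(rintZ _ cg); apply: eq_Rintegral => x _.
  by rewrite mul0r subr0 vx.
have d0 t : is_derive t 1 (fun t => rint (fun x => v (x, t) * g (x - 0 * t))) 0.
  apply: is_derive_eq (dA t) _.
  have -> : rint (fun x => (2^-1 * v (x, t) ^+ 2 - 0 * v (x, t)) *
      derive1 g (x - 0 * t)) = 2^-1 * v (0, t) ^+ 2 * rint (derive1 g).
    rewrite -(rintZ _ cdg); apply: eq_Rintegral => x _.
    by rewrite !mul0r !subr0 vx.
  have -> : rint (derive1 g) = 0.
    have [dg cdg'] := smooth_derive tg.1; have [N HN] := bg.
    have N1 : N < `|N| + 1 by have := ler_norm N; lra.
    rewrite -[RHS]subr0; apply: (@rint_FTC R g _ 0 0 (`|N| + 1)) => //.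
    - by move=> x Nx; apply: (derive1_vanish tg.1 HN); lra.
    - by apply: HN; rewrite normrN ger0_norm ?addr_ge0.
    - by apply: HN; rewrite ger0_norm ?addr_ge0.
  have -> : rint (fun x => cdf (nu t) x * g (x - 0 * t)) = rint (fun _ : R => 0).
    apply: eq_Rintegral => x _.
    have -> : cdf (nu t) x = 0.
      apply/le_anti; rewrite cdf_ge0 andbT.
      by have := cdf_le_mass (nu t) x; rewrite (mass_preserved t 0 tv) M0.
    by rewrite mul0r.
  by rewrite Rintegral_cst// mul0r !mulr0 addr0.
move=> x t; rewrite vx.
have : v (0, t) * rint g = v (0, 0) * rint g.
  by rewrite -!E; exact: is_derive_0_is_cst d0.
by apply: mulIf; rewrite gt_eqF//; lra.
Qed.

Lemma is_derive_add_cst xi (w k t : R) : is_derive t 1 xi w ->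
  is_derive t 1 (fun s => xi s + k) w.
Proof.
by move=> dx; apply: is_derive_eq (is_deriveD dx (is_derive_cst k t 1)) _; rewrite addr0.
Qed.

(** The two extreme curves of a level have equal velocities, so they stay parallel, and a translate
    of one that starts between them remains in the level. If [m <= 0] only the right one is used, if
    [m] reaches the total mass only the left one; the other half of the level condition is then
    automatic. *)
Lemma level_curve v ux nu m x0 : transported v nu -> momentum_balance v ux nu ->
  energy_density ux nu -> level nu m 0 x0 ->
  exists xi, [/\ forall t, is_derive t 1 xi (v (xi t, t)),
    forall t, level nu m t (xi t) & xi 0 = x0].
Proof.
move=> tv mb ed [Hl Hu].
have shift a : (forall t, is_derive t 1 a (v (a t, t))) ->
    (forall t, level nu m t (a t)) ->
    (forall t, level nu m t (a t + (x0 - a 0))) ->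
    exists xi, [/\ forall t, is_derive t 1 xi (v (xi t, t)),
      forall t, level nu m t (xi t) & xi 0 = x0].
  move=> da la lxi; have ca : continuous a.
    by move=> t; exact: is_derive_continuous (da t).
  exists (fun t => a t + (x0 - a 0)); split=> // [t|]; last by rewrite addrC subrK.
  have -> : v (a t + (x0 - a 0), t) = v (a t, t).
    apply: (@same_level_same_velocity v ux nu m (fun t => a t + (x0 - a 0)) a mb ed).
    - by move=> s; apply: cvgD; [exact: ca|exact: cvg_cst].
    - exact: ca.
    - by apply: aeW => s.
  exact: is_derive_add_cst.
have [m0|m0] := ltP 0 m; have [mM|Mm] := ltP m (mass (nu 0)).
- have [a [da la a0]] := lower_level_curve tv m0 (ex_intro _ x0 Hu).
  have [b [db lb b0]] := upper_level_curve tv mM (ex_intro _ x0 Hl).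
  have ca : continuous a by move=> t; exact: is_derive_continuous (da t).
  have cb : continuous b by move=> t; exact: is_derive_continuous (db t).
  have vab t : v (b t, t) = v (a t, t).
    apply: (same_level_same_velocity mb ed cb ca); exact: aeW.
  have dba t : is_derive t 1 b (v (a t, t)) by rewrite -vab; exact: db.
  have Eba := is_derive_constant_diff dba da.
  apply: (shift a) => // t; split.
    have [h _] := lb t; apply: le_trans h; apply: cdfl_homo.
    by have := Eba t; have := b0 _ Hl; lra.
  have [_ h] := la t; apply: (le_trans h); apply: cdf_homo.
  by have := a0 _ Hu; lra.
- have [a [da la a0]] := lower_level_curve tv m0 (ex_intro _ x0 Hu).
  apply: (shift a) => // t; split.
    apply: le_trans (cdfl_le_cdf _ _) (le_trans (cdf_le_mass _ _) _).
    by rewrite (mass_preserved t 0 tv).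
  have [_ h] := la t; apply: (le_trans h); apply: cdf_homo.
  by have := a0 _ Hu; lra.
- have [b [db lb b0]] := upper_level_curve tv mM (ex_intro _ x0 Hl).
  apply: (shift b) => // t; split.
    have [h _] := lb t; apply: le_trans h; apply: cdfl_homo.
    by have := b0 _ Hl; lra.
  exact: le_trans m0 (cdf_ge0 _ _).
- have M0 : mass (nu 0) = 0.
    by apply/le_anti; rewrite (le_trans Mm m0)/=; exact: fine_ge0.
  have vc := zero_mass_velocity tv mb ed M0.
  exists (fun t => v (0, 0) * t + x0); split=> [t|t|]; last by rewrite mulr0 add0r.
    rewrite vc; apply: is_derive_add_cst.
    apply: is_derive_eq (is_deriveM (is_derive_cst (v (0, 0)) t 1) (is_derive_id t 1)) _.
    by rewrite scaler0 addr0 /GRing.scale/= mulr1.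
  split; last exact: le_trans m0 (cdf_ge0 _ _).
  apply: le_trans (cdfl_le_cdf _ _) (le_trans (cdf_le_mass _ _) _).
  by rewrite (mass_preserved t 0 tv).
Qed.

End LevelCurves.

(** * Velocity along a level curve *)

Section VelocityAlongCharacteristics.
Context {R : realType}.
Implicit Types (v : R * R -> R) (ux : R -> R -> R) (nu : R -> finBorel R).
Implicit Types (xi f g : R -> R) (x y z t s r e d c N T m k : R) (mu : finBorel R).

Lemma rint_local_le f (z r k : R) : 0 <= r -> 0 <= k ->
  (leb R).-integrable setT (EFin \o f) ->
  (forall x, `|x - z| <= r -> `|f x| <= k) ->
  (forall x, r < `|x - z| -> f x = 0) -> `|rint f| <= k * (2 * r).
Proof.
move=> r0 k0 If fk f0.
have -> : rint f = segI f (z - r) (z + r).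
  apply: rint_restrict => x h; apply: f0; rewrite ltr_normr.
  by case: h => h; apply/orP; [right|left]; lra.
have Is := integrable_segment (z - r) (z + r) If.
apply: (le_trans (segI_norm Is)).
rewrite (_ : 2 * r = z + r - (z - r)); last by ring.
rewrite -segI_cst; last by lra.
apply: le_segI => [||x /andP[h1 h2]].
- exact: integrable_normR.
- exact: integrable_segment_cst.
- by apply: fk; rewrite ler_norml; lra.
Qed.

(** Equal to [1] on [[-e, e]] and to [0] beyond distance [2 e], so that its slope is of order
    [1 / e] and its mass of order [e]. *)
Definition bump e : R -> R := plateau (- (2 * e)) e e e.

Section Bump.
Variable e : R.
Hypothesis e0 : 0 < e.

Let arb : - (2 * e) + e <= e. Proof. by have := e0; lra. Qed.

Lemma bump_test : test_function (bump e).
Proof. exact: plateau_test. Qed.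

Lemma bump_ge0 x : 0 <= bump e x.
Proof. exact: plateau_ge0. Qed.

Lemma bump_le1 x : bump e x <= 1.
Proof. exact: plateau_le1. Qed.

Lemma bump_out x : 2 * e < `|x| -> bump e x = 0.
Proof.
rewrite ltr_normr => /orP h; apply: plateau_out => //.
by have := e0; case: h => h; [right|left]; lra.
Qed.

Lemma bump_mass : 2 * e <= rint (bump e) <= 4 * e.
Proof.
have := rint_plateau_bounds e0 e0 arb; rewrite -/(bump e) => /andP[h1 h2].
by apply/andP; split; lra.
Qed.

Lemma bump_derive1_le (C : R) : (forall x, dstep x <= C) ->
  forall x, `|derive1 (bump e) x| <= C / e.
Proof.
move=> HC x; rewrite plateau_derive1.
have b (a y : R) : 0 <= derive1 (step a e) y <= C / e.
  by rewrite step_derive1_ge0//= step_derive1 ler_wpM2r// invr_ge0 ltW.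
have /andP[h1 h2] := b (- (2 * e)) x; have /andP[h3 h4] := b e x.
move: h1 h2 h3 h4; move: (derive1 _ _) (derive1 _ _) => p q; clear => h1 h2 h3 h4.
by rewrite ler_norml; apply/andP; split; lra.
Qed.

End Bump.

(** Both sides are the increment of one primitive [H] between points beyond the support. *)
Lemma rint_shift g (a : R) : ccs g -> rint (fun x => g (x - a)) = rint g.
Proof.
move=> cg; have [cgc [N HN]] := cg.
pose H y := \int[leb R]_(x in `]-oo, y]) g x.
have dH y : is_derive y 1 H (g y).
  have yy1 : y < y + 1 by rewrite ltrDl.
  have [| | |d1 d2] := @continuous_FTC1 R g -oo%O y (y + 1) yy1.
  - by apply: integrableS (ccs_integrable cg) => //; exact: measurable_itv.
  - by rewrite ltNyr.
  - exact: cgc.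
  - by split; [exact: d1|rewrite -derive1E; exact: d2].
have dHa y : is_derive y 1 (fun x => H (x - a)) (g (y - a)).
  have d1 : is_derive y 1 (fun x => x - a) 1.
    by apply: is_derive_eq (is_deriveB (is_derive_id y 1) (is_derive_cst a y 1)) _; rewrite subr0.
  by have := @is_derive1_comp R H (fun x => x - a) y _ _ (dH (y - a)) d1; rewrite mulr1.
have Na := normr_ge0 a; have NN := normr_ge0 N; have aa := ler_norm a.
have Naa := ler_norm (- a); rewrite normrN in Naa; have lN := ler_norm N.
pose K := `|N| + `|a| + 1.
have K0 : - K <= K by rewrite /K; lra.
rewrite (@rint_restrict R _ (- K) K); last first.
  move=> x h; apply: HN; rewrite ltr_normr; move: h; rewrite /K => -[h|h];
    apply/orP; [right|left]; lra.
rewrite (@rint_restrict R _ (- K - a) (K - a)); last first.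
  move=> x h; apply: HN; rewrite ltr_normr; move: h; rewrite /K => -[h|h];
    apply/orP; [right|left]; lra.
rewrite (@rint_FTC_segment R (fun x => H (x - a)))//; last first.
  move=> x; apply: continuous_comp; last exact: cgc.
  by apply: cvgB; [exact: cvg_id|exact: cvg_cst].
by rewrite (@rint_FTC_segment R H)// lerD2r.
Qed.

Lemma bump_ccs e : 0 < e -> ccs (bump e).
Proof.
move=> e0; have bt := bump_test e0.
by split; [exact: smooth_cont bt.1|exact: test_bsupp].
Qed.

Lemma bump_shift_ccs e z : 0 < e -> ccs (fun x => bump e (x - z)).
Proof.
move=> e0; have bt := bump_test e0; split; last first.
  exact/bsupp_shift/test_bsupp.
by have [/smooth_cont] := smooth_shift z bt.1.
Qed.

(** The factor [2] compares the length [4 * e] of the support with the mass of the bump, which is at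
    least [2 * e]. *)
Lemma bump_average_close (u : R -> R) e z k : continuous u -> 0 < e ->
  (forall x, `|x - z| <= 2 * e -> `|u x - u z| <= k) ->
  `|(rint (bump e))^-1 * rint (fun x => u x * bump e (x - z)) - u z| <= 2 * k.
Proof.
move=> cu e0 uk; have /andP[kl _] := bump_mass e0.
have kap0 : 0 < rint (bump e) by lra.
have cb := bump_shift_ccs z e0.
have k0 : 0 <= k.
  by have := uk z; rewrite !subrr normr0; apply; lra.
have c1 : ccs (fun x => u x * bump e (x - z)) by exact: ccsMl.
have B : `|rint (fun x => u x * bump e (x - z)) - u z * rint (bump e)| <=
    k * (2 * (2 * e)).
  rewrite -(rint_shift z (bump_ccs e0)) -(rintZ _ cb).
  have c2 : ccs (fun x => u z * bump e (x - z)).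
    by apply: (@ccsMl R (fun _ => u z)) => // x; exact: cvg_cst.
  rewrite -(rintB c1 c2); apply: (@rint_local_le _ z) => //.
  - lra.
  - exact/ccs_integrable/ccsB.
  - move=> x hx; rewrite -mulrBl normrM -[leRHS]mulr1 ler_pM ?uk//.
    by rewrite ger0_norm ?bump_ge0 ?bump_le1.
  - by move=> x hx; rewrite bump_out// !mulr0 subrr.
rewrite (_ : _ - u z = (rint (bump e))^-1 *
  (rint (fun x => u x * bump e (x - z)) - u z * rint (bump e))); last first.
  by field; rewrite gt_eqF.
rewrite normrM gtr0_norm ?invr_gt0// ler_pdivrMl//; apply: (le_trans B).
by move: kl k0 e0; clear; nra.
Qed.

(** On the support, of length [4 * e], the square [(u - u z) ^ 2] is at most [2 e] times the mass
    increment [Del], which compensates the slope [C / e]. After division by the mass of the bump, at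
    least [2 * e], both terms are bounded by multiples of [Del]. *)
Lemma bump_average_estimate (u p : R -> R) mu e z m (C : R) : Cb u ->
  weak_derivative u p -> L2 p -> has_density (fun x => p x ^+ 2) mu ->
  cdf mu z = m -> 0 < e -> (forall x, dstep x <= C) ->
  `|(rint (bump e))^-1 *
      (2^-1 * rint (fun x => (u x - u z) ^+ 2 * derive1 (bump e) (x - z)) +
       2^-1 * rint (fun x => cdf mu x * bump e (x - z))) - m / 2| <=
  (4 * C + 1) * (cdf mu (z + 2 * e) - cdf mu (z - 2 * e)).
Proof.
have arith (a b c d f g : R) : b <= 8 * d -> c <= 4 * f -> a <= b + c ->
  8 * d + 2 * f <= g -> 0 <= d -> 2^-1 * a <= g by lra.
move=> bu wd Lp Hd cm e0 HC.
have SI := density_square_increment bu wd Lp Hd.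
have C0 : 0 <= C := le_trans (dstep_ge0 0) (HC 0).
set Del := cdf mu (z + 2 * e) - cdf mu (z - 2 * e).
have Del0 : 0 <= Del by rewrite subr_ge0; apply: cdf_homo; lra.
have near_cdf x : `|x - z| <= 2 * e -> `|cdf mu x - m| <= Del.
  rewrite ler_norml => /andP[h1 h2]; rewrite -cm.
  have h3 : cdf mu x <= cdf mu (z + 2 * e) by apply: cdf_homo; lra.
  have h4 : cdf mu (z - 2 * e) <= cdf mu x by apply: cdf_homo; lra.
  have h5 : cdf mu z <= cdf mu (z + 2 * e) by apply: cdf_homo; lra.
  have h6 : cdf mu (z - 2 * e) <= cdf mu z by apply: cdf_homo; lra.
  by rewrite ler_norml /Del; apply/andP; split; lra.
have near_u x : `|x - z| <= 2 * e -> (u x - u z) ^+ 2 <= 2 * e * Del.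
  move=> hx; have := near_cdf x hx; rewrite -cm ler_norml => /andP[k1 k2].
  move: hx; rewrite ler_norml => /andP[h1 h2].
  have [xz|zx] := leP x z.
    rewrite -(opprB (u z)) sqrrN; apply: (le_trans (SI _ _ xz)).
    by have h3 := cdf_homo mu xz; apply: ler_pM; lra.
  apply: (le_trans (SI _ _ (ltW zx))).
  by have h3 := cdf_homo mu (ltW zx); apply: ler_pM; lra.
have bt := bump_test e0; have bb := test_bsupp bt.
have [sdb _ cdb] := ccs_derive1 bt.1 bb; have [_ bdb] := cdb.
have cb := bump_shift_ccs z e0.
have cdbz : ccs (fun x => derive1 (bump e) (x - z)).
  split; last exact: bsupp_shift.
  by have [/smooth_cont] := smooth_shift z sdb.
have [cu _] := bu.
have cE1 : ccs (fun x => (u x - u z) ^+ 2 * derive1 (bump e) (x - z)).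
  apply: ccsMl => //; under eq_fun do rewrite expr2.
  by move=> x; apply: cvgM; (apply: cvgB; [exact: cu|exact: cvg_cst]).
set E1 := rint (fun x => (u x - u z) ^+ 2 * _).
set E2 := rint (fun x => cdf mu x * _).
set kap := rint (bump e).
have /andP[kl _] := bump_mass e0; rewrite -/kap in kl.
have kap0 : 0 < kap by lra.
have B1 : `|E1| <= 2 * e * Del * (C / e) * (2 * (2 * e)).
  apply: (@rint_local_le _ z).
  - lra.
  - by rewrite !mulr_ge0 ?invr_ge0 ?(ltW e0).
  - exact: ccs_integrable.
  - move=> x hx; rewrite normrM (ger0_norm (sqr_ge0 _)) ler_pM ?sqr_ge0 ?near_u//.
    exact: bump_derive1_le.
  - move=> x hx; rewrite (@derive1_vanish R (bump e) (2 * e)) ?mulr0//.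
    + exact: bt.1.
    + by move=> y; exact: bump_out.
have B2 : `|E2 - m * kap| <= Del * (2 * (2 * e)).
  have i1 := cdf_ccs_integrable mu cb.
  have i2 := integrableRZ m measurableT (ccs_integrable cb).
  rewrite /kap -(rint_shift z (bump_ccs e0)).
  rewrite -(RintegralZl m measurableT (ccs_integrable cb)).
  rewrite -(RintegralB measurableT i1 i2).
  apply: (@rint_local_le _ z) => //.
  - lra.
  - exact: integrableRB.
  - move=> x hx; rewrite -mulrBl normrM -[leRHS]mulr1 ler_pM ?near_cdf//.
    by rewrite ger0_norm ?bump_ge0 ?bump_le1.
  - by move=> x hx; rewrite bump_out// !mulr0 subrr.
have -> : kap^-1 * (2^-1 * E1 + 2^-1 * E2) - m / 2 =
    kap^-1 * (2^-1 * (E1 + (E2 - m * kap))).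
  by field; rewrite gt_eqF.
rewrite normrM gtr0_norm ?invr_gt0// ler_pdivrMl// normrM gtr0_norm ?invr_gt0//.
have B3 := ler_normD E1 (E2 - m * kap).
have E3 : 2 * e * Del * (C / e) * (2 * (2 * e)) = 8 * (C * e * Del).
  by field; rewrite gt_eqF.
rewrite E3 in B1.
have B4 : (4 * C + 1) * Del * (2 * e) <= (4 * C + 1) * Del * kap.
  by rewrite ler_wpM2l// mulr_ge0// addr_ge0// mulr_ge0.
have B5 : (4 * C + 1) * Del * (2 * e) = 8 * (C * e * Del) + 2 * (e * Del) by ring.
have B6 : 0 <= e * Del by rewrite mulr_ge0// ltW.
rewrite B5 [leRHS]mulrC in B4.
rewrite mulrC in B4 *.
have B7 : Del * (2 * (2 * e)) = 4 * (e * Del) by ring.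
rewrite B7 in B2.
have B8 : 0 <= C * e * Del by rewrite !mulr_ge0// ltW.
exact: arith B1 B2 B3 B4 B8.
Qed.

Lemma velocity_along_level_curve v ux nu m xi : momentum_balance v ux nu ->
  energy_density ux nu -> transported v nu ->
  (forall t, is_derive t 1 xi (v (xi t, t))) ->
  (forall t, level nu m t (xi t)) ->
  forall s t, s < t -> v (xi t, t) - v (xi s, s) = m / 2 * (t - s).
Proof.
have arith (a b c d f k : R) : a <= b -> b <= c + k / 2 -> c <= d + k / 2 ->
  d <= f -> a - f <= k by lra.
move=> mb ed tv dxi lxi s t st; have [cv wnu Hux _] := mb.
have uv := continuous_to_Cb_ucb cv.
have cxi : continuous xi by move=> r; exact: is_derive_continuous (dxi r).
have cw := continuous_along cv cxi.
have [C HC] := @dstep_bounded R.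
have C0 : 0 <= C := le_trans (dstep_ge0 0) (HC 0).
have C10 : 0 < 4 * C + 1 by rewrite ltr_wpDl// mulr_ge0.
pose M := mass (nu 0).
have M0 : 0 <= M by exact: fine_ge0.
pose eps n : R := n.+1%:R^-1.
have eps0 n : 0 < eps n by rewrite invr_gt0.
pose B n := bump (eps n).
have B0 n x : 0 <= B n x by exact: bump_ge0.
have bt n : test_function (B n) by exact: bump_test.
have bb n : bsupp (B n) := test_bsupp (bt n).
pose kap n := rint (B n).
pose D n r := (kap n)^-1 * rint (fun x => v (x, r) * B n (x - xi r)).
pose E1 n r := rint (fun x => (v (x, r) - v (xi r, r)) ^+ 2 * derive1 (B n) (x - xi r)).
pose E2 n r := rint (fun x => cdf (nu r) x * B n (x - xi r)).
(* The gap between the derivative of the averaged velocity [D n] and its expected limit [m / 2]. *)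
pose q n r := (kap n)^-1 * (2^-1 * E1 n r + 2^-1 * E2 n r) - m / 2.
have ub n := ucb_moving (bt n).1 (bb n) cxi.
have lb n := loc_bsupp_moving (bb n) cxi.
have sdb n : smooth (derive1 (B n)) by have [] := ccs_derive1 (bt n).1 (bb n).
have bdb n : bsupp (derive1 (B n)) by have [_ _ []] := ccs_derive1 (bt n).1 (bb n).
have udb n := ucb_moving (sdb n) (bdb n) cxi.
have ldb n := loc_bsupp_moving (bdb n) cxi.
have uw : ucb (fun r _ => v (xi r, r)).
  split=> [r|r e' e'0]; first exact: Cb_cst.
  have [d d0 Hd] := (continuous_epsP _ r).1 (cw r) _ e'0.
  by exists d => // r' /Hd.
have usq : ucb (fun r x => (v (x, r) - v (xi r, r)) ^+ 2).
  have h : ucb (fun r x => v (x, r) + -1 * v (xi r, r)).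
    by apply: ucbD => //; apply: ucbM => //; exact: ucb_cst (Cb_cst _).
  rewrite (_ : (fun r x => _) = fun r x => (v (x, r) + -1 * v (xi r, r)) *
    (v (x, r) + -1 * v (xi r, r))); first exact: ucbM.
  by apply/funext => r; apply/funext => x; ring.
have uE1 n := ucbM usq (udb n).
have lE1 n : loc_bsupp (fun r x => (v (x, r) - v (xi r, r)) ^+ 2 *
  derive1 (B n) (x - xi r)) by exact: loc_bsuppMl.
have cE1 n : continuous (E1 n) by exact: continuous_rint.
have cE2 n : continuous (E2 n) by exact: continuous_rint_cdf.
have cq n : continuous (q n).
  move=> r; apply: cvgB; last exact: cvg_cst.
  apply: cvgM; first exact: cvg_cst.
  by apply: cvgD; (apply: cvgM; [exact: cvg_cst|]); [exact: cE1|exact: cE2].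
have dD n (r : R) : is_derive r 1 (fun r => D n r - m / 2 * r) (q n r).
  have h := momentum_along_characteristic mb (bt n).1 (bb n) (B0 n) dxi r.
  have h2 := is_deriveM (is_derive_cst (kap n)^-1 r 1) h.
  have h3 := is_deriveM (is_derive_cst (m / 2) r 1) (is_derive_id r 1).
  apply: is_derive_eq (is_deriveB h2 h3) _.
  by rewrite !scaler0 !addr0 /GRing.scale/= mulr1.
have FTC n : segI (q n) s t = D n t - D n s - m / 2 * (t - s).
  rewrite /segI (rint_FTC_segment (ltW st) (cq n) (dD n)).
  by move: (D n t) (D n s); clear => a b; ring.
(* At almost every time [nu r] has no atoms, so [Del n r] tends to [0]; its bound by the total mass
   gives the dominating constant. *)
pose Del n r := cdf (nu r) (xi r + 2 * eps n) - cdf (nu r) (xi r - 2 * eps n).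
have DelM n r : Del n r <= M.
  rewrite lerBlDr (le_trans (cdf_le_mass _ _))// (mass_preserved r 0 tv).
  by rewrite lerDl cdf_ge0.
pose good r := has_density (fun x => ux x r ^+ 2) (nu r).
have qDel n r : good r -> `|q n r| <= (4 * C + 1) * Del n r.
  move=> Hd; have [wd Lux] := Hux r; have [Ecl _] := density_cdf Hd.
  have cm : cdf (nu r) (xi r) = m.
    by have [h1 h2] := lxi r; apply/le_anti; rewrite h2 -Ecl h1.
  exact: bump_average_estimate (cv.1 r) wd Lux Hd cm (eps0 n) HC.
have Del_cvg r : good r -> forall k, 0 < k ->
    exists n0, forall n, (n0 <= n)%N -> Del n r <= k.
  move=> Hd k k0; have [Ecl _] := density_cdf Hd.
  have k20 : 0 < k / 2 by rewrite divr_gt0.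
  have [d1 d10 H1] := cdf_right (nu r) (xi r) k20.
  have [d2 d20 H2] := cdf_left (nu r) (xi r) k20.
  have d0 : 0 < Num.min d1 d2 / 2 by rewrite divr_gt0// lt_min d10.
  have [n0 _ Hn0] := near_infty_natSinv_lt (PosNum d0).
  exists n0 => n /Hn0/=; rewrite -/(eps n) ltr_pdivlMr// lt_min => /andP[en1 en2].
  have h1 : cdf (nu r) (xi r + 2 * eps n) <= cdf (nu r) (xi r + d1).
    by apply: cdf_homo; rewrite lerD2l mulrC ltW.
  have h2 : cdf (nu r) (xi r - d2) <= cdf (nu r) (xi r - 2 * eps n).
    by apply: cdf_homo; rewrite lerD2l lerN2 mulrC ltW.
  by rewrite Ecl in H2; exact: arith h1 H1 H2 h2.
have mst : measurable (`[s, t] : set (borelR R)) by exact: measurable_itv.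
have Iq_cvg : (fun n => segI (q n) s t) @ \oo --> (0 : R).
  have [] := @dominated_convergence _ _ R (leb R) (`[s, t]%classic : set (borelR R)) mst
    (fun n r => (q n r)%:E) (fun _ => 0%E) (fun _ => ((4 * C + 1) * M)%:E).
  - by move=> n; apply/measurable_EFinP; apply: measurable_funTS; exact: continuous_measurable_fun.
  - exact: measurable_cst.
  - apply: (ae_imply2 ed ed) => r Hd _ _.
    apply/fine_cvgP; split; first by apply: nearW.
    apply/cvgrPdist_le => k k0.
    have k10 : 0 < k / (4 * C + 1) by rewrite divr_gt0.
    have [n0 Hn0] := Del_cvg r Hd _ k10.
    exists n0 => // n /= /Hn0 h; rewrite sub0r normrN.
    by apply: (le_trans (qDel n r Hd)); rewrite mulrC -ler_pdivlMr.
  - exact: integrable_segment_cst.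
  - apply: (ae_imply2 ed ed) => r Hd _ n _; rewrite lee_fin.
    by apply: (le_trans (qDel n r Hd)); rewrite ler_wpM2l// ltW.
  by move=> _ _; rewrite integral0 => /fine_cvgP[_]; exact.
have D_cvg r : (fun n => D n r) @ \oo --> v (xi r, r).
  apply/cvgrPdist_le => k k0.
  have k20 : 0 < k / 2 by rewrite divr_gt0.
  have [d d0 Hd] := (continuous_epsP _ _).1 ((cv.1 r).1 (xi r)) _ k20.
  have d20 : 0 < d / 2 by rewrite divr_gt0.
  have [n0 _ Hn0] := near_infty_natSinv_lt (PosNum d20).
  exists n0 => // n /= /Hn0/=; rewrite -/(eps n) ltr_pdivlMr// mulrC => en.
  have <- : 2 * (k / 2) = k by rewrite mulrC divfK// pnatr_eq0.
  rewrite distrC.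
  apply: bump_average_close; [exact: (cv.1 r).1|exact: eps0|].
  by move=> x hx; apply: Hd; exact: le_lt_trans en.
have lim1 : (fun n => D n t - D n s - m / 2 * (t - s)) @ \oo -->
    v (xi t, t) - v (xi s, s) - m / 2 * (t - s).
  by apply: cvgB; [apply: cvgB; exact: D_cvg|exact: cvg_cst].
have lim2 : (fun n => D n t - D n s - m / 2 * (t - s)) @ \oo --> (0 : R).
  by under eq_fun do rewrite -FTC.
apply/eqP; rewrite -subr_eq0; apply/eqP.
rewrite -(cvg_lim (@Rhausdorff R) lim1).
exact: (cvg_lim (@Rhausdorff R) lim2).
Qed.

End VelocityAlongCharacteristics.

(** * The explicit characteristics *)

Section InitialLabels.
Context {R : realType} (mub : finBorel R).
Implicit Types (a b x y e d : R).

(* The mass that [mub] carries to the left of the starting point [xbar mub a];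
   it is constant along the characteristic of [a]. *)
Definition label a : R := a - xbar mub a.

Lemma label_cdf a : cdfl mub (xbar mub a) <= label a /\ label a <= cdf mub (xbar mub a).
Proof.
have [] := xbarP mub a; rewrite cdfE cdflE -!EFinD !lee_fin /label => h1 h2.
by split; lra.
Qed.

Lemma xbar_homo a b : a <= b -> xbar mub a <= xbar mub b.
Proof.
move=> ab; rewrite leNgt; apply/negP => h.
have [h1 _] := label_cdf a; have [_ h2] := label_cdf b.
by have := @cdf_le_cdfl R mub _ _ h; move: h1 h2; rewrite /label; lra.
Qed.

(** Where [xbar] stays put the label grows with the parameter; levels found at two distinct points
    are ordered like the points. *)
Lemma label_homo a b : a <= b -> label a <= label b.
Proof.
move=> ab; have := xbar_homo ab; rewrite le_eqVlt => /orP[/eqP h|h].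
  by rewrite /label -h lerD2r.
have [_ h1] := label_cdf a; have [h2 _] := label_cdf b.
by apply: le_trans h1 (le_trans _ h2); exact: cdf_le_cdfl.
Qed.

Lemma label_ge0 a : 0 <= label a.
Proof. by have [h _] := label_cdf a; exact: le_trans (cdfl_ge0 _ _) h. Qed.

Lemma label_le_mass a : label a <= mass mub.
Proof. by have [_ h] := label_cdf a; exact: le_trans h (cdf_le_mass _ _). Qed.

(** [xbar] and [label] are nondecreasing and add up to the identity, so each is 1-Lipschitz. *)
Lemma increment_xbar a b : a <= b -> xbar mub b - xbar mub a <= b - a.
Proof. by move=> ab; have := label_homo ab; rewrite /label; lra. Qed.

Lemma increment_label a b : a <= b -> label b - label a <= b - a.
Proof. by move=> ab; have := xbar_homo ab; rewrite /label; lra. Qed.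

Lemma lipschitz_continuous (f : R -> R) : {homo f : x y / x <= y} ->
  (forall x y, x <= y -> f y - f x <= y - x) -> continuous f.
Proof.
move=> hf lf x; apply/continuous_epsP => e e0; exists e => // y.
have [xy|yx] := leP x y.
  rewrite !ger0_norm ?subr_ge0 ?hf// => h; apply: le_trans (lf _ _ xy) _.
  exact: ltW.
have yx' := ltW yx.
rewrite distrC [`|f y - f x|]distrC !ger0_norm ?subr_ge0 ?hf// => h.
by apply: le_trans (lf _ _ yx') _; exact: ltW.
Qed.

Lemma xbar_continuous : continuous (xbar mub).
Proof. by apply: lipschitz_continuous; [exact: xbar_homo|exact: increment_xbar]. Qed.

Lemma label_continuous : continuous label.
Proof. by apply: lipschitz_continuous; [exact: label_homo|exact: increment_label]. Qed.

Lemma label_Ny e : 0 < e -> exists a, label a <= e.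
Proof.
(* The point [x] serves as the parameter as well: [label_ge0] gives [xbar mub x <= x]. *)
move=> e0; have [x hx] := cdf_Ny mub e0; exists x.
have [_ h] := label_cdf x; apply: le_trans h (le_trans _ hx); apply: cdf_homo.
by have := label_ge0 x; rewrite /label subr_ge0.
Qed.

End InitialLabels.

Section ExplicitCharacteristics.
Context {R : realType} (ub : R -> R) (mub : finBorel R).
Variables (v : R * R -> R) (ux : R -> R -> R) (nu : R -> finBorel R).
Implicit Types (a b x y z s t : R).

Definition solves_from := [/\ transported v nu, momentum_balance v ux nu,
  energy_density ux nu, forall x, v (x, 0) = ub x &
  forall A : set (borelR R), measurable A -> nu 0 A = mub A].

Hypothesis sol : solves_from.
Hypothesis cub : Cb ub.

Let y a t := ychar ub mub a t.
Let m a := label mub a.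

Lemma ychar0 a : ychar ub mub a 0 = xbar mub a.
Proof. by rewrite /ychar expr0n mulr0 !mul0r !addr0. Qed.

Lemma ychar_is_derive a t :
  is_derive t 1 (ychar ub mub a) (ub (xbar mub a) + t / 2 * (a - xbar mub a)).
Proof.
pose p := xbar mub a; pose w := ub p; pose k := a - p.
have d1 := is_deriveM (is_derive_id t 1) (is_derive_id t 1).
have d2 := is_deriveD (is_deriveD (is_derive_cst p t 1)
  (is_deriveM (is_derive_cst w t 1) (is_derive_id t 1)))
  (is_deriveM d1 (is_derive_cst (k / 4) t 1)).
have -> : ychar ub mub a = cst p + cst w * id + (id * id) * cst (k / 4).
  apply/funext => s; rewrite /ychar -/p -/w -/k /= /GRing.add/= /GRing.mul/=.
  by rewrite expr2 mulrA mulrAC.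
apply: is_derive_eq d2 _; rewrite /GRing.scale/= -/p -/w -/k.
by field.
Qed.

Lemma label_level0 a : level nu (m a) 0 (xbar mub a).
Proof.
have [_ _ _ _ n0] := sol; have := label_cdf mub a; rewrite /level /cdf /cdfl.
by rewrite !n0//; exact: measurable_itv.
Qed.

(** The level curve from [xbar mub a] is given abstractly, but its velocity is explicit: affine in
    time, with half the label as slope. Integration identifies the curve with the parabola [ychar],
    which inherits its properties. *)
Lemma ychar_level a t : level nu (m a) t (y a t) /\
  v (y a t, t) = ub (xbar mub a) + t / 2 * (a - xbar mub a).
Proof.
have [tv mb ed v0 _] := sol.
have [xi [dxi lxi xi0]] := level_curve tv mb ed (label_level0 a).
have H := velocity_along_level_curve mb ed tv dxi lxi.
have V s : v (xi s, s) = ub (xbar mub a) + s / 2 * (a - xbar mub a).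
  have V0 : v (xi 0, 0) = ub (xbar mub a) by rewrite xi0 v0.
  rewrite -V0 -/(label mub a) -/(m a).
  have arith (p q k r : R) : p - q = k / 2 * (r - 0) -> p = q + r / 2 * k.
    by move=> h; rewrite -[p](subrK q) h; field.
  have arith' (p q k r : R) : q - p = k / 2 * (0 - r) -> p = q + r / 2 * k.
    by move=> h; rewrite -[q](subrK p) h; field.
  have [s0|s0|->] := ltgtP s 0.
  - by apply: arith'; exact: H.
  - by apply: arith; exact: H.
  - by rewrite !mul0r addr0.
have xiE s : xi s = y a s.
  apply/eqP; rewrite -subr_eq0; apply/eqP.
  have dy (r : R) : is_derive r 1 (y a) (v (xi r, r)) by rewrite V; exact: ychar_is_derive.
  by rewrite (is_derive_constant_diff dxi dy) xi0 /y ychar0 subrr.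
by rewrite -xiE; split; [exact: lxi|exact: V].
Qed.

Lemma ychar_characteristic a t : is_derive t 1 (ychar ub mub a) (v (y a t, t)).
Proof. by rewrite (ychar_level a t).2; exact: ychar_is_derive. Qed.

(** The level condition forces on [xi] the velocity of [ychar] at equal times, so the two curves
    differ by a constant, which vanishes at time [0]. *)
Lemma characteristic_unique a (xi : R -> R) : (forall t, is_derive t 1 xi (v (xi t, t))) ->
  xi 0 = xbar mub a -> {ae leb R, forall t, level nu (m a) t (xi t)} ->
  xi = ychar ub mub a.
Proof.
move=> dxi xi0 lxi; have [tv mb ed _ _] := sol.
have E t : v (xi t, t) = v (y a t, t).
  apply: (@same_level_same_velocity R v ux nu (m a)) => //.
  - by move=> s; exact: is_derive_continuous (dxi s).
  - by move=> s; exact: is_derive_continuous (ychar_is_derive a s).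
  - by apply: (ae_imply2 lxi lxi) => s ls _; split=> //; exact: (ychar_level a s).1.
apply/funext => t; apply/eqP; rewrite -subr_eq0; apply/eqP.
have dy (r : R) : is_derive r 1 (y a) (v (xi r, r)) by rewrite E; exact: ychar_characteristic.
by rewrite (is_derive_constant_diff dxi dy) xi0 /y ychar0 subrr.
Qed.

(** Curves with different labels are ordered by the distribution function at time [t]; curves with
    the same label have equal velocities and keep their initial distance. *)
Lemma ychar_homo t : {homo y ^~ t : a b / a <= b}.
Proof.
move=> a b ab; have [tv mb ed _ _] := sol.
have := label_homo mub ab; rewrite le_eqVlt => /orP[/eqP mE|mlt]; last first.
  rewrite leNgt; apply/negP => yba.
  have [_ h1] := (ychar_level b t).1; have [h2 _] := (ychar_level a t).1.
  have := @cdf_le_cdfl R (nu t) _ _ yba.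
  by move=> h; move: (le_trans h1 (le_trans h h2)); rewrite /m leNgt mlt.
have E s : v (y a s, s) = v (y b s, s).
  apply: (@same_level_same_velocity R v ux nu (m a)) => //.
  - by move=> r; exact: is_derive_continuous (ychar_is_derive a r).
  - by move=> r; exact: is_derive_continuous (ychar_is_derive b r).
  - apply: aeW => r; split; first exact: (ychar_level a r).1.
    by rewrite /m mE; exact: (ychar_level b r).1.
have da (r : R) := ychar_characteristic a r.
have db (r : R) : is_derive r 1 (y b) (v (y a r, r)) by rewrite E; exact: ychar_characteristic.
have := is_derive_constant_diff da db t; rewrite /y !ychar0.
by have := xbar_homo mub ab; lra.
Qed.

Lemma ychar_continuous t : continuous (y ^~ t).
Proof.
move=> a; have cx := @xbar_continuous R mub a.
have cu : {for a, continuous (fun a => ub (xbar mub a))}.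
  apply: (@continuous_comp _ _ _ (xbar mub) ub) => //; exact: cub.1.
rewrite /y /ychar; apply: cvgD; first apply: cvgD => //.
  by apply: cvgM; [exact: cu|exact: cvg_cst].
apply: cvgM; first exact: cvg_cst.
exact: label_continuous.
Qed.

Lemma ychar_near t : exists C : R, forall a, `|y a t - a| <= C.
Proof.
have [_ [K HK]] := (CbP _).1 cub.
exists (mass mub + K * `|t| + t ^+ 2 / 4 * mass mub) => a.
have E : y a t - a = - label mub a + ub (xbar mub a) * t + t ^+ 2 / 4 * label mub a.
  by rewrite /y /ychar /label; ring.
have la : `|label mub a| <= mass mub by rewrite ger0_norm ?label_ge0// label_le_mass.
rewrite E; apply: le_trans (ler_normD _ _) _; apply: lerD.
  apply: le_trans (ler_normD _ _) _; rewrite normrN; apply: lerD => //.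
  by rewrite normrM ler_wpM2r.
have t4 : 0 <= t ^+ 2 / 4 by rewrite divr_ge0// sqr_ge0.
by rewrite normrM (ger0_norm t4) ler_wpM2l.
Qed.

(** The displacement [y a t - a] is bounded in [a], so [y ^~ t] passes [x] on both sides and the
    intermediate value theorem applies. *)
Lemma ychar_surjective t x : exists a, x = y a t.
Proof.
have [C HC] := ychar_near t.
have h1 : y (x - C) t <= x by have := HC (x - C); rewrite ler_norml => /andP[_]; lra.
have h2 : x <= y (x + C) t by have := HC (x + C); rewrite ler_norml => /andP[+ _]; lra.
have C0 : 0 <= C by exact: le_trans (HC 0).
have ab : x - C <= x + C by lra.
have [||c _ <-] := @IVT R (y ^~ t) (x - C) (x + C) x ab; last by exists c.
- by apply: continuous_subspaceT; exact: ychar_continuous.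
- rewrite ge_min h1/= le_max h2 orbT//.
Qed.

End ExplicitCharacteristics.

(** * The formula for the measure *)

Section LipschitzDensity.
Context {R : realType}.
Implicit Types (a b x e : R).

Lemma stieltjes_itvoc (F : cumulative R R) a b : a <= b ->
  lebesgue_stieltjes_measure F `]a, b]%classic = (F b - F a)%:E.
Proof.
move=> ab; rewrite /lebesgue_stieltjes_measure /measure_extension/=.
by rewrite measurable_mu_extE/= ?wlength_itv_bnd//; exact: is_ocitv.
Qed.

Lemma measure_half_line (m : {measure set (borelR R) -> \bar R}) (F : R -> R) :
  (forall a b, a <= b -> m `]a, b]%classic = (F b - F a)%:E) ->
  (forall x, 0 <= F x) -> {homo F : x y / x <= y} ->
  (forall e, 0 < e -> exists x, F x <= e) ->
  forall b, m `]-oo, b]%classic = (F b)%:E.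
Proof.
move=> mF F0 hF FN b; apply/eqP; rewrite eq_le; apply/andP; split.
- pose E n : set (borelR R) := `]b - n%:R, b]%classic.
  have UE : \bigcup_n E n = `]-oo, b]%classic.
    apply/seteqP; split => [x [n _]|x]; rewrite /E/= !in_itv/=.
      by move=> /andP[].
    move=> xb; exists (Num.bound `|b - x|) => //=; rewrite in_itv/= xb andbT.
    by have := archi_boundP (normr_ge0 (b - x)); have := ler_norm (b - x); lra.
  have cE : m \o E @ \oo --> m (\bigcup_n E n).
    apply: nondecreasing_cvg_mu.
    - by move=> i; exact: measurable_itv.
    - by rewrite UE; exact: measurable_itv.
    - move=> i j ij; apply/subsetPset; apply: subset_itvr; rewrite bnd_simp.
      by rewrite lerD2l lerN2 ler_nat.
  rewrite UE in cE; apply: (cvge_to_le cE); apply: nearW => n /=.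
  by rewrite /E mF ?lerBlDr ?lerDl// lee_fin gerBl.
- apply/lee_addgt0Pr => e e0; have [x xe] := FN e e0.
  have [xb|bx] := leP x b; last first.
    apply: (@le_trans _ _ e%:E); first by rewrite lee_fin (le_trans _ xe)// hF// ltW.
    by rewrite leeDr.
  have : (m `]x, b]%classic <= m `]-oo, b]%classic)%E.
    apply: le_measure; rewrite ?inE; [exact: measurable_itv..|].
    by apply: subset_itvr; rewrite bnd_simp.
  rewrite mF// => h; apply: (@le_trans _ _ ((F b - F x)%:E + e%:E)%E).
    by rewrite -EFinD lee_fin; move: xe; lra.
  by rewrite leeD2r.
Qed.

Lemma measure_setT_le (m : {measure set (borelR R) -> \bar R}) (M : R) :
  (forall b, (m `]-oo, b]%classic <= M%:E)%E) -> (m setT <= M%:E)%E.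
Proof.
move=> H; pose E n : set (borelR R) := `]-oo, n%:R]%classic.
have UE : \bigcup_n E n = setT.
  apply/seteqP; split => // x _; exists (Num.bound `|x|) => //=.
  rewrite /E/= in_itv/= (le_trans (ler_norm x))//.
  exact/ltW/archi_boundP.
have cE : m \o E @ \oo --> m (\bigcup_n E n).
  apply: nondecreasing_cvg_mu.
  - by move=> i; exact: measurable_itv.
  - by rewrite UE; exact: measurableT.
  - move=> i j ij; apply/subsetPset; apply: subset_itvl; rewrite bnd_simp.
    by rewrite ler_nat.
by rewrite UE in cE; apply: (cvge_to_le cE); apply: nearW => n /=; exact: H.
Qed.

Lemma eq_measure_half_lines (m1 m2 : {measure set (borelR R) -> \bar R}) (F : R -> R) :
  (forall b, m1 `]-oo, b]%classic = (F b)%:E) ->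
  (forall b, m2 `]-oo, b]%classic = (F b)%:E) ->
  forall A, measurable A -> m1 A = m2 A.
Proof.
have oc (m : {measure set (borelR R) -> \bar R}) :
    (forall b, m `]-oo, b]%classic = (F b)%:E) ->
    forall a b, a <= b -> m `]a, b]%classic = (F b - F a)%:E.
  move=> mF a b ab.
  have -> : `]a, b]%classic = `]-oo, b] `\` `]-oo, a] :> set (borelR R).
    by rewrite -[RHS]setCK setCD setCitvl setUC -[LHS]setCK setCitv.
  have bfin : (m `]-oo, b]%classic < +oo)%E by rewrite mF ltry.
  have ma : measurable (`]-oo, a] : set (borelR R)) by exact: measurable_itv.
  have mb : measurable (`]-oo, b] : set (borelR R)) by exact: measurable_itv.
  have sub : (`]-oo, a] : set (borelR R)) `<=` `]-oo, b].
    by apply: subset_itvl; rewrite bnd_simp.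
  transitivity (m `]-oo, b]%classic - m `]-oo, a]%classic)%E; last by rewrite !mF EFinB.
  by apply: etrans (measureD mb ma bfin) _; congr (_ - m _)%E; exact: setIidr.
move=> H1 H2 A mA; pose I n : set (borelR R) := `]- n%:R, n%:R]%classic.
have mG : @measurable _ (borelR R) = <<s @ocitv R >> by [].
have GI n : @ocitv R (I n) by exact: is_ocitv.
have UI : \bigcup_n I n = setT.
  apply/seteqP; split => // x _; exists (Num.bound `|(x : R)|) => //=.
  have := archi_boundP (normr_ge0 (x : R)); rewrite ltr_norml => /andP[h1 h2].
  by rewrite /I/= in_itv/= h1 (ltW h2).
have E X : @ocitv R X -> m1 X = m2 X.
  move=> [[a b]] /= _ <-; have [ab|ba] := leP a b; first by rewrite !oc.
  by rewrite set_itv_ge ?measure0// bnd_simp -leNgt ltW.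
have Ifin n : (m1 (I n) < +oo)%E.
  by rewrite oc// ?ltry// (@le_trans _ _ 0)// oppr_le0.
exact: (@measure_unique _ R (borelR R) (@ocitv R) I mG (@ocitvI R) GI UI m1 m2 E Ifin A mA).
Qed.

End LipschitzDensity.

Section LipschitzMeasure.
Context {R : realType} (f : R -> R) (M : R).
Implicit Types (a b x e : R).
Hypothesis f_homo : {homo f : x y / x <= y}.
Hypothesis f_lip : forall x y, x <= y -> f y - f x <= y - x.
Hypothesis f_ge0 : forall x, 0 <= f x.
Hypothesis f_le : forall x, f x <= M.
Hypothesis f_Ny : forall e, 0 < e -> exists x, f x <= e.

(* The Stieltjes measures of [f] and [id - f] add up to the Lebesgue measure,
   so the former is absolutely continuous. *)
Let F x := f x.
Let G x := x - f x.

Let G_homo : {homo G : x y / x <= y}.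
Proof. by move=> x y xy; have := f_lip xy; rewrite /G; lra. Qed.

Let F_continuous : continuous F.
Proof. exact: lipschitz_continuous. Qed.

Let G_continuous : continuous G.
Proof. by move=> x; apply: cvgB; [exact: cvg_id|exact: F_continuous]. Qed.

#[local] HB.instance Definition _ := isCumulative.Build R _ R F f_homo
  (right_continuousW F_continuous).

#[local] HB.instance Definition _ := isCumulative.Build R _ R G G_homo
  (right_continuousW G_continuous).

Let mF : {measure set (borelR R) -> \bar R} := lebesgue_stieltjes_measure F.
Let mG : {measure set (borelR R) -> \bar R} := lebesgue_stieltjes_measure G.

Let mFhalf b : mF `]-oo, b]%classic = (f b)%:E.
Proof.
apply: measure_half_line => //.
by move=> a' b' ab; rewrite /mF; exact: (stieltjes_itvoc (F : cumulative R R) ab).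
Qed.

Let mF_fin : fin_num_fun mF.
Proof.
move=> A mA; apply/fin_real/andP; split; first exact: lt_le_trans (measure_ge0 _ _).
apply: (@le_lt_trans _ _ (mF setT)); first by apply: le_measure; rewrite ?inE.
apply: (@le_lt_trans _ _ M%:E); last by rewrite ltry.
by apply: measure_setT_le => b; rewrite mFhalf lee_fin.
Qed.

Let mF_leb A : measurable A -> (mF A <= leb R A)%E.
Proof.
move=> mA; rewrite (lebesgue_measure_unique (mu := measure_add mF mG))//.
  by apply: (@le_trans _ _ (mF A + mG A)%E); [rewrite leeDl|rewrite -measure_addE].
move=> _ [[a b]] /= _ <-; transitivity (mF `]a, b]%classic + mG `]a, b]%classic)%E;
  last by rewrite -measure_addE.
have [ab|ba] := leP a b; last by rewrite set_itv_ge ?measure0 ?adde0// bnd_simp -leNgt ltW.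
have -> : mF `]a, b]%classic = (F b - F a)%:E.
  exact: (stieltjes_itvoc (F : cumulative R R) ab).
have -> : mG `]a, b]%classic = (G b - G a)%:E.
  exact: (stieltjes_itvoc (G : cumulative R R) ab).
rewrite -EFinD; apply: etrans (stieltjes_itvoc (idfun : cumulative R R) ab) _.
by congr (_%:E); rewrite /G /F /=; lra.
Qed.

(** Radon-Nikodym provides a density of the Stieltjes measure. Since [f] tends to zero at minus
    infinity, it is the integral of this density from there, and Lebesgue differentiation identifies
    its derivative almost everywhere. *)
Lemma lipschitz_density : exists (m : {finite_measure set (borelR R) -> \bar R})
    (g : R -> R), [/\ forall b, m `]-oo, b]%classic = (f b)%:E,
  measurable_fun [set: borelR R] (EFin \o g : borelR R -> \bar R),
  forall A, measurable A -> m A = (\int[leb R]_(x in A) (g x)%:E)%E &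
  {ae leb R, forall x, derivable f x 1 /\ derive1 f x = g x}].
Proof.
pose m : {finite_measure set (borelR R) -> \bar R} :=
  HB.pack (lebesgue_stieltjes_measure (F : cumulative R R))
    (Measure_isFinite.Build _ _ _ (lebesgue_stieltjes_measure F) mF_fin).
have dom : m `<< leb R.
  apply/null_content_dominatesP => A mA A0; apply/eqP; rewrite -measure_le0.
  by rewrite -A0; exact: mF_leb.
have [h [h0 hfin hint hm]] := radon_nikodym_sigma_finite dom.
have hE : EFin \o (fine \o h) = h by apply/funext => x /=; rewrite fineK.
exists m, (fine \o h); split => //.
- by rewrite hE; exact: measurable_int hint.
- by move=> A mA; rewrite hm//; apply: eq_integral => x _ /=; rewrite fineK.
have FE : (fun x => (\int[leb R]_(t in [set` `]-oo, x]]) (fine \o h) t)%R) = f.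
  apply/funext => x; rewrite /Rintegral.
  have mx : measurable (`]-oo, x] : set (borelR R)) by exact: measurable_itv.
  under eq_integral do rewrite /= fineK//.
  by rewrite -hm//= mFhalf.
have := @FTC1Ny R (fine \o h); rewrite FE; apply.
- move=> y; rewrite hE; apply: integrableS hint => //.
- apply: open_integrable_locally; first exact: openT.
  by rewrite hE.
Qed.

End LipschitzMeasure.

(** * Integrals of functions equal almost everywhere to measurable ones *)

Section AlmostEverywhereIntegral.
Import HBNNSimple.
Local Open Scope ereal_scope.
Context d (T : measurableType d) (R : realType) (mu : {measure set T -> \bar R}).

(* [f] need not be measurable: the integral of a nonnegative function is the
   supremum of the integrals of the simple functions below it, and these are
   insensitive to null sets. *)
Lemma ge0_integral_ae_measurable (A : set T) (f g : T -> \bar R) : measurable A ->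
  measurable_fun setT g -> (forall x, 0 <= f x) -> (forall x, 0 <= g x) ->
  {ae mu, forall x, f x = g x} ->
  \int[mu]_(x in A) f x = \int[mu]_(x in A) g x.
Proof.
move=> mA mg f0 g0 [N [mN N0 HN]].
have mgA : measurable_fun A g by exact: measurable_funS mg.
have AN : measurable (A `\` N) by exact: measurableD.
have fgN x : (A `\` N) x -> f x = g x by move=> [_ nN]; apply: contrapT => h; apply: nN; exact: HN.
apply/eqP; rewrite eq_le; apply/andP; split.
- rewrite ge0_integralE//; apply: ge_ereal_sup => _ [h /= hf <-].
  rewrite -(integralT_nnsfun mu h).
  have mh : measurable_fun setT (fun x => (h x)%:E) by apply/measurable_EFinP.
  have h0 x : 0 <= (h x)%:E by rewrite lee_fin.
  have hA : \int[mu]_x (h x)%:E = \int[mu]_(x in A) (h x)%:E.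
    rewrite [RHS]integral_mkcond; apply: eq_integral => x _; rewrite patchE.
    case: ifPn => // xA; apply/eqP; rewrite eq_le h0 andbT.
    by apply: le_trans (hf x) _; rewrite patchE (negbTE xA).
  rewrite hA (ge0_negligible_integral mN mA (measurable_funS _ _ mh) _ N0)//.
  rewrite (ge0_negligible_integral mN mA mgA _ N0)//.
  apply: ge0_le_integral => //.
  + exact: measurable_funS mh.
  + exact: measurable_funS mg.
  + move=> x xAN; rewrite -fgN//; have := hf x; rewrite patchE.
    by case: ifPn => // /negP; rewrite inE; case: xAN.
- rewrite (ge0_negligible_integral mN mA mgA _ N0)// !ge0_integralE//.
  apply: le_ereal_sup => _ [h /= hg <-]; exists h => //= x.
  apply: le_trans (hg x) _; rewrite !patchE; case: ifPn => [|_].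
    by rewrite inE => xAN; case: (xAN) => xA _; rewrite mem_set// fgN.
  by case: ifPn.
Qed.

Lemma integral_ae_measurable (A : set T) (f g : T -> \bar R) : measurable A ->
  measurable_fun setT g -> {ae mu, forall x, f x = g x} ->
  \int[mu]_(x in A) f x = \int[mu]_(x in A) g x.
Proof.
move=> mA mg fg; rewrite integralE [RHS]integralE; congr (_ - _);
  apply: ge0_integral_ae_measurable => //.
- exact: measurable_funepos.
- case: fg => N [mN N0 HN]; exists N; split=> // x /= h; apply: HN => fgx.
  by apply: h; rewrite !funeposE fgx.
- exact: measurable_funeneg.
- case: fg => N [mN N0 HN]; exists N; split=> // x /= h; apply: HN => fgx.
  by apply: h; rewrite !funenegE fgx.
Qed.

End AlmostEverywhereIntegral.

Section MeasureFormula.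
Context {R : realType} (ub : R -> R) (mub : finBorel R).
Variables (v : R * R -> R) (ux : R -> R -> R) (nu : R -> finBorel R).
Implicit Types (a b x y z s t : R).
Hypothesis sol : solves_from ub mub v ux nu.
Hypothesis cub : Cb ub.

(** [fdens] is almost everywhere the derivative of [label], as [xbar] is the identity minus [label].
    Its values on the null set where the derivative fails are arbitrary defaults, so it is replaced
    under the integral by the measurable Radon-Nikodym density. *)
Lemma fdens_integral : exists m : {finite_measure set (borelR R) -> \bar R},
  (forall b, m `]-oo, b]%classic = (label mub b)%:E) /\
  forall A, measurable A -> m A = (\int[leb R]_(a in A) (fdens mub a)%:E)%E.
Proof.
have [m [g [mh mg mE dg]]] := lipschitz_density (@label_homo R mub)
  (@increment_label R mub) (@label_ge0 R mub) (@label_le_mass R mub)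
  (@label_Ny R mub).
exists m; split=> // A mA; rewrite mE//; apply/esym/integral_ae_measurable => //.
apply: (ae_imply2 dg dg) => a [da <-] _; congr (_%:E).
have dl : is_derive a 1 (label mub) (derive1 (label mub) a).
  by apply: DeriveDef => //; rewrite derive1E.
rewrite /fdens; have -> : xbar mub = (fun b : R => b - label mub b).
  by apply/funext => b; rewrite /label subKr.
by rewrite (is_derive_derive1 (is_deriveB (is_derive_id a 1) dl)) subKr.
Qed.

(** The preimage is a half-line by monotonicity and closed by continuity. Its endpoint [a] is the
    largest parameter sent to [x], so its label is the highest level at [x], namely
    [cdf (nu t) x]. *)
Lemma ychar_preimage_half_line t x : exists a,
  (fun b => ychar ub mub b t) @^-1` `]-oo, x]%classic = `]-oo, a]%classic /\
  label mub a = cdf (nu t) x.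
Proof.
pose y b := ychar ub mub b t; pose S := [set b | y b <= x].
have [C HC] := ychar_near mub cub t.
have [b0 Eb0] := ychar_surjective mub cub t x.
have SU : has_sup S.
  split; first by exists b0; rewrite /S/= /y -Eb0.
  exists (x + C) => b; rewrite /S/= => yx; have := HC b.
  by rewrite ler_norml => /andP[+ _]; move: yx; rewrite /y; lra.
pose a := sup S; have y_homo := ychar_homo sol t.
have Sa b : b < a -> y b <= x.
  by move=> /(sup_gt SU.1)[c Sc bc]; apply: le_trans Sc; apply: y_homo; exact: ltW.
have aS b : y b <= x -> b <= a by move=> h; exact: (ub_le_sup SU.2).
have ya : y a <= x.
  apply/ler_addgt0Pr => e e0.
  have [d d0 Hd] := (continuous_epsP _ _).1 (@ychar_continuous R ub mub cub t a) _ e0.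
  have d20 : 0 < d / 2 by rewrite divr_gt0.
  have h1 : y (a - d / 2) <= x by apply: Sa; rewrite ltrBlDr ltrDl.
  have := Hd (a - d / 2); rewrite addrAC subrr sub0r normrN gtr0_norm//.
  rewrite gtr_pMr// invf_lt1// ltr1n => /(_ isT); rewrite ler_norml => /andP[+ _].
  by move: h1; rewrite /y; lra.
have yaE : y a = x.
  apply/eqP; rewrite eq_le ya/= Eb0; apply: y_homo; apply: aS.
  by rewrite /y -Eb0.
exists a; split.
  apply/seteqP; split=> b /=; rewrite !in_itv/=; first exact: aS.
  by move=> ba; apply: le_trans ya; exact: y_homo.
have [[_ la] _] := ychar_level sol a t; rewrite -/(y a) yaE in la.
(* A larger parameter [a + e] is sent strictly to the right of [x], so its label is at least
   [cdf (nu t) x]; as the label is 1-Lipschitz, that of [a] falls short by at most [e]. *)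
apply/eqP; rewrite eq_le la/=; apply/ler_addgt0Pr => e e0.
have xy : x < y (a + e).
  by rewrite ltNge; apply/negP => /aS; rewrite gerDl leNgt e0.
have [[lb _] _] := ychar_level sol (a + e) t.
have := @increment_label R mub a (a + e); rewrite lerDl (ltW e0) => /(_ isT).
have := cdf_le_cdfl (nu t) xy; move: lb; rewrite -/(y (a + e)).
by move: (label mub a) (label mub (a + e)) => p q; lra.
Qed.

(** Both sides are measures with the same distribution function: the push-forward gives []-oo, x]]
    the mass [label mub a] of its preimage. *)
Lemma solution_measure_formula t (A : set (borelR R)) : measurable A ->
  nu t A = mu_formula ub mub t A.
Proof.
move=> mA; have [m [mh mE]] := fdens_integral.
pose y : borelR R -> borelR R := fun b => ychar ub mub b t.
have my : measurable_fun setT y.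
  by apply: continuous_measurable_fun; exact: ychar_continuous.
have my' : measurable (y @^-1` A) by rewrite -[X in measurable X]setTI; exact: my.
rewrite /mu_formula /pushforward -mE//.
pose P : {measure set (borelR R) -> \bar R} :=
  @measure_function_pushforward__canonical__measure_function_Measure _ _ _ _ _ m y my.
apply: (@eq_measure_half_lines R (nu t) P (cdf (nu t))) => // [x|x].
  exact: cdfE.
have [a [Ea la]] := ychar_preimage_half_line t x.
by rewrite /P /= /pushforward Ea mh la.
Qed.

End MeasureFormula.

Lemma conservative_solves_from (R : realType) (ub : R -> R) (mub : finBorel R)
    (v : R * R -> R) (nu : R -> finBorel R) :
  conservative_solution ub mub v nu -> exists ux, solves_from ub mub v ux nu.
Proof.
by move=> [ux [[cv _ _ Hux wnu] [v0 nu0 ed] mom tr _]]; exists ux; split=> //; split.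
Qed.

Theorem theorem3p2 (R : realType) (ub : R -> R) (mub : finBorel R)
    (v : R * R -> R) (nu : R -> finBorel R) :
  in_D ub mub ->
  conservative_solution ub mub v nu ->
  (exists! y1 : R -> R -> R, forall alpha : R,
     [/\ (forall t : R, is_derive t 1 (y1 alpha) (v (y1 alpha t, t))),
         y1 alpha 0 = xbar mub alpha &
         {ae leb R, forall t : R,
           (nu t `]-oo, y1 alpha t[%classic <= (alpha - xbar mub alpha)%:E)%E /\
           ((alpha - xbar mub alpha)%:E <= nu t `]-oo, y1 alpha t]%classic)%E}])
  /\
  (forall x t : R,
     (exists alpha : R, x = ychar ub mub alpha t) /\
     (forall alpha : R, x = ychar ub mub alpha t ->
        v (x, t) = derive1 (ychar ub mub alpha) t /\
        derive1 (ychar ub mub alpha) t =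
          ub (xbar mub alpha) + t / 2 * (alpha - xbar mub alpha)))
  /\
  (forall (t : R) (A : set (borelR R)), measurable A ->
     nu t A = mu_formula ub mub t A).
Proof.
move=> [cub _] /conservative_solves_from[ux sol].
split; [exists (ychar ub mub); split|split].
- move=> a; split; [exact: (ychar_characteristic sol)|exact: ychar0|].
  (* The explicit characteristics satisfy the level condition at every time, whereas a competitor is
     only assumed to satisfy it at almost every time. *)
  apply: aeW => t; have [[h1 h2] _] := ychar_level sol a t.
  by rewrite cdfE cdflE !lee_fin.
- move=> y1 Hy1; apply/funext => a; have [dy y0 ly] := Hy1 a.
  apply/esym/(characteristic_unique sol) => //.
  apply: (ae_imply2 ly ly) => t [h1 h2] _.
  by move: h1 h2; rewrite cdfE cdflE !lee_fin.
- move=> x t; split; first exact: ychar_surjective.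
  move=> a ->; rewrite (is_derive_derive1 (ychar_is_derive ub mub a t)).
  by split=> //; exact: (ychar_level sol a t).2.
- by move=> t A mA; exact: (solution_measure_formula sol).
Qed.
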